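(* Let $I\subset\mathbb{R}$ be a bounded interval, let $m,k,d\ge 1$, and let $\beta,\gamma\in(0,1]$ with $\beta(2+\gamma)>2$. Let $g=(g^i)_{i=1}^k\in C^{\beta}(I^m;\mathbb{R}^k)$ be such that for every $i\neq j$ in $\{1,\dots,k\}$ and every rectangle $Q\subseteq I^m$ with sides parallel to the coordinate axes $$\int_{\partial Q} g^i\,\mathrm{d}g^j=0 .$$ Let $f\colon I^m\times\mathbb{R}^d\to\mathbb{R}^{d\times k}$ be $(g,x^d)$-differentiable, i.e. differentiable with respect to the map $(x^m,x^d)\in I^m\times\mathbb{R}^d\mapsto (g(x^m),x^d)\in\mathbb{R}^{k+d}$, with $$\mathbb{D}_{(g,x^d)}f=(\mathbb{D}_g f,\mathbb{D}_{x^d}f)\in C^{\gamma}\big(I^m\times\mathbb{R}^d;\mathbb{R}^{(dk)\times(k+d)}\big).$$ Then, for every $(p_0,\vartheta)\in I^m\times\mathbb{R}^d$, there exists a unique $\theta\in C^{\beta}(I^m;\mathbb{R}^d)$ such that $\theta_{p_0}=\vartheta$ and $$\delta\theta_{pq}=f(p,\theta_p)\,\delta g_{pq}+o(\delta_{pq})\qquad\text{for } p,q\in I^m .$$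
   Context: Notation: for a function $u$ and points $p,q$ of its domain, $u_p:=u(p)$, $\delta u_{pq}:=u_q-u_p$, $\delta_{pq}:=q-p$. $C^{\alpha}(X;\mathbb{R}^n)$, $\alpha\in(0,1]$, is the space of $u\colon X\to\mathbb{R}^n$ with $\sup_X|u|+\sup_{x\ne y}|u_y-u_x|/|y-x|^{\alpha}<\infty$ (for $\alpha=1$: bounded Lipschitz functions). A function $R$ of pairs $(p,q)$ is $o(\delta_{pq})$ if it vanishes for $p=q$ and $\sup_{0<|q-p|\le\varepsilon}|R_{pq}|/|q-p|\to0$ as $\varepsilon\to0$. Differentiability with respect to a map: let $X\subseteq\mathbb{R}^N$ be convex and $G\colon X\to\mathbb{R}^K$ continuous. A map $u\colon X\to\mathbb{R}^M$ is $G$-differentiable if there is a continuous matrix-valued $\mathbb{D}_G u=(\partial_{G^i}u^j)\colon X\to\mathbb{R}^{M\times K}$ (a $G$-derivative, not necessarily unique) with $\delta u_{xy}=(\mathbb{D}_G u)_x\,\delta G_{xy}+o(\delta_{xy})$ for $x,y\in X$. Here $\mathbb{D}_g f$ and $\mathbb{D}_{x^d}f$ denote the blocks of $\mathbb{D}_{(g,x^d)}f$ corresponding to the components $g$ and $x^d$. Integrals: for $u\in C^{\alpha}$, $w\in C^{\beta}$ with $\alpha+\beta>1$, $\int_{[pq]}u\,\mathrm{d}w$ is the Young integral $\int_0^1 (u\circ\gamma)\,\mathrm{d}(w\circ\gamma)$, $\gamma(t)=(1-t)p+tq$. A rectangle with sides parallel to the axes is $Q=[p;v_1,v_2]$, with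 $v_1,v_2$ parallel to canonical basis vectors, and $\int_{\partial Q}$ is the sum of the integrals over the oriented segments $[p(p+v_1)]$, $[(p+v_1)(p+v_1+v_2)]$, $[(p+v_1+v_2)(p+v_2)]$, $[(p+v_2)p]$. $Q\subseteq I^m$ means that the convex hull of its four vertices lies in $I^m$. *)

(* Defs.v *)
From HB Require Import structures.
From mathcomp Require Import all_boot all_order all_algebra.
From mathcomp Require Import all_classical all_reals all_analysis.

Set Implicit Arguments.
Unset Strict Implicit.
Unset Printing Implicit Defensive.

Import Order.TTheory GRing.Theory Num.Theory.
Import numFieldNormedType.Exports.

Local Open Scope classical_set_scope.
Local Open Scope ring_scope.

(* A map defined on a subset X of R^N is encoded by a total function that is
   only ever constrained on X.  Points of R^n are column vectors, R^m x R^d is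
   the product of normed modules.  The library norms on matrices and products
   are sup norms; they are equivalent to the Euclidean ones, and the notions
   below only depend on the norms up to equivalence. *)

Definition holder_on {R : realType} {V W : normedModType R}
    (alpha : R) (X : set V) (u : V -> W) : Prop :=
  (exists B : R, forall x, X x -> `|u x| <= B) /\
  (exists C : R, forall x y, X x -> X y -> x != y ->
     `|u y - u x| / `|y - x| `^ alpha <= C).

(* Rem p q = o(q - p), uniformly over p, q in X. *)
Definition little_o_on {R : realType} {V W : normedModType R}
    (X : set V) (Rem : V -> V -> W) : Prop :=
  (forall p, X p -> Rem p p = 0) /\
  (forall eta : R, 0 < eta -> exists2 eps : R, 0 < eps &
     forall p q, X p -> X q -> 0 < `|q - p| <= eps ->
       `|Rem p q| / `|q - p| <= eta).

(* D is a G-derivative of u on X. *)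
Definition is_gderivative {R : realType} {V : normedModType R} {K M : nat}
    (X : set V) (G : V -> 'cV[R]_K) (u : V -> 'cV[R]_M)
    (D : V -> 'M[R]_(M, K)) : Prop :=
  {within X, continuous D} /\
  little_o_on X (fun x y => (u y - u x) - D x *m (G y - G x)).

(* Sum of u(t_i) (w(s_{i+1}) - w(s_i)) over the partition a :: s with tags t. *)
Definition stieltjes_sum {R : realType} (u w : R -> R)
    (a : R) (s : seq R) (t : nat -> R) : R :=
  \sum_(i < size s) u (t i) * (w (nth 0 (a :: s) i.+1) - w (nth 0 (a :: s) i)).

(* l is the limit of these sums as the mesh tends to 0. *)
Definition is_young_integral {R : realType} (u w : R -> R) (a b l : R) : Prop :=
  forall e : R, 0 < e -> exists2 h : R, 0 < h &
    forall (s : seq R) (t : nat -> R), itv_partition a b s ->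
      (forall i, (i < size s)%N ->
         nth 0 (a :: s) i.+1 - nth 0 (a :: s) i < h /\
         nth 0 (a :: s) i <= t i <= nth 0 (a :: s) i.+1) ->
      `|stieltjes_sum u w a s t - l| < e.

(* Total operator, with value 0 when the limit does not exist. *)
Definition young_integral {R : realType} (u w : R -> R) (a b : R) : R :=
  xget 0 [set l | is_young_integral u w a b l].

Definition segment_integral {R : realType} {V : normedModType R}
    (u w : V -> R) (p q : V) : R :=
  let gam (t : R) : V := (1 - t) *: p + t *: q in
  young_integral (u \o gam) (w \o gam) 0 1.

Definition parallelogram_boundary_integral {R : realType} {V : normedModType R}
    (u w : V -> R) (p v1 v2 : V) : R :=
  segment_integral u w p (p + v1) +
  segment_integral u w (p + v1) (p + v1 + v2) +
  segment_integral u w (p + v1 + v2) (p + v2) +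
  segment_integral u w (p + v2) p.

Definition finite_convex_hull {R : realType} {V : normedModType R}
    (s : seq V) : set V :=
  [set x | exists l : 'I_(size s) -> R,
     [/\ forall i, 0 <= l i, \sum_i l i = 1 & x = \sum_i l i *: s`_i]].

Definition parallel_to_axis {R : realType} {m : nat} (v : 'cV[R]_m) : Prop :=
  exists (i : 'I_m) (c : R), v = c *: delta_mx i 0.

Definition axis_rectangle_in {R : realType} {m : nat}
    (X : set 'cV[R]_m) (p v1 v2 : 'cV[R]_m) : Prop :=
  [/\ parallel_to_axis v1, parallel_to_axis v2 &
      finite_convex_hull [:: p; p + v1; p + v1 + v2; p + v2] `<=` X].

Definition cube {R : realType} (m : nat) (I : set R) : set 'cV[R]_m :=
  [set x | forall i, I (x i 0)].

(* The map (x^m, x^d) |-> (g(x^m), x^d). *)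
Definition extend_map {R : realType} {m k d : nat}
    (g : 'cV[R]_m -> 'cV[R]_k) (x : 'cV[R]_m * 'cV[R]_d) : 'cV[R]_(k + d) :=
  col_mx (g x.1) x.2.

(* The entries of a d x k matrix listed as a vector of R^(d * k). *)
Definition flatten_mx {R : realType} {d k : nat} (A : 'M[R]_(d, k)) :
  'cV[R]_(d * k) := (mxvec A)^T.

Definition is_solution {R : realType} {m k d : nat} (I : set R) (beta : R)
    (g : 'cV[R]_m -> 'cV[R]_k)
    (f : 'cV[R]_m * 'cV[R]_d -> 'M[R]_(d, k))
    (p0 : 'cV[R]_m) (vartheta : 'cV[R]_d)
    (theta : 'cV[R]_m -> 'cV[R]_d) : Prop :=
  [/\ holder_on beta (cube I) theta,
      theta p0 = vartheta &
      little_o_on (cube I)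
        (fun p q => (theta q - theta p) - f (p, theta p) *m (g q - g p))].

(* Main.v *)
Require Import Defs.
From HB Require Import structures.
From mathcomp Require Import all_boot all_order all_algebra.
From mathcomp Require Import all_classical all_reals all_analysis.
From mathcomp Require Import ring lra.

Set Implicit Arguments.
Unset Strict Implicit.
Unset Printing Implicit Defensive.

Import Order.TTheory GRing.Theory Num.Theory.
Import numFieldNormedType.Exports.

Local Open Scope classical_set_scope.
Local Open Scope ring_scope.

(** Why the theorem holds. Write [h] for the length of a segment [[p, q]] of the
    cube, [kappa = beta (1 + gamma)] and [zeta = beta (2 + gamma)]; the hypothesis
    [zeta > 2] forces [kappa > 1].

    Along a single segment the equation is a Young equation, and it is solved by
    composing the Euler maps [a |-> a + f (p, a) (g q - g p)] along dyadic
    subdivisions. Two consecutive half steps differ from the full step by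
    [O (h ^ kappa)] with [kappa > 1], so the compositions converge
    ([dyadic_flow]); since [f] is differentiable in the state with a Hoelder
    derivative, the limit maps [phi p q] are moreover Lipschitz with constant
    [1 + O (h ^ beta)]. Everything then amounts to the consistency of these
    maps on triangles, [phi q r (phi p q a) = phi p r a]: given that,
    [theta p = phi p0 p vartheta] satisfies [theta q = phi p q (theta p)], hence the
    equation, and any other solution follows the flow and coincides with
    [theta] ([flow_trajectory]).

    Consistency is a nonlinear Stokes argument ([flow_property]). A triangle is
    cut into four triangles of half the size, so a defect of order [h ^ zeta] is
    divided by about [2 ^ zeta] while the number of triangles is multiplied by
    [4]; as [zeta > 2], the total defect of the small triangles tends to zero. To
    see that the defect has this order, [phi] is compared with the second-order
    maps [davie], which involve the iterated integrals of [g] along [[p, q]].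
    Their defect is [O (h ^ zeta)] as soon as these second-level increments satisfy
    Chen's relation for all triples of points, which is automatic when the
    one-forms [g_i dg_j] have potentials on the cube. This is where the
    hypothesis on rectangles enters: it makes the integral of [g_i dg_j] along
    staircases a function of the end point ([closed_form_potential]); for [i = j]
    the potential is [g_i ^ 2 / 2].

    Two reductions complete the argument. The assumption that [f] is
    differentiable with an error [o (h)] improves by itself to Taylor bounds with
    explicit powers ([gderivative_taylor]), by the bisection principle that drives
    the whole proof ([bisection_bound]): a quantity that is [o (h ^ r)] and that
    grows by a factor at most [2 ^ r] from scale [h / 2] to scale [h], up to a
    source [O (h ^ s)] with [s > r], is [O (h ^ s)]. And since [f] grows linearly, it is
    replaced by a bounded field that agrees with it on a large ball of the state
    space; the growth bound of the flow ([dyadic_growth]) is the same for all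
    these truncations, so the radius can be fixed in advance. *)

(** * Powers, midpoints and the bisection principle *)

Section Powers.
Context {R : realType}.
Implicit Types x y r s : R.

Lemma le_of_eq x y : x = y -> x <= y.
Proof. by move=> ->. Qed.

Lemma powR_half x s : 0 <= x -> (x / 2) `^ s = x `^ s / 2 `^ s.
Proof.
move=> x0; rewrite powRM ?invr_ge0//; congr (_ * _).
by rewrite -powR_inv1// powRAC powR_inv1// powR_ge0.
Qed.

Lemma powRDge0 x r s : 0 < r -> 0 < s -> x `^ (r + s) = x `^ r * x `^ s.
Proof. by move=> r0 s0; apply: powRD; rewrite gt_eqF ?addr_gt0. Qed.

Lemma powR_mono x y s : 0 <= s -> 0 <= x -> x <= y -> x `^ s <= y `^ s.
Proof.
by move=> s0 x0 xy; apply: ge0_ler_powR; rewrite ?nnegrE// (le_trans x0).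
Qed.

Lemma powR_anti x r s : 0 < r -> r <= s -> 0 <= x <= 1 -> x `^ s <= x `^ r.
Proof.
move=> r0 rs /andP[]; rewrite le_eqVlt => /predU1P[<- _|x0 x1].
  by rewrite !powR0 ?gt_eqF// (lt_le_trans r0).
by apply: ger_powR => //; rewrite x0.
Qed.

Lemma powR_le1 x s : 0 < s -> 0 <= x <= 1 -> x `^ s <= 1.
Proof.
by move=> s0 /andP[x0 x1]; have := powR_mono (ltW s0) x0 x1; rewrite powR1.
Qed.

Lemma powR_small s (e : R) : 0 < s -> 0 < e ->
  exists2 d : R, 0 < d & forall x, 0 <= x <= d -> x `^ s <= e.
Proof.
move=> s0 e0; exists (e `^ s^-1); first exact: powR_gt0.
move=> x /andP[x0 xd].
by rewrite (le_trans (powR_mono (ltW s0) x0 xd))// -powRrM mulVf ?gt_eqF// powRr1// ltW.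
Qed.

Lemma powR_gt1 s : 0 < s -> 1 < 2 `^ s :> R.
Proof. move=> s0; rewrite -[ltLHS](_ : 1 `^ s = 1); last by rewrite powR1.
by rewrite gt0_ltr_powR ?nnegrE ?ltr1n. Qed.

Lemma powR2_lt r s : r < s -> 2 `^ r < 2 `^ s :> R.
Proof.
move=> rs; rewrite -(subrK r s) powRD; last by rewrite pnatr_eq0 implybT.
by rewrite ltr_pMl ?powR_gt0// powR_gt1// subr_gt0.
Qed.

Lemma powR2_Xn r n : (2 `^ r) ^+ n = (2 ^+ n) `^ r :> R.
Proof. by rewrite -powR_mulrn ?powR_ge0// powRAC powR_mulrn. Qed.

End Powers.

Section Bisection.
Context {R : realType}.

Section Principle.
Variables (Bd : R -> R -> Prop) (h0 A C K s : R).
Hypothesis Bd_le : forall h M M', M <= M' -> Bd h M -> Bd h M'.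
Hypotheses (A_ge0 : 0 <= A) (K_ge0 : 0 <= K).
Hypothesis K_fix : A * (K / 2 `^ s) + C <= K.
Hypothesis Bd_step : forall h M, 0 <= h <= h0 -> 0 <= M ->
  Bd (h / 2) M -> Bd h (A * M + C * h `^ s).

Lemma bisection_iter n h M : 0 <= h <= h0 -> 0 <= M ->
  Bd (h / 2 ^+ n) M -> Bd h (A ^+ n * M + K * h `^ s).
Proof.
elim: n h => [|n IH] h hh M0 HB.
  move: HB; rewrite !expr0 mul1r divr1; apply: Bd_le.
  by rewrite lerDl mulr_ge0// powR_ge0.
have /andP[h_ge0 h_le] := hh.
have hh2 : 0 <= h / 2 <= h0 by apply/andP; split; lra.
have := IH _ hh2 M0; rewrite -mulrA -invfM -exprS => /(_ HB) HB2.
have M2 : 0 <= A ^+ n * M + K * (h / 2) `^ s.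
  by rewrite addr_ge0 ?mulr_ge0 ?exprn_ge0 ?powR_ge0.
apply: Bd_le (Bd_step hh M2 HB2).
rewrite powR_half// mulrDr mulrA -exprS -addrA lerD2l.
have -> : A * (K * (h `^ s / 2 `^ s)) + C * h `^ s =
          (A * (K / 2 `^ s) + C) * h `^ s by ring.
by rewrite ler_wpM2r// powR_ge0.
Qed.

(** [Bd h M] reads: the quantity under study is at most [M] at scale [h]. After
    [n] bisections the contribution of the smallest scale is
    [A ^ n * o ((h / 2 ^ n) ^ r)], which vanishes because [A <= 2 ^ r]; only the source
    terms [C h ^ s] remain, and [K_fix] says that [K] is large enough to
    absorb their geometric sum. *)
Lemma bisection_bound r : A <= 2 `^ r ->
  (forall e, 0 < e -> exists2 d : R, 0 < d &
     forall h, 0 <= h <= d -> Bd h (e * h `^ r)) ->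
  forall h e, 0 <= h <= h0 -> 0 < e -> Bd h (K * h `^ s + e).
Proof.
move=> Ar small h e hh e0; have /andP[h_ge0 h_le] := hh.
pose e1 := e / (h `^ r + 1).
have hr1 : 0 < h `^ r + 1 by rewrite ltr_wpDl ?powR_ge0.
have e10 : 0 < e1 by rewrite divr_gt0.
have [d d0 Hd] := small _ e10.
have [n hn] : exists n : nat, h / 2 ^+ n <= d.
  exists (Num.bound (h / d)); rewrite ler_pdivrMr ?exprn_gt0// -ler_pdivrMl// mulrC.
  have /ltW := archi_boundP (divr_ge0 h_ge0 (ltW d0)); move/le_trans; apply.
  by rewrite -natrX ler_nat ltnW// ltn_expl.
have hn0 : 0 <= h / 2 ^+ n by rewrite divr_ge0// exprn_ge0.
have M0 : 0 <= e1 * (h / 2 ^+ n) `^ r by rewrite mulr_ge0 ?powR_ge0// ltW.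
have := bisection_iter hh M0 (Hd _ _); rewrite hn0 hn => /(_ isT).
apply: Bd_le; rewrite addrC lerD2l.
have -> : (h / 2 ^+ n) `^ r = h `^ r / (2 `^ r) ^+ n.
  rewrite powRM ?invr_ge0 ?exprn_ge0// powR2_Xn; congr (_ * _).
  by rewrite -powR_inv1 ?exprn_ge0// powRAC powR_inv1// powR_ge0.
have p2 : 0 < (2 `^ r) ^+ n :> R by rewrite exprn_gt0// powR_gt0.
rewrite (_ : A ^+ n * _ = (A ^+ n / (2 `^ r) ^+ n) * (e1 * h `^ r)); last by ring.
apply: (@le_trans _ _ (1 * (e1 * h `^ r))).
  apply: ler_wpM2r; first by rewrite mulr_ge0 ?powR_ge0 ?(ltW e10).
  by rewrite ler_pdivrMr// mul1r lerXn2r// nnegrE// powR_ge0.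
rewrite mul1r /e1 -mulrA ger_pMr// mulrC ler_pdivrMr// mul1r lerDl.
exact: ler01.
Qed.

End Principle.

Definition midpoint {V : normedModType R} (p q : V) : V := 2^-1 *: (p + q).

Definition midpoint_closed {V : normedModType R} (X : set V) :=
  forall p q, X p -> X q -> X (midpoint p q).

Section Midpoint.
Context {V : normedModType R}.
Implicit Types p q r : V.

Lemma midpointC p q : midpoint p q = midpoint q p.
Proof. by rewrite /midpoint addrC. Qed.

Lemma half_sum p : 2^-1 *: p + 2^-1 *: p = p.
Proof. by rewrite -scalerDl (_ : 2^-1 + 2^-1 = 1) ?scale1r//; lra. Qed.

Lemma midpoint_subl p q : midpoint p q - p = 2^-1 *: (q - p).
Proof.
rewrite /midpoint -[X in _ - X](half_sum p) scalerDr scalerBr opprD addrACA subrr add0r.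
by [].
Qed.

Lemma midpoint_subr p q : q - midpoint p q = 2^-1 *: (q - p).
Proof. by rewrite -opprB midpointC midpoint_subl -scalerN opprB. Qed.

Lemma norm_half (v : V) : `|2^-1 *: v| = `|v| / 2.
Proof. by rewrite normrZ ger0_norm ?invr_ge0// mulrC. Qed.

Lemma midpoint_dist p q r : midpoint p r - midpoint p q = 2^-1 *: (r - q).
Proof. by rewrite /midpoint -scalerBr opprD addrACA subrr add0r. Qed.

Lemma norm_midl p q : `|midpoint p q - p| = `|q - p| / 2.
Proof. by rewrite midpoint_subl norm_half. Qed.

Lemma norm_midr p q : `|q - midpoint p q| = `|q - p| / 2.
Proof. by rewrite midpoint_subr norm_half. Qed.

End Midpoint.

(** The sum of the geometric series of ratio [2 ^ (1 - s)], the constant of the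
    sewing lemma. *)
Definition sewing_const (s : R) : R := (1 - 2 / 2 `^ s)^-1.

Lemma sewing_const_gt0 s : 1 < s -> 0 < sewing_const s.
Proof.
move=> s1; rewrite invr_gt0 subr_gt0 ltr_pdivrMr ?powR_gt0// mul1r.
by have := @powR2_lt R _ _ s1; rewrite powRr1.
Qed.

Lemma sewing_const_fix C s : 1 < s ->
  2 * (C * sewing_const s / 2 `^ s) + C = C * sewing_const s.
Proof.
move=> s1; have := sewing_const_gt0 s1; rewrite invr_gt0 => /lt0r_neq0 n0.
have p0 : 2 `^ s != 0 :> R by rewrite gt_eqF ?powR_gt0.
rewrite /sewing_const; field; rewrite p0 /=.
move: n0; apply: contra => /eqP e0; apply/eqP.
by rewrite -(mulfK p0 (1 - _)) mulrBl mul1r divfK// e0 mul0r.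
Qed.

(** The additive case of the principle: the [2 ^ n] pieces of a segment
    contribute [2 ^ n * o (h / 2 ^ n)], which tends to zero, so that the source
    terms alone decide the order. *)
Lemma bisection_subadditive (V : normedModType R) (X : set V) (N : V -> V -> R) C s :
  midpoint_closed X -> 1 < s -> 0 <= C ->
  (forall p q, X p -> X q ->
     N p q <= N p (midpoint p q) + N (midpoint p q) q + C * `|q - p| `^ s) ->
  (forall e, 0 < e -> exists2 d : R, 0 < d &
     forall p q, X p -> X q -> `|q - p| <= d -> N p q <= e * `|q - p|) ->
  forall p q, X p -> X q -> N p q <= C * sewing_const s * `|q - p| `^ s.
Proof.
move=> Xm s1 C0 Nsub Nsmall p q Xp Xq.
pose Bd h M := 0 <= M /\ forall p q, X p -> X q -> `|q - p| <= h -> N p q <= M.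
have K0 : 0 <= C * sewing_const s by rewrite mulr_ge0// ltW// sewing_const_gt0.
apply/ler_addgt0Pr => e e0.
have [_ +] : Bd `|q - p| (C * sewing_const s * `|q - p| `^ s + e).
  apply: (@bisection_bound Bd `|q - p| 2 C _ s _ _ _ _ _ 1) => //.
  - by move=> h M M' MM' [M0 HM]; split=> [|*]; rewrite (le_trans _ MM') ?HM.
  - by rewrite sewing_const_fix.
  - move=> h M /andP[h0 _] M0 [_ HM]; split.
      by rewrite addr_ge0 ?mulr_ge0 ?powR_ge0.
    move=> a b Xa Xb ab; apply: (le_trans (Nsub _ _ Xa Xb)); apply: lerD.
      rewrite mulrDl mul1r; apply: lerD; apply: HM; rewrite ?norm_midl ?norm_midr ?ler_pM2r//; exact: Xm.
    by rewrite ler_wpM2l// powR_mono// ltW// (lt_trans ltr01).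
  - by rewrite powRr1.
  - move=> e1 e10; have [d d0 Hd] := Nsmall _ e10; exists d => // h /andP[h0 hd].
    rewrite powRr1//; split; first by rewrite mulr_ge0// ltW.
    move=> a b Xa Xb ab; apply: (le_trans (Hd _ _ Xa Xb (le_trans ab hd))).
    by rewrite ler_pM2l.
  - by rewrite normr_ge0 lexx.
by apply.
Qed.

End Bisection.

(** * The one-dimensional Young integral *)

Section PointwiseCluster.
Context {R : realType}.

(** A pointwise bounded sequence of functions converges pointwise along an
    ultrafilter; hence the limit inherits every closed relation between two
    values that holds asymptotically along the sequence. *)
Lemma pointwise_cluster (T : Type) (D : set T) (x : nat -> T -> R) (M : T -> R) :
  (forall t n, D t -> `|x n t| <= M t) ->
  exists P : T -> R, forall s t e N, D s -> D t -> 0 < e ->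
    exists n, [/\ (N <= n)%N, `|x n s - P s| < e & `|x n t - P t| < e].
Proof.
move=> xM.
have [U [Uu sU]] := @ultraFilterLemma nat \oo _.
have PU : ProperFilter U by exact: ultra_proper.
have lims t : exists l, D t -> forall e, 0 < e -> U [set n | `|x n t - l| < e].
  have [Dt|nDt] := pselect (D t); last by exists 0.
  have /= := @segment_compact R (- M t) (M t) ((x ^~ t) @ U) _ _.
  case.
    by apply: filterE => n /=; rewrite in_itv /= -ler_norml xM.
  move=> l [_ cl]; exists l => _ e e0.
  have [//|nU] := in_ultra_setVsetC [set n | `|x n t - l| < e] Uu.
  have [y [/= yA]] := cl (~` [set y | `|y - l| < e]) (ball l e) nU (nbhsx_ballx _ _ e0).
  by rewrite -ball_normE /ball_ /= distrC.
have [P HP] := choice lims; exists P => s t e N Ds Dt e0.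
have UN : U [set n | (N <= n)%N] by apply: sU; exact: nbhs_infty_ge.
have [n [[ns nt] nN]] : exists n, ([set n | `|x n s - P s| < e] `&`
    [set n | `|x n t - P t| < e] `&` [set n | (N <= n)%N]) n.
  by apply: (@filter_ex _ U); apply: filterI => //; apply: filterI; exact: HP.
by exists n.
Qed.

End PointwiseCluster.

Section YoungPrimitive.
Context {R : realType}.
Variables (a b : R) (u w : R -> R) (beta Cu Cw : R).
Hypotheses (ab : a <= b) (beta0 : 0 < beta) (beta2 : 1 < beta + beta).
Hypotheses (Cu0 : 0 <= Cu) (Cw0 : 0 <= Cw).
Hypothesis hu : forall s t, a <= s <= b -> a <= t <= b ->
  `|u t - u s| <= Cu * `|t - s| `^ beta.
Hypothesis hw : forall s t, a <= s <= b -> a <= t <= b ->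
  `|w t - w s| <= Cw * `|t - s| `^ beta.

Let node (eta : R) (i : nat) : R := a + i%:R * eta.

(** The integral of [u dw] from [a] to [t], with [u] frozen at the left node of each
    cell of the grid of mesh [eta]. *)
Let left_sum (eta t : R) : R :=
  let i := Num.truncn ((t - a) / eta) in
  \sum_(j < i) u (node eta j) * (w (node eta j.+1) - w (node eta j)) +
  u (node eta i) * (w t - w (node eta i)).

Let nodeP eta t : 0 < eta -> a <= t ->
  node eta (Num.truncn ((t - a) / eta)) <= t < node eta (Num.truncn ((t - a) / eta)).+1.
Proof.
move=> e0 at_; have /truncn_itv : 0 <= (t - a) / eta by rewrite divr_ge0 ?subr_ge0// ltW.
by rewrite ler_pdivlMr// ltr_pdivrMr// /node => /andP[? ?]; apply/andP; split; lra.
Qed.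

Let osc eta x y z v : a <= x <= b -> a <= y <= b -> a <= z <= b -> a <= v <= b ->
  `|y - x| <= eta -> `|v - z| <= eta ->
  `|(u y - u x) * (w v - w z)| <= Cu * Cw * eta `^ (beta + beta).
Proof.
move=> hx hy hz hv yx vz; rewrite normrM powRDge0// mulrACA.
apply: ler_pM => //.
- by apply: (le_trans (hu hx hy)); rewrite ler_wpM2l// powR_mono// ltW.
- by apply: (le_trans (hw hz hv)); rewrite ler_wpM2l// powR_mono// ltW.
Qed.

Let left_sum_local eta s t : 0 < eta -> a <= s -> s <= t -> t <= b -> t - s <= eta ->
  `|left_sum eta t - left_sum eta s - u s * (w t - w s)| <=
  2 * (Cu * Cw * eta `^ (beta + beta)).
Proof.
move=> e0 as_ st tb ts.
have at_ : a <= t by lra.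
have /andP[s1 s2] := nodeP e0 as_; have /andP[t1 t2] := nodeP e0 at_.
rewrite /left_sum; set i := Num.truncn _ in s1 s2 *; set i' := Num.truncn _ in t1 t2 *.
have nS j : node eta j.+1 = node eta j + eta.
  by rewrite /node -addn1 natrD mulrDl mul1r addrA.
have ii' : (i <= i')%N.
  by apply: le_truncn; rewrite ler_pM2r ?invr_gt0// lerD2r.
have i'i : (i' <= i.+1)%N.
  rewrite leqNgt; apply/negP => lt.
  have : node eta i.+2 <= node eta i' by rewrite lerD2l ler_pM2r// ler_nat.
  by rewrite nS; lra.
have ni : a <= node eta i by rewrite lerDl mulr_ge0// ltW.
have osc0 : 0 <= Cu * Cw * eta `^ (beta + beta) by rewrite !mulr_ge0 ?powR_ge0.
have [Ei|Ni] := eqVneq i' i.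
  rewrite Ei in t1 t2 *; have nSi := nS i.
  rewrite [X in `|X|](_ : _ = (u (node eta i) - u s) * (w t - w s)); last by ring.
  rewrite (@le_trans _ _ (Cu * Cw * eta `^ (beta + beta)))//; last by lra.
  by apply: osc; rewrite ?ler_norml; apply/andP; split; lra.
have Ei : i' = i.+1 by apply/eqP; rewrite eqn_leq i'i ltn_neqAle eq_sym Ni.
rewrite Ei in t1 t2 *; rewrite big_ord_recr /=; have nSi := nS i.
rewrite [X in `|X|](_ : _ = (u (node eta i) - u s) * (w (node eta i.+1) - w s) +
  (u (node eta i.+1) - u s) * (w t - w (node eta i.+1))); last by ring.
rewrite (le_trans (ler_normD _ _))// [leRHS]mulrDl !mul1r.
apply: lerD; apply: osc; rewrite ?ler_norml; apply/andP; split; lra.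
Qed.

Let left_sum_global eta n s t : 0 < eta -> a <= s -> s <= t -> t <= b ->
  b - a <= 2 ^+ n * eta ->
  `|left_sum eta t - left_sum eta s - u s * (w t - w s)| <=
  2 ^+ n * (2 * (Cu * Cw * eta `^ (beta + beta))) +
  Cu * Cw * sewing_const (beta + beta) * (t - s) `^ (beta + beta).
Proof.
move=> e0 as_ st tb hn.
pose Bd h M := 0 <= M /\ forall s t, a <= s -> s <= t -> t <= b -> t - s <= h ->
  `|left_sum eta t - left_sum eta s - u s * (w t - w s)| <= M.
have osc0 r : 0 <= Cu * Cw * r `^ (beta + beta) by rewrite !mulr_ge0 ?powR_ge0.
suff [_] : Bd (t - s) (2 ^+ n * (2 * (Cu * Cw * eta `^ (beta + beta))) +
  Cu * Cw * sewing_const (beta + beta) * (t - s) `^ (beta + beta)) by apply.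
apply: (@bisection_iter R Bd (t - s) 2 (Cu * Cw)) => //.
- by move=> h M M' MM' [M0 HM]; split=> [|*]; rewrite (le_trans _ MM') ?HM.
- by rewrite mulr_ge0 ?mulr_ge0// ltW// sewing_const_gt0.
- by rewrite sewing_const_fix.
- move=> h M /andP[h0 _] M0 [_ HM]; split; first by rewrite addr_ge0// mulr_ge0.
  move=> x y ax xy yb yx; pose m := (x + y) / 2.
  rewrite [X in `|X|](_ : _ = (left_sum eta m - left_sum eta x - u x * (w m - w x)) +
    (left_sum eta y - left_sum eta m - u m * (w y - w m)) +
    (u m - u x) * (w y - w m)); last by ring.
  rewrite (le_trans (ler_normD _ _))// lerD//.
    rewrite (le_trans (ler_normD _ _))// mulrDl mul1r lerD//; apply: HM; rewrite /m; lra.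
  by apply: osc; rewrite /m ?ler_norml; apply/andP; split; lra.
- by rewrite lexx andbT subr_ge0.
- by rewrite mulr_ge0.
split; first by rewrite mulr_ge0.
move=> x y ax xy yb yx; apply: left_sum_local => //.
apply: (le_trans yx); rewrite ler_pdivrMr ?exprn_gt0// mulrC.
by apply: le_trans hn; lra.
Qed.

(** The increments of the left-point sums are exactly additive, and below the mesh
    they are close to those of [u dw]; bisection down to the mesh therefore bounds
    them at all scales, up to an error that vanishes with the mesh, and any
    pointwise limit point is a primitive. *)
Lemma young_primitive : exists P : R -> R, forall s t, a <= s <= b -> a <= t <= b ->
  `|P t - P s - u s * (w t - w s)| <=
  Cu * Cw * (sewing_const (beta + beta) + 1) * `|t - s| `^ (beta + beta).
Proof.
have l0 : 0 < b - a + 1.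
  by rewrite ltr_wpDl ?subr_ge0.
set l := b - a + 1 in l0.
(* With mesh [l / 2 ^ n], exactly [n] bisections reach the scale of one cell. *)
pose eta n := l / 2 ^+ n; have eta0 n : 0 < eta n by rewrite divr_gt0// exprn_gt0.
pose S := sewing_const (beta + beta).
have S0 : 0 <= S by rewrite ltW// sewing_const_gt0.
pose c := 2 * (Cu * Cw * l `^ (beta + beta)); pose q : R := 2 / 2 `^ (beta + beta).
have c0 : 0 <= c by rewrite mulr_ge0// !mulr_ge0 ?powR_ge0.
have q1 : q < 1.
  by rewrite ltr_pdivrMr ?powR_gt0// mul1r; have := @powR2_lt R _ _ beta2; rewrite powRr1.
have q0 : 0 <= q by rewrite divr_ge0 ?powR_ge0.
have bound n s t : a <= s -> s <= t -> t <= b ->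
    `|left_sum (eta n) t - left_sum (eta n) s - u s * (w t - w s)| <=
    c * q ^+ n + Cu * Cw * S * (t - s) `^ (beta + beta).
  move=> as_ st tb; have ln : b - a <= 2 ^+ n * eta n.
    by rewrite /eta mulrC divfK ?gt_eqF ?exprn_gt0// /l; lra.
  apply: (le_trans (left_sum_global (eta0 n) as_ st tb ln)); rewrite lerD2r.
  rewrite /eta powRM ?invr_ge0 ?exprn_ge0 ?(ltW l0)//.
  rewrite -powR_inv1 ?exprn_ge0// powRAC -powR2_Xn powR_inv1 ?exprn_ge0 ?powR_ge0//.
  by rewrite /q expr_div_n /c le_of_eq//; ring.
have xM t n : [set t | a <= t <= b] t -> `|left_sum (eta n) t| <=
    c + Cu * Cw * S * (t - a) `^ (beta + beta) + `|u a * (w t - w a)|.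
  move=> /= /andP[at_ tb]; have := bound n a t (lexx a) at_ tb.
  have -> : left_sum (eta n) a = 0.
    by rewrite /left_sum subrr mul0r truncn0 big_ord0 /node mul0r addr0 subrr mulr0 addr0.
  rewrite subr0 => H; rewrite -(subrK (u a * (w t - w a)) (left_sum _ t)).
  rewrite (le_trans (ler_normD _ _))// lerD2r (le_trans H)// lerD2r.
  by rewrite ler_piMr// exprn_ile1// ltW.
have [P HP] := pointwise_cluster xM.
exists P.
have main s t : a <= s -> s <= t -> t <= b ->
    `|P t - P s - u s * (w t - w s)| <= Cu * Cw * S * (t - s) `^ (beta + beta).
  move=> as_ st tb; apply/ler_addgt0Pr => e e0.
  have e3 : 0 < e / 3 by rewrite divr_gt0.
  have [N HN] : exists N, forall n, (N <= n)%N -> c * q ^+ n <= e / 3.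
    have : (fun n => c * q ^+ n) @ \oo --> (0 : R).
      by apply: cvg_geometric; rewrite ger0_norm.
    move=> /cvgrPdist_le /(_ _ e3) [N _ HN]; exists N => n Nn.
    by have := HN n Nn; rewrite /= sub0r normrN; apply: le_trans; rewrite ler_norm.
  have [n [Nn sn tn]] : exists n, [/\ (N <= n)%N,
      `|left_sum (eta n) s - P s| < e / 3 & `|left_sum (eta n) t - P t| < e / 3].
    by apply: HP => //=; apply/andP; split=> //; [exact: le_trans tb|exact: le_trans st].
  have := bound n s t as_ st tb; have := HN _ Nn.
  have -> : P t - P s - u s * (w t - w s) =
    (left_sum (eta n) t - left_sum (eta n) s - u s * (w t - w s)) -
    (left_sum (eta n) t - P t) + (left_sum (eta n) s - P s) by ring.
  move=> H1 H2; rewrite (le_trans (ler_normD _ _))//.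
  have := ler_normB (left_sum (eta n) t - left_sum (eta n) s - u s * (w t - w s))
     (left_sum (eta n) t - P t).
  by move: H1 H2 sn tn; lra.
move=> s t /andP[as_ sb] /andP[at_ tb].
have pw0 r : 0 <= Cu * Cw * r `^ (beta + beta) by rewrite !mulr_ge0 ?powR_ge0.
have [st|/ltW ts] := leP s t.
  apply: (le_trans (main _ _ as_ st tb)); rewrite ger0_norm ?subr_ge0//.
  by rewrite ler_wpM2r ?powR_ge0// ler_wpM2l ?mulr_ge0// lerDl.
have -> : P t - P s - u s * (w t - w s) =
  (u t - u s) * (w t - w s) - (P s - P t - u t * (w s - w t)) by ring.
rewrite [leRHS](_ : _ = Cu * Cw * `|t - s| `^ (beta + beta) +
  Cu * Cw * S * `|t - s| `^ (beta + beta)); last by rewrite /S; ring.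
rewrite (le_trans (ler_normB _ _))// lerD//; last first.
  by rewrite [`|t - s|]distrC [`|s - t|]ger0_norm ?subr_ge0//; exact: main.
by apply: osc; rewrite ?as_ ?at_.
Qed.

End YoungPrimitive.

Section YoungIntegral.
Context {R : realType}.

Lemma uniform_partition (h : R) : 0 < h ->
  exists2 s : seq R, itv_partition 0 1 s &
    forall i, (i < size s)%N -> nth 0 (0 :: s) i.+1 - nth 0 (0 :: s) i < h.
Proof.
move=> h0; pose N := (Num.bound h^-1).+1; have N0 : 0 < N%:R :> R by rewrite ltr0n.
have Nh : N%:R^-1 < h.
  rewrite -[ltRHS]invrK ltf_pV2 ?posrE ?invr_gt0//.
  rewrite (lt_trans (archi_boundP _)) ?invr_ge0 ?ltW// ltr_nat.
  exact: leqnn.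
pose s := [seq i.+1%:R / N%:R | i <- iota 0 N] : seq R.
have szs : size s = N by rewrite size_map size_iota.
have ns i : (i <= N)%N -> nth 0 (0 :: s) i = i%:R / N%:R.
  case: i => [|i] iN /=; first by rewrite mul0r.
  by rewrite (nth_map 0%N) ?size_iota// nth_iota.
have stp i : (i < N)%N -> nth 0 (0 :: s) i.+1 - nth 0 (0 :: s) i = N%:R^-1.
  by move=> iN; rewrite !ns// 1?ltnW// -mulrBl -natrB// subSnn mul1r.
exists s; last by move=> i; rewrite szs => iN; rewrite stp.
split; last by rewrite (last_nth 0) szs ns// divff// gt_eqF.
apply/(pathP 0) => i; rewrite szs => iN.
by rewrite -subr_gt0 (stp _ iN) invr_gt0.
Qed.

Variables (u w P : R -> R) (beta Cu Cw K : R).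
Hypotheses (beta0 : 0 < beta) (beta2 : 1 < beta + beta).
Hypotheses (Cu0 : 0 <= Cu) (Cw0 : 0 <= Cw) (K0 : 0 <= K).
Hypothesis hu : forall s t, 0 <= s <= 1 -> 0 <= t <= 1 ->
  `|u t - u s| <= Cu * `|t - s| `^ beta.
Hypothesis hw : forall s t, 0 <= s <= 1 -> 0 <= t <= 1 ->
  `|w t - w s| <= Cw * `|t - s| `^ beta.
Hypothesis hP : forall s t, 0 <= s <= 1 -> 0 <= t <= 1 ->
  `|P t - P s - u s * (w t - w s)| <= K * `|t - s| `^ (beta + beta).

(** On a cell of length [x] the tagged term and the increment of the primitive differ
    by [O (x ^ (2 beta))], and [2 beta > 1]: the sum over a partition of mesh [h] is
    [O (h ^ (2 beta - 1))]. *)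
Lemma is_young_integral_primitive : is_young_integral u w 0 1 (P 1 - P 0).
Proof.
move=> e e0; pose C := K + Cu * Cw.
have C0 : 0 <= C by rewrite addr_ge0// mulr_ge0.
pose e1 := e / (C + 1).
have e10 : 0 < e1 by rewrite divr_gt0// ltr_wpDl.
have r0 : 0 < beta + beta - 1 by rewrite subr_gt0.
have [h h0 Hh] := powR_small r0 e10; exists h => // s t [ps ls] hst.
set x := nth 0 (0 :: s).
have xlt i : (i < size s)%N -> x i < x i.+1 by move=> si; exact: (pathP 0 ps).
have x01 i : (i <= size s)%N -> 0 <= x i <= 1.
  move=> si; have part : itv_partition 0 1 s by split.
  rewrite /x (set_nth_default 1)/= ?ltnS//.
  by rewrite (itv_partition_nth_ge _ part) ?(itv_partition_nth_le _ part).
have tel (f : R -> R) : \sum_(i < size s) (f (x i.+1) - f (x i)) = f 1 - f 0.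
  rewrite -(big_mkord xpredT (fun i => f (x i.+1) - f (x i))) telescope_sumr//.
  by rewrite /x -(last_nth 0) (eqP ls).
rewrite /stieltjes_sum -(tel P) -sumrB.
apply: (@le_lt_trans _ _ (\sum_(i < size s) C * e1 * (x i.+1 - x i))).
  apply: (le_trans (ler_norm_sum _ _ _)); apply: ler_sum => i _.
  have si := ltn_ord i; have [xh /andP[xt tx]] := hst _ si.
  have xi := x01 _ (ltnW si); have xi1 := x01 _ si.
  have d0 : 0 < x i.+1 - x i by rewrite subr_gt0 xlt.
  have ti : 0 <= t i <= 1.
    by move/andP: xi => [xi _]; move/andP: xi1 => [_ xi1];
      rewrite (le_trans xi)//= (le_trans tx).
  rewrite -/(x i) -/(x i.+1).
  rewrite (_ : _ - _ = (u (t i) - u (x i)) * (w (x i.+1) - w (x i)) -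
    (P (x i.+1) - P (x i) - u (x i) * (w (x i.+1) - w (x i)))); last by ring.
  apply: (@le_trans _ _ (C * (x i.+1 - x i) `^ (beta + beta))).
    rewrite /C [leRHS]mulrDl [leRHS]addrC (le_trans (ler_normB _ _))// lerD//.
      rewrite normrM powRDge0// mulrACA ler_pM//.
        rewrite (le_trans (hu xi ti))// ler_wpM2l// powR_mono// ?(ltW beta0)//.
        by rewrite ger0_norm ?subr_ge0// lerD2r.
      by rewrite (le_trans (hw xi xi1))// ger0_norm// ltW.
    by rewrite (le_trans (hP xi xi1))// ger0_norm// ltW.
  rewrite -mulrA ler_wpM2l//.
  rewrite -[beta + beta](subrK 1) powRDge0// powRr1 ?(ltW d0)// ler_wpM2r ?(ltW d0)//.
  by rewrite Hh// (ltW d0) ltW.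
rewrite -mulr_sumr (tel id) subr0 mulr1 /e1 mulrCA gtr_pMr// ltr_pdivrMr ?ltr_wpDl// mul1r.
by rewrite ltrDl.
Qed.

(** The limit is unique because partitions of arbitrarily small mesh exist. *)
Lemma young_integral_primitive : young_integral u w 0 1 = P 1 - P 0.
Proof.
apply: xget_unique => /=; first exact: is_young_integral_primitive.
move=> l Hl; apply/eqP; rewrite -subr_eq0 -normr_le0.
apply/ler_addgt0Pr => e e0; rewrite add0r.
have e2 : 0 < e / 2 by rewrite divr_gt0.
have [h1 h10 H1] := Hl _ e2.
have [h2 h20 H2] := is_young_integral_primitive e2.
have h0 : 0 < Num.min h1 h2 by rewrite lt_min h10.
have [s part smesh] := uniform_partition h0.
have ps : path <%R 0 s by case: part.
have x1 i : (i < size s)%N -> nth 0 (0 :: s) i <= nth 0 (0 :: s) i <= nth 0 (0 :: s) i.+1.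
  by move=> si; rewrite lexx ltW// (pathP 0 ps).
have le1 : `|stieltjes_sum u w 0 s (nth 0 (0 :: s)) - l| < e / 2.
  by apply: (H1 _ _ part) => i si; have := smesh _ si; rewrite lt_min => /andP[? ?]; split=> //; exact: x1.
have le2 : `|stieltjes_sum u w 0 s (nth 0 (0 :: s)) - (P 1 - P 0)| < e / 2.
  by apply: (H2 _ _ part) => i si; have := smesh _ si; rewrite lt_min => /andP[? ?]; split=> //; exact: x1.
set S := stieltjes_sum _ _ _ _ _ in le1 le2.
rewrite (_ : l - _ = (S - (P 1 - P 0)) - (S - l)); last by ring.
by rewrite (le_trans (ler_normB _ _))//; move: le1 le2; lra.
Qed.

End YoungIntegral.

(** * Closed one-forms on a cube *)

Section MatrixNorm.
Context {R : realType}.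

Lemma mx_entry_le m n (A : 'M[R]_(m, n)) i j : `|A i j| <= `|A|.
Proof. by rewrite [leRHS]/Num.Def.normr /= mx_normrE; apply/bigmax_geP; right => /=; exists (i, j). Qed.

Lemma mx_norm_le m n (A : 'M[R]_(m, n)) e :
  0 <= e -> (forall i j, `|A i j| <= e) -> `|A| <= e.
Proof.
move=> e0 H; rewrite [leLHS]/Num.Def.normr /= mx_normrE.
by apply: bigmax_le => // -[i j] _; exact: H.
Qed.

Lemma mulmx_norm m n p (A : 'M[R]_(m, n)) (B : 'M[R]_(n, p)) :
  `|A *m B| <= n%:R * (`|A| * `|B|).
Proof.
apply: mx_norm_le => [|i j]; first by rewrite !mulr_ge0.
rewrite mxE (le_trans (ler_norm_sum _ _ _))//.
rewrite -[n in n%:R]card_ord mulr_natl -sumr_const; apply: ler_sum => l _.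
by rewrite normrM ler_pM// mx_entry_le.
Qed.

End MatrixNorm.

Section Replace.
Context {R : realType} {m : nat}.
Implicit Types (x y : 'cV[R]_m) (c : 'I_m) (r s t : R).

Definition replace x c t : 'cV[R]_m := \col_i (if i == c then t else x i 0).

Lemma replaceE x c t i : replace x c t i 0 = if i == c then t else x i 0.
Proof. by rewrite mxE. Qed.

Lemma colP2 x y : (forall i, x i 0 = y i 0) -> x = y.
Proof. by move=> h; apply/matrixP => i j; rewrite (ord1 j). Qed.

Lemma replace_replace x c s t : replace (replace x c s) c t = replace x c t.
Proof. by apply: colP2 => i; rewrite !replaceE; case: eqP. Qed.

Lemma replaceC x c c' s t : c != c' ->
  replace (replace x c s) c' t = replace (replace x c' t) c s.
Proof.
move=> cc'; apply: colP2 => i; rewrite !replaceE.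
by case: eqP => [->|//]; rewrite eq_sym (negbTE cc').
Qed.

Lemma replace_id x c : replace x c (x c 0) = x.
Proof. by apply: colP2 => i; rewrite replaceE; case: eqP => [->|]. Qed.

Lemma replace_line x c r s t :
  (1 - t) *: replace x c r + t *: replace x c s = replace x c ((1 - t) * r + t * s).
Proof.
by apply: colP2 => i; rewrite 2!mxE [X in _ + X]mxE !replaceE; case: eqP => // _; ring.
Qed.

Lemma replace_dist x c r s : `|replace x c s - replace x c r| <= `|s - r|.
Proof.
apply: mx_norm_le => // i j; rewrite (ord1 j) !mxE; case: eqP => // _.
by rewrite subrr normr0.
Qed.

Lemma replace_delta x c r s : replace x c s = replace x c r + (s - r) *: delta_mx c 0.
Proof.
apply: colP2 => i; rewrite !mxE eqxx andbT; case: eqP => _ /=; last by ring.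
by ring.
Qed.

Lemma cube_replace (I : set R) x c t : cube I x -> I t -> cube I (replace x c t).
Proof. by move=> Ix It i; rewrite replaceE; case: eqP. Qed.

End Replace.

Section AxisForm.
Context {R : realType} {m : nat}.
Variables (I : set R) (beta Cu Cw : R) (u w : 'cV[R]_m -> R).
Hypotheses (hI : is_interval I) (beta0 : 0 < beta) (beta2 : 1 < beta + beta).
Hypotheses (Cu0 : 0 <= Cu) (Cw0 : 0 <= Cw).
Hypothesis hu : forall x y, cube I x -> cube I y -> `|u y - u x| <= Cu * `|y - x| `^ beta.
Hypothesis hw : forall x y, cube I x -> cube I y -> `|w y - w x| <= Cw * `|y - x| `^ beta.

Definition axis_integral (x : 'cV[R]_m) (c : 'I_m) (r s : R) : R :=
  segment_integral u w (replace x c r) (replace x c s).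

Lemma axis_integral_replace x c t r s :
  axis_integral (replace x c t) c r s = axis_integral x c r s.
Proof. by rewrite /axis_integral !replace_replace. Qed.

Let K := Cu * Cw * (sewing_const (beta + beta) + 1).

Let K0 : 0 <= K.
Proof. by rewrite /K mulr_ge0// ?mulr_ge0// addr_ge0// ltW// sewing_const_gt0. Qed.

Let axis_holder (v : 'cV[R]_m -> R) C x c a b : 0 <= C ->
  (forall x y, cube I x -> cube I y -> `|v y - v x| <= C * `|y - x| `^ beta) ->
  cube I x -> I a -> I b -> forall s t, a <= s <= b -> a <= t <= b ->
  `|v (replace x c t) - v (replace x c s)| <= C * `|t - s| `^ beta.
Proof.
move=> C0 hv Ix Ia Ib s t sab tab; have Is := hI Ia Ib sab; have It := hI Ia Ib tab.
rewrite (le_trans (hv _ _ _ _))//; try exact: cube_replace.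
by rewrite ler_wpM2l// powR_mono// ?(ltW beta0)// replace_dist.
Qed.

(** On a whole axis segment one primitive computes all the integrals, in both
    directions, since affine reparametrization preserves the estimates that
    characterize Young integrals. *)
Lemma axis_primitive x c a b : cube I x -> I a -> I b -> a <= b ->
  exists P : R -> R, forall r s, a <= r <= b -> a <= s <= b ->
    axis_integral x c r s = P s - P r /\
    `|P s - P r - u (replace x c r) * (w (replace x c s) - w (replace x c r))| <=
      K * `|s - r| `^ (beta + beta).
Proof.
move=> Ix Ia Ib ab.
have hu' := axis_holder c Cu0 hu Ix Ia Ib.
have hw' := axis_holder c Cw0 hw Ix Ia Ib.
have [P HP] := young_primitive ab beta0 beta2 Cu0 Cw0 hu' hw'.
exists P => r s rab sab; split; last exact: HP.
pose g t := (1 - t) * r + t * s.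
have gab t : 0 <= t <= 1 -> a <= g t <= b.
  move=> /andP[t0 t1]; move: rab sab => /andP[ar rb] /andP[as_ sb].
  by rewrite /g; apply/andP; split; nra.
have gd t t' : `|g t' - g t| = `|t' - t| * `|s - r|.
  by rewrite -normrM; congr `|_|; rewrite /g; ring.
have gpow t t' p : `|g t' - g t| `^ p = `|s - r| `^ p * `|t' - t| `^ p.
  by rewrite gd powRM// mulrC.
have -> : P s - P r = (P \o g) 1 - (P \o g) 0.
  by rewrite /= /g; congr (P _ - P _); ring.
rewrite /axis_integral /segment_integral.
apply: (@young_integral_primitive R _ _ (P \o g) beta (Cu * `|s - r| `^ beta)
  (Cw * `|s - r| `^ beta) (K * `|s - r| `^ (beta + beta))) => //.
- by rewrite mulr_ge0// powR_ge0.
- by rewrite mulr_ge0// powR_ge0.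
- by rewrite mulr_ge0// powR_ge0.
- move=> t t' ht ht'; rewrite /= !replace_line -/(g _) -/(g _).
  by rewrite -mulrA -gpow; apply: hu'; exact: gab.
- move=> t t' ht ht'; rewrite /= !replace_line -/(g _) -/(g _).
  by rewrite -mulrA -gpow; apply: hw'; exact: gab.
- move=> t t' ht ht'; rewrite /= !replace_line -/(g _) -/(g _).
  by rewrite -mulrA -gpow; apply: HP; exact: gab.
Qed.

Lemma axis_integral_chasles x c r s t : cube I x -> I r -> I s -> I t ->
  axis_integral x c r s + axis_integral x c s t = axis_integral x c r t.
Proof.
move=> Ix Ir Is It; pose a := Num.min r (Num.min s t); pose b := Num.max r (Num.max s t).
have Ia : I a by rewrite /a !minEle; do 2 case: ifP.
have Ib : I b by rewrite /b !maxEle; do 2 case: ifP.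
have ra : a <= r <= b by rewrite /a /b ge_min lexx le_max lexx.
have sa : a <= s <= b by rewrite /a /b !ge_min lexx !le_max lexx !orbT.
have ta : a <= t <= b by rewrite /a /b !ge_min lexx !le_max lexx !orbT.
have ab : a <= b by case/andP: ra; exact: le_trans.
have [P HP] := axis_primitive c Ix Ia Ib ab.
have [-> _] := HP _ _ ra sa; have [-> _] := HP _ _ sa ta; have [-> _] := HP _ _ ra ta.
by ring.
Qed.

Lemma axis_integral_rev x c r s : cube I x -> I r -> I s ->
  axis_integral x c s r = - axis_integral x c r s.
Proof.
move=> Ix Ir Is; have /eqP := axis_integral_chasles c Ix Ir Ir Ir.
rewrite -subr_eq0 addrK => /eqP rr0; apply/eqP.
by rewrite -addr_eq0 addrC axis_integral_chasles// rr0.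
Qed.

Lemma axis_integral_germ x c r s : cube I x -> I r -> I s ->
  `|axis_integral x c r s - u (replace x c r) * (w (replace x c s) - w (replace x c r))|
  <= K * `|s - r| `^ (beta + beta).
Proof.
move=> Ix Ir Is; pose a := Num.min r s; pose b := Num.max r s.
have Ia : I a by rewrite /a !minEle; case: ifP.
have Ib : I b by rewrite /b !maxEle; case: ifP.
have ra : a <= r <= b by rewrite /a /b ge_min lexx le_max lexx.
have sa : a <= s <= b by rewrite /a /b !ge_min lexx !le_max lexx !orbT.
have ab : a <= b by case/andP: ra; exact: le_trans.
have [P HP] := axis_primitive c Ix Ia Ib ab.
by have [-> +] := HP _ _ ra sa.
Qed.

Hypothesis hclosed : forall p v1 v2, axis_rectangle_in (cube I) p v1 v2 ->
  parallelogram_boundary_integral u w p v1 v2 = 0.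

Lemma interval_combination n (l y : 'I_n.+1 -> R) :
  (forall i, I (y i)) -> (forall i, 0 <= l i) -> \sum_i l i = 1 -> I (\sum_i l i * y i).
Proof.
move=> Iy l0 l1.
have [i _ imin] : exists2 i, true & forall j, y i <= y j.
  by case: (@arg_minP _ _ _ ord0 xpredT y isT) => i _ H; exists i => // j; exact: H.
have [k _ kmax] : exists2 i, true & forall j, y j <= y i.
  by case: (@arg_maxP _ _ _ ord0 xpredT y isT) => k _ H; exists k => // j; exact: H.
apply: (hI (Iy i) (Iy k)); rewrite -[y i]mul1r -[y k]mul1r -l1 !mulr_suml.
by apply/andP; split; apply: ler_sum => j _; rewrite ler_wpM2l.
Qed.

(** The two paths joining opposite corners of a rectangle. *)
Lemma axis_integral_rectangle x c c' r s t t' : c != c' ->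
  cube I x -> I r -> I s -> I t -> I t' ->
  axis_integral (replace x c' t) c r s + axis_integral (replace x c s) c' t t' =
  axis_integral (replace x c r) c' t t' + axis_integral (replace x c' t') c r s.
Proof.
move=> cc' Ix Ir Is It It'.
pose p := replace (replace x c' t) c r.
pose v1 : 'cV[R]_m := (s - r) *: delta_mx c 0.
pose v2 : 'cV[R]_m := (t' - t) *: delta_mx c' 0.
have cr y (z : 'I_m) q : cube I y -> I q -> cube I (replace y z q) by exact: cube_replace.
have E1 : p + v1 = replace (replace x c' t) c s by rewrite [RHS](replace_delta _ _ r).
have E2 : p + v1 + v2 = replace (replace x c' t') c s.
  by rewrite E1 -!(replaceC _ _ _ cc') [RHS](replace_delta _ _ t).
have E3 : p + v2 = replace (replace x c' t') c r.
  by rewrite /p -!(replaceC _ _ _ cc') [RHS](replace_delta _ _ t).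
have rect : axis_rectangle_in (cube I) p v1 v2.
  split; [by exists c, (s - r)|by exists c', (t' - t)|].
  rewrite E2 E1 E3 => y [l [l0 l1 ->]] i.
  rewrite summxE; under eq_bigr do rewrite mxE.
  apply: interval_combination => // j.
  by case: j => [[|[|[|[|//]]]] ?] /=; rewrite /p; apply: (cr) => //; exact: cr.
have := hclosed rect; rewrite /parallelogram_boundary_integral E2 E1 E3 /p.
have -> : segment_integral u w (replace (replace x c' t) c r) (replace (replace x c' t) c s)
  = axis_integral (replace x c' t) c r s by [].
have -> : segment_integral u w (replace (replace x c' t) c s) (replace (replace x c' t') c s)
  = axis_integral (replace x c s) c' t t' by rewrite -!(replaceC _ _ _ cc').
have -> : segment_integral u w (replace (replace x c' t') c s) (replace (replace x c' t') c r)
  = axis_integral (replace x c' t') c s r by [].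
have -> : segment_integral u w (replace (replace x c' t') c r) (replace (replace x c' t) c r)
  = axis_integral (replace x c r) c' t' t by rewrite -!(replaceC _ _ _ cc').
rewrite (axis_integral_rev c _ Ir Is) ?(axis_integral_rev c' _ It It'); try exact: cr.
move: (axis_integral (replace x c' t) c r s) (axis_integral (replace x c s) c' t t')
  (axis_integral (replace x c r) c' t t') (axis_integral (replace x c' t') c r s).
by move=> A B C D E; apply/eqP; rewrite -subr_eq0 -E; apply/eqP; ring.
Qed.

(** [H q] is the integral along the staircase from [p0] to [q] that adjusts the
    coordinates one after the other. Moving [q] in direction [c] leaves the first
    [c] steps unchanged, extends step [c], and translates every later step,
    which by the rectangle identity transports the increment unchanged. *)
Lemma axis_potential (p0 : 'cV[R]_m) : cube I p0 ->
  exists H : 'cV[R]_m -> R, forall q c t, cube I q -> I t ->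
    H (replace q c t) - H q = axis_integral q c (q c 0) t.
Proof.
move=> Ip0.
pose stair (l : nat) (q : 'cV[R]_m) : 'cV[R]_m := \col_i (if (i < l)%N then q i 0 else p0 i 0).
pose H (l : nat) q := \sum_(i < m | (i < l)%N) axis_integral (stair i q) i (p0 i 0) (q i 0).
have Istair l q : cube I q -> cube I (stair l q).
  by move=> Iq i; rewrite mxE; case: ifP.
have HS (l : 'I_m) q : H l.+1 q = H l q + axis_integral (stair l q) l (p0 l 0) (q l 0).
  rewrite /H (bigD1 l)//= addrC; congr (_ + _); apply: eq_bigl => i.
  by rewrite ltnS ltn_neqAle andbC.
have stairL (l : 'I_m) q : stair l q = replace (stair l q) l (p0 l 0).
  by apply: colP2 => i; rewrite !mxE; case: eqP => // ->; rewrite ltnn.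
have stairS (l : 'I_m) q : stair l.+1 q = replace (stair l q) l (q l 0).
  by apply: colP2 => i; rewrite !mxE ltnS leq_eqVlt -val_eqE /=; case: eqP => // /val_inj ->.
have key c t q l : cube I q -> I t -> (l <= m)%N ->
    H l (replace q c t) - H l q =
    if (c < l)%N then axis_integral (stair l q) c (q c 0) t else 0.
  move=> Iq It; elim: l => [|l IH] lm.
    by rewrite /H !big_pred0 ?subrr.
  pose l' := Ordinal lm; have /= EH := HS l'; rewrite !EH.
  have {}IH := IH (ltnW lm); rewrite /= opprD addrACA IH.
  have [cl|lc|cl] := ltngtP c l.
  - rewrite (ltn_trans cl (ltnSn l)).
    have cl' : c != l' by apply: contraTN cl => /eqP -> /=; rewrite ltnn.
    have -> : stair l (replace q c t) = replace (stair l q) c t.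
      apply: colP2 => i; rewrite !mxE.
      by case: (eqVneq i c) => [->|_]; rewrite ?cl.
    rewrite replaceE eq_sym (negbTE cl').
    have E0 : stair l q = replace (stair l q) c (q c 0).
      by apply: colP2 => i; rewrite !mxE; case: eqP => // ->; rewrite cl.
    have := axis_integral_rectangle cl' (Istair l q Iq) (Iq c) It (Ip0 l') (Iq l').
    rewrite -(stairL l') -(stairS l') -E0 /= => E.
    by rewrite addrA E addrAC subrr add0r.
  - by rewrite ltnNge lc /= add0r; have -> : stair l (replace q c t) = stair l q;
      [apply: colP2 => i; rewrite !mxE; case: (eqVneq i c) => [->|//]; rewrite ltnNge ltnW
      |rewrite replaceE; case: eqP => [E|_]; rewrite ?subrr//; move: lc; rewrite -E ltnn].
  - have Ec : c = l' by exact: val_inj.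
    rewrite add0r cl ltnSn -Ec.
    have -> : stair l (replace q c t) = stair l q.
      apply: colP2 => i; rewrite !mxE; case: (eqVneq i c) => [->|//].
      by rewrite cl ltnn.
    have -> : stair l.+1 q = replace (stair l q) c (q c 0) by rewrite -cl stairS.
    rewrite axis_integral_replace replaceE eqxx.
    by rewrite -(axis_integral_chasles c (Istair l q Iq) (Ip0 c) (Iq c) It); lra.
have Em q : stair m q = q by apply: colP2 => i; rewrite mxE ltn_ord.
exists (H m) => q c t Iq It.
by rewrite (key c t q m Iq It (leqnn m)) ltn_ord Em.
Qed.

(** A general increment of the staircase potential is a sum of [m] axis increments,
    each of which is close to the first-order term [u dw] at its own base point;
    moving all base points to [p] costs products of two Hoelder increments. *)
Lemma closed_form_potential (p0 : 'cV[R]_m) : cube I p0 ->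
  exists H : 'cV[R]_m -> R, exists C : R, 0 <= C /\ forall p q, cube I p -> cube I q ->
    `|H q - H p - u p * (w q - w p)| <= C * `|q - p| `^ (beta + beta).
Proof.
move=> Ip0; have [H HH] := axis_potential Ip0.
exists H, (m%:R * (K + Cu * Cw)); split; first by rewrite mulr_ge0// addr_ge0// mulr_ge0.
move=> p q Ip Iq.
pose stair (l : nat) : 'cV[R]_m := \col_i (if (i < l)%N then q i 0 else p i 0).
have Is l : cube I (stair l) by move=> i; rewrite mxE; case: ifP.
have d0 l : `|stair l - p| <= `|q - p|.
  apply: mx_norm_le => // i j; rewrite (ord1 j) !mxE; case: ifP => _; last first.
    by rewrite subrr normr0.
  by have := mx_entry_le (q - p) i 0; rewrite !mxE.
have stp (l : 'I_m) : stair l.+1 = replace (stair l) l (q l 0).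
  by apply: colP2 => i; rewrite !mxE ltnS leq_eqVlt -val_eqE /=; case: eqP => // /val_inj ->.
have sl (l : 'I_m) : stair l l 0 = p l 0 by rewrite mxE ltnn.
have key l : (l <= m)%N -> `|H (stair l) - H p - u p * (w (stair l) - w p)| <=
    l%:R * (K + Cu * Cw) * `|q - p| `^ (beta + beta).
  elim: l => [|l IH] lm.
    have -> : stair 0%N = p by apply: colP2 => i; rewrite mxE.
    by rewrite !subrr mulr0 subrr normr0 !mul0r.
  have {}IH := IH (ltnW lm); pose l' := Ordinal lm.
  have e1 : `|H (stair l.+1) - H (stair l) -
      u (stair l) * (w (stair l.+1) - w (stair l))| <= K * `|q - p| `^ (beta + beta).
    have := stp l'; rewrite /= => ->; rewrite HH//.
    have := axis_integral_germ l' (Is l) (Is l l') (Iq l'); rewrite replace_id.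
    move=> /le_trans; apply; rewrite ler_wpM2l// powR_mono// ?addr_ge0 ?(ltW beta0)//.
    by rewrite (sl l'); have := mx_entry_le (q - p) l' 0; rewrite !mxE.
  have e2 : `|(u (stair l) - u p) * (w (stair l.+1) - w (stair l))| <=
      Cu * Cw * `|q - p| `^ (beta + beta).
    rewrite normrM powRDge0// mulrACA ler_pM//.
      by apply: (le_trans (hu Ip (Is l))); rewrite ler_wpM2l// powR_mono// ltW.
    apply: (le_trans (hw (Is l) (Is l.+1))); rewrite ler_wpM2l// powR_mono// ?(ltW beta0)//.
    have := stp l'; rewrite /= => ->; rewrite -{2}[stair l](replace_id _ l').
    rewrite (le_trans (replace_dist _ _ _ _))// (sl l').
    by have := mx_entry_le (q - p) l' 0; rewrite !mxE.
  have -> : H (stair l.+1) - H p - u p * (w (stair l.+1) - w p) =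
    (H (stair l) - H p - u p * (w (stair l) - w p)) +
    (H (stair l.+1) - H (stair l) - u (stair l) * (w (stair l.+1) - w (stair l))) +
    (u (stair l) - u p) * (w (stair l.+1) - w (stair l)) by ring.
  set r := `|q - p| `^ (beta + beta) in IH e1 e2 *.
  apply: (@le_trans _ _ (l%:R * (K + Cu * Cw) * r + K * r + Cu * Cw * r)).
    by rewrite (le_trans (ler_normD _ _))// lerD// (le_trans (ler_normD _ _))// lerD.
  by rewrite -[in leRHS]addn1 natrD le_of_eq//; ring.
have Em : stair m = q by apply: colP2 => i; rewrite mxE ltn_ord.
by have := key m (leqnn m); rewrite Em.
Qed.

End AxisForm.

(** * Sewing of almost flows *)

Section Sewing.
Context {R : realType}.

Lemma doubling (Q : R -> Prop) (h0 D : R) : 0 < h0 -> Q h0 ->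
  (forall h, 0 <= h -> Q h -> Q (2 * h)) -> (forall h h', h <= h' -> Q h' -> Q h) -> Q D.
Proof.
move=> h00 Q0 Q2 Qle.
have Qn n : Q (2 ^+ n * h0).
  elim: n => [|n IH]; first by rewrite mul1r.
  by rewrite exprS -mulrA; apply: Q2 => //; rewrite mulr_ge0 ?exprn_ge0// ltW.
pose N := Num.bound (`|D| / h0); apply: Qle (Qn N).
rewrite -ler_pdivrMr//; apply: (@le_trans _ _ (`|D| / h0)).
  by rewrite ler_pM2r ?invr_gt0// ler_norm.
rewrite (le_trans (ltW (archi_boundP _))) ?divr_ge0// ?(ltW h00)// -natrX ler_nat.
by rewrite ltnW// ltn_expl.
Qed.

Lemma bisection_bound_exists (A C r s : R) : 0 <= A -> 0 <= C -> A <= 2 `^ r -> r < s ->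
  exists2 K : R, 0 <= K & A * (K / 2 `^ s) + C <= K.
Proof.
move=> A0 C0 Ar rs; have p0 : 0 < 2 `^ s :> R by rewrite powR_gt0.
have q1 : A / 2 `^ s < 1.
  by rewrite ltr_pdivrMr// mul1r (le_lt_trans Ar)// powR2_lt.
have d0 : 0 < 1 - A / 2 `^ s by rewrite subr_gt0.
exists (C / (1 - A / 2 `^ s)); first by rewrite divr_ge0// ltW.
set t := A / _ in q1 d0 *.
rewrite mulrCA mulrC -/t -lerBrDl -{1}[C](divfK (lt0r_neq0 d0)).
by rewrite le_of_eq//; ring.
Qed.

(** The inequality that closes every induction on the dyadic depth: the two halves
    contribute [2 K / 2 ^ kappa < K], and for small [x] and [y], powers of the scale,
    the factors by which they are transported do not use up the slack. *)
Lemma sewing_slack (kappa C : R) : 1 < kappa -> 1 <= C ->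
  exists K e : R, [/\ 0 <= K, 0 < e & forall x y, 0 <= x <= e -> 0 <= y <= e ->
    K / 2 `^ kappa * (2 + 2 * C * x + K * y) + C <= K].
Proof.
move=> k1 C1; have C0 : 0 <= C by lra.
have [K K0 fixK] : exists2 K, 0 <= K & 2 * (K / 2 `^ kappa) + 2 * C = K.
  exists (2 * C * sewing_const kappa); last exact: sewing_const_fix.
  by rewrite !mulr_ge0// ltW// sewing_const_gt0.
exists K.
have t0 : 0 < K * (2 * C + K) + 1 by rewrite ltr_wpDl// mulr_ge0// addr_ge0// mulr_ge0.
exists (K * (2 * C + K) + 1)^-1; split=> //; first by rewrite invr_gt0.
set e := _^-1 => x y /andP[x0 xe] /andP[y0 ye].
have Ke : K / 2 `^ kappa <= K.
  by rewrite ler_pdivrMr ?powR_gt0// ler_peMr// ltW// powR_gt1// (lt_trans ltr01).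
have T0 : 0 <= K / 2 `^ kappa by rewrite divr_ge0// powR_ge0.
have He : K * (2 * C + K) * e <= 1.
  by rewrite ler_pdivrMr// mul1r lerDl.
have : K / 2 `^ kappa * (2 * C * x + K * y) <= K * ((2 * C + K) * e).
  apply: ler_pM; rewrite ?T0 ?Ke ?addr_ge0 ?mulr_ge0//.
  by rewrite [leRHS]mulrDl; apply: lerD; rewrite ler_wpM2l// mulr_ge0.
rewrite mulrA => H.
have -> : K / 2 `^ kappa * (2 + 2 * C * x + K * y) =
  2 * (K / 2 `^ kappa) + K / 2 `^ kappa * (2 * C * x + K * y) by ring.
by move: H He fixK; lra.
Qed.

Lemma cauchy_geometric d (x : nat -> 'cV[R]_d) (c q : R) :
  0 <= c -> 0 <= q < 1 -> (forall n, `|x n.+1 - x n| <= c * q ^+ n) ->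
  cvgn x.
Proof.
move=> c0 /andP[q0 q1] xq.
have q10 : 0 < 1 - q by rewrite subr_gt0.
have tail n k : `|x (n + k)%N - x n| <= c / (1 - q) * q ^+ n.
  have : `|x (n + k)%N - x n| <= c / (1 - q) * q ^+ n * (1 - q ^+ k).
    elim: k => [|k IH]; first by rewrite addn0 !subrr normr0 mulr0.
    rewrite (le_trans (ler_distD (x (n + k)%N) _ _))// addnS.
    rewrite (le_trans (lerD (xq _) IH))// exprD exprS.
    rewrite -{1}[c](divfK (lt0r_neq0 q10)).
    by rewrite le_of_eq//; ring.
  move/le_trans; apply; rewrite ler_piMr ?mulr_ge0 ?exprn_ge0 ?invr_ge0 ?(ltW q10)//.
  by rewrite gerBl exprn_ge0.
apply: cauchy_cvg; apply/cauchyP => e e0.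
have : (fun n => c / (1 - q) * q ^+ n) @ \oo --> (0 : R).
  by apply: cvg_geometric; rewrite ger0_norm.
move=> /cvgrPdist_lt /(_ _ e0) [N _ HN].
have close n k : (N <= n)%N -> ball (x n) e (x (n + k)%N).
  move=> Nn; rewrite -ball_normE /ball_ /= distrC (le_lt_trans (tail _ _))//.
  by have := HN n Nn; rewrite /= sub0r normrN; apply: le_lt_trans; rewrite ler_norm.
exists (x N), N => // k /= Nk; rewrite -(subnKC Nk); exact: close.
Qed.

Context {V : normedModType R} {d : nat}.
Local Notation W := 'cV[R]_d.
Implicit Types (E : V -> V -> W -> W) (p q r : V) (a b : W).

Fixpoint dyadic E n p q a : W :=
  if n is n'.+1 then dyadic E n' (midpoint p q) q (dyadic E n' p (midpoint p q) a)
  else E p q a.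

(** [lam = 0] describes increments that are bounded uniformly in the state, and
    [lam = 1] increments of linear growth. The defect measures the failure of two
    half steps to compose to a full step. *)
Record almost_flow (X : set V) (lam C beta kappa : R) E : Prop := AlmostFlow {
  af_incr : forall p q a, X p -> X q ->
    `|E p q a - a| <= C * (1 + lam * `|a|) * `|q - p| `^ beta;
  af_lip : forall p q a b, X p -> X q ->
    `|E p q a - E p q b - (a - b)| <= C * `|q - p| `^ beta * `|a - b|;
  af_defect : forall p q a, X p -> X q -> `|q - p| <= 1 ->
    `|E (midpoint p q) q (E p (midpoint p q) a) - E p q a| <=
    C * (1 + lam * `|a|) * `|q - p| `^ kappa }.

Lemma af_lip1 X lam C beta kappa E p q a b : almost_flow X lam C beta kappa E ->
  X p -> X q -> `|E p q a - E p q b| <= (1 + C * `|q - p| `^ beta) * `|a - b|.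
Proof.
move=> AF Xp Xq; rewrite -[_ - E p q b](subrK (a - b)) (le_trans (ler_normD _ _))//.
by rewrite [leRHS]mulrDl mul1r addrC lerD2l (af_lip AF).
Qed.

(** By induction on the depth: the error at scale [h] is at most that of the two
    halves, which is smaller by the factor [2 ^ (1 - kappa)], plus the defect of one
    step. *)
Lemma dyadic_close (C beta kappa : R) : 1 <= C -> 0 < beta -> beta <= kappa -> 1 < kappa ->
  exists K h0 : R, [/\ 0 <= K, 0 < h0 <= 1 & forall X lam E, midpoint_closed X ->
    0 <= lam <= 1 -> almost_flow X lam C beta kappa E ->
    forall n p q a, X p -> X q -> `|q - p| <= h0 ->
      `|dyadic E n p q a - E p q a| <= K * (1 + lam * `|a|) * `|q - p| `^ kappa].
Proof.
move=> C1 beta0 bk k1; have C0 : 0 <= C by lra.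
have [K [e [K0 e0 Ke]]] := sewing_slack k1 C1.
have [h1 h10 Hh1] := powR_small beta0 e0.
exists K, (Num.min h1 1); split=> //; first by rewrite lt_min h10 ltr01 ge_min lexx orbT.
move=> X lam E Xm /andP[lam0 lam1] AF.
elim=> [|n IH] p q a Xp Xq.
  by rewrite subrr normr0 !mulr_ge0 ?powR_ge0// addr_ge0// mulr_ge0.
rewrite le_min => /andP[hq h1q] /=.
have Xpq := Xm _ _ Xp Xq; set m := midpoint p q in Xpq *.
set h := `|q - p| in hq h1q *.
have h0 : 0 <= h by exact: normr_ge0.
have hm : h / 2 <= Num.min h1 1 by rewrite le_min; apply/andP; split; lra.
have IHl := IH p m a Xp Xpq; have IHr := IH m q (dyadic E n p m a) Xpq Xq.
rewrite norm_midl in IHl; rewrite norm_midr in IHr.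
have {}IHl := IHl hm; have {}IHr := IHr hm.
have D1 := af_defect AF a Xp Xq h1q; rewrite -/m -/h in D1.
have L1 := af_lip1 (dyadic E n p m a) (E p m a) AF Xpq Xq; rewrite norm_midr -/h in L1.
have G1 := af_incr AF a Xp Xpq; rewrite norm_midl -/h in G1.
rewrite powR_half// in IHl, IHr.
have xe : h `^ beta <= e by rewrite Hh1// h0.
have yx : h `^ kappa <= h `^ beta by rewrite powR_anti// h0.
have x2 : (h / 2) `^ beta <= h `^ beta by rewrite powR_mono// ?(ltW beta0)//; lra.
have y2 : h `^ kappa / 2 `^ kappa <= h `^ kappa.
  by rewrite -powR_half// powR_mono//; lra.
have := Ke (h `^ beta) (h `^ kappa); rewrite !powR_ge0 xe (le_trans yx xe) => /(_ isT isT).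
set x := h `^ beta in xe yx x2 *; set y := h `^ kappa in yx y2 IHl IHr D1 *.
have x0 : 0 <= x by exact: powR_ge0. have y0 : 0 <= y by exact: powR_ge0.
set A := dyadic E n p m a in IHl IHr L1 *; set B := E p m a in IHl D1 L1 G1 *.
set w := 1 + lam * `|a| in IHl D1 G1 *.
have w1 : 1 <= w by rewrite lerDl mulr_ge0.
have w0 : 0 <= w by lra.
set T := K / 2 `^ kappa => HK.
have T0 : 0 <= T by rewrite divr_ge0// powR_ge0.
have IHl' : `|A - B| <= T * w * y by rewrite (le_trans IHl)// /T le_of_eq//; ring.
have AB : `|A - B| <= K * w * y by rewrite (le_trans IHl)// ler_wpM2l// mulr_ge0.
have wA : 1 + lam * `|A| <= w * (1 + C * x + K * y).
  have nA : `|A| <= `|a| + C * w * x + K * w * y.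
    rewrite -[A](subrK B) (le_trans (ler_normD _ _))// addrC lerD//.
    rewrite -[B](subrK a) (le_trans (ler_normD _ _))// addrC lerD//.
    by rewrite (le_trans G1)// ler_wpM2l// mulr_ge0.
  apply: (@le_trans _ _ (w + 1 * (C * w * x + K * w * y))); last first.
    by rewrite le_of_eq//; ring.
  rewrite /w -addrA lerD2l.
  apply: (@le_trans _ _ (lam * (`|a| + (C * w * x + K * w * y)))).
    by rewrite ler_wpM2l// addrA.
  rewrite mulrDr lerD2l ler_wpM2r// addr_ge0// !mulr_ge0//.
have IHr' : `|dyadic E n m q A - E m q A| <= T * y * (w * (1 + C * x + K * y)).
  apply: (le_trans IHr).
  rewrite (_ : K * _ * _ = T * y * (1 + lam * `|A|)); last by rewrite /T; ring.
  by rewrite ler_wpM2l// mulr_ge0.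
have L1' : `|E m q A - E m q B| <= (1 + C * x) * (T * w * y).
  apply: (le_trans L1); apply: ler_pM => //; first by rewrite addr_ge0// mulr_ge0// powR_ge0.
  by rewrite lerD2l ler_wpM2l.
have -> : dyadic E n m q A - E p q a =
   (dyadic E n m q A - E m q A) + (E m q A - E m q B) + (E m q B - E p q a).
  by apply: colP2 => i; rewrite !mxE; ring.
apply: (@le_trans _ _ (T * y * (w * (1 + C * x + K * y)) + (1 + C * x) * (T * w * y) + C * w * y)).
  by rewrite (le_trans (ler_normD _ _))// lerD// (le_trans (ler_normD _ _))// lerD.
rewrite (_ : _ + _ = (T * (2 + 2 * C * x + K * y) + C) * (w * y)); last by ring.
by rewrite -[K * w * y]mulrA ler_wpM2r// mulr_ge0.
Qed.

(** The bound at small scales is iterated finitely many times to cover the whole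
    domain. That [M] is chosen before the almost flow is what allows a field
    to be truncated at a radius known in advance. *)
Lemma dyadic_growth (C beta kappa D : R) : 1 <= C -> 0 < beta -> beta <= kappa -> 1 < kappa ->
  exists M : R, 1 <= M /\ forall X E, midpoint_closed X ->
    almost_flow X 1 C beta kappa E ->
    forall n p q a, X p -> X q -> `|q - p| <= D ->
      1 + `|dyadic E n p q a| <= M * (1 + `|a|).
Proof.
move=> C1 beta0 bk k1; have C0 : 0 <= C by lra.
have [K [h0 [K0 /andP[h00 h01] HK]]] := dyadic_close C1 beta0 bk k1.
pose Q h := exists M : R, 1 <= M /\ forall X E, midpoint_closed X ->
    almost_flow X 1 C beta kappa E ->
    forall n p q a, X p -> X q -> `|q - p| <= h ->
      1 + `|dyadic E n p q a| <= M * (1 + `|a|).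
have E0 X E h p q a : almost_flow X 1 C beta kappa E -> X p -> X q -> `|q - p| <= h ->
    1 + `|E p q a| <= (1 + C * h `^ beta) * (1 + `|a|).
  move=> AF Xp Xq pq; rewrite -[E p q a](subrK a).
  have := af_incr AF a Xp Xq; rewrite mul1r => H.
  have := ler_normD (E p q a - a) a.
  have : C * (1 + `|a|) * `|q - p| `^ beta <= C * h `^ beta * (1 + `|a|).
    rewrite mulrAC ler_wpM2r ?addr_ge0// ler_wpM2l// powR_mono// ltW//.
  by rewrite mulrDl mul1r; lra.
apply: (@doubling Q h0 D h00).
- exists (1 + C + K); split; first by lra.
  move=> X E Xm AF n p q a Xp Xq pq.
  have l01 : 0 <= (1 : R) <= 1 by rewrite ler01 lexx.
  have := HK X 1 E Xm l01 AF n p q a Xp Xq pq; rewrite mul1r => H.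
  have hp s : 0 < s -> `|q - p| `^ s <= 1.
    by move=> s0; rewrite powR_le1// normr_ge0 (le_trans pq).
  have := E0 _ _ _ _ _ a AF Xp Xq (lexx _).
  have := ler_normD (dyadic E n p q a - E p q a) (E p q a); rewrite subrK.
  have : C * `|q - p| `^ beta * (1 + `|a|) <= C * 1 * (1 + `|a|).
    by rewrite ler_wpM2r ?addr_ge0// ler_wpM2l// hp.
  have : K * (1 + `|a|) * `|q - p| `^ kappa <= K * (1 + `|a|) * 1.
    by rewrite ler_wpM2l ?mulr_ge0 ?addr_ge0// hp// (lt_le_trans beta0).
  by move: H; rewrite !mulrDl !mul1r !mulr1; lra.
- move=> h h0' [M [M1 HM]]; have M0 : 0 <= M by lra.
  exists (M * M + 1 + C * (2 * h) `^ beta); split.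
    by rewrite -addrA addrCA lerDl addr_ge0 ?mulr_ge0 ?powR_ge0.
  move=> X E Xm AF [|n] p q a Xp Xq pq /=.
    rewrite (le_trans (E0 _ _ _ _ _ a AF Xp Xq pq))// ler_wpM2r ?addr_ge0//.
    by rewrite lerD2r lerDr mulr_ge0.
  have Xpq := Xm _ _ Xp Xq.
  have pq2 : `|q - p| / 2 <= h by lra.
  rewrite (le_trans (HM X E Xm AF n _ _ _ Xpq Xq _)) ?norm_midr//.
  rewrite (le_trans (ler_wpM2l M0 (HM X E Xm AF n _ _ _ Xp Xpq _))) ?norm_midl//.
  rewrite mulrA ler_wpM2r ?addr_ge0// -addrA lerDl addr_ge0// mulr_ge0// powR_ge0//.
- move=> h h' hh' [M [M1 HM]]; exists M; split=> // X E Xm AF n p q a Xp Xq pq.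
  by apply: (HM X E) => //; exact: le_trans hh'.
Qed.

End Sewing.

Section RegularFlow.
Context {R : realType} {V : normedModType R} {d : nat}.
Local Notation W := 'cV[R]_d.
Implicit Types (E : V -> V -> W -> W) (p q : V) (a b : W).

(** The four-point bounds are those of an increment that is differentiable in the
    state with a [gamma]-Hoelder derivative. *)
Record regular_flow (X : set V) (C beta gamma kappa : R) E : Prop := RegularFlow {
  rf_af : almost_flow X 0 C beta kappa E;
  rf_four : forall p q a b a' b', X p -> X q ->
    `|E p q a - E p q b - (E p q a' - E p q b') - (a - b - (a' - b'))| <=
    C * `|q - p| `^ beta * (`|a - b - (a' - b')| +
       `|a' - b'| * (`|a - a'| `^ gamma + `|b - b'| `^ gamma));
  rf_defect : forall p q a b, X p -> X q -> `|q - p| <= 1 ->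
    `|E (midpoint p q) q (E p (midpoint p q) a) - E p q a -
      (E (midpoint p q) q (E p (midpoint p q) b) - E p q b)| <=
    C * `|q - p| `^ kappa * `|a - b| }.

Variables (X : set V) (C beta gamma kappa : R) (E : V -> V -> W -> W).
Hypotheses (C1 : 1 <= C) (beta0 : 0 < beta) (gamma01 : 0 < gamma <= 1).
Hypotheses (kappaE : kappa = beta + beta * gamma) (kappa1 : 1 < kappa).
Hypotheses (Xm : midpoint_closed X) (RF : regular_flow X C beta gamma kappa E).

Let C0 : 0 <= C. Proof. exact: le_trans C1. Qed.
Let AF := rf_af RF.
Let gamma0 : 0 < gamma. Proof. by case/andP: gamma01. Qed.
Let beta_kappa : beta <= kappa.
Proof. by rewrite kappaE lerDl mulr_ge0// ltW. Qed.
Let half_le (h : R) : 0 <= h -> h / 2 <= h. Proof. by move=> ?; lra. Qed.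

(** Multiplying the Lipschitz constants of the [2 ^ n] factors gives nothing, as
    [(1 + C (h / 2 ^ n) ^ beta) ^ (2 ^ n)] diverges for [beta < 1]. Instead, the
    difference of two trajectories is compared with its first-order
    increment, by the same induction on the depth as for the trajectories. *)
Lemma dyadic_lipschitz : exists L h0 : R, [/\ 0 <= L, 0 < h0 <= 1 &
  forall n p q a b, X p -> X q -> `|q - p| <= h0 ->
    `|dyadic E n p q a - dyadic E n p q b| <= (1 + L * `|q - p| `^ beta) * `|a - b|].
Proof.
have [K [h1 [K0 /andP[h10 h11] HK]]] := @dyadic_close R V d _ _ _ C1 beta0 beta_kappa kappa1.
pose C2 := C + 2 * (C * (1 + C) * (K + 1)).
have CC2 : C <= C2 by rewrite lerDl !mulr_ge0// addr_ge0.
have [K' [e [K'0 e0 Ke]]] := sewing_slack kappa1 (le_trans C1 CC2).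
have [h2 h20 Hh2] := powR_small beta0 e0.
pose h0 := Num.min h1 h2.
have h00 : 0 < h0 by rewrite lt_min h10.
have h01 : h0 <= 1 by rewrite ge_min h11.
have main n p q a b : X p -> X q -> `|q - p| <= h0 ->
    `|dyadic E n p q a - dyadic E n p q b - (E p q a - E p q b)| <=
    K' * `|a - b| * `|q - p| `^ kappa.
  elim: n p q a b => [|n IH] p q a b Xp Xq hq.
    by rewrite /= subrr normr0 !mulr_ge0// powR_ge0.
  rewrite /=; have Xpq := Xm Xp Xq; set m := midpoint p q in Xpq *.
  set h := `|q - p| in hq *.
  have h_ge0 : 0 <= h by exact: normr_ge0.
  have hm : h / 2 <= h0 by rewrite (le_trans (half_le h_ge0)).
  have IHl := IH p m a b Xp Xpq; rewrite norm_midl -/h in IHl; have {}IHl := IHl hm.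
  have IHr := IH m q (dyadic E n p m a) (dyadic E n p m b) Xpq Xq.
  rewrite norm_midr -/h in IHr; have {}IHr := IHr hm.
  have hq1 : h <= 1 by rewrite (le_trans hq).
  have D := rf_defect RF a b Xp Xq hq1; rewrite -/m -/h in D.
  have lam01 : 0 <= (0 : R) <= 1 by rewrite lexx ler01.
  have hm1 : `|m - p| <= h1 by rewrite norm_midl -/h (le_trans hm)// ge_min lexx.
  have Ka := HK _ _ _ Xm lam01 AF n p m a Xp Xpq hm1.
  have Kb := HK _ _ _ Xm lam01 AF n p m b Xp Xpq hm1.
  rewrite norm_midl -/h mul0r addr0 mulr1 in Ka.
  rewrite norm_midl -/h mul0r addr0 mulr1 in Kb.
  have L1 := af_lip1 a b AF Xp Xpq; rewrite norm_midl -/h in L1.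
  have F := rf_four RF (dyadic E n p m a) (dyadic E n p m b) (E p m a) (E p m b) Xpq Xq.
  rewrite norm_midr -/h in F.
  have xe : h `^ beta <= e by rewrite Hh2// h_ge0 (le_trans hq)// ge_min lexx orbT.
  have yx : h `^ kappa <= h `^ beta by rewrite powR_anti// h_ge0.
  have x2 : (h / 2) `^ beta <= h `^ beta by rewrite powR_mono ?(ltW beta0) ?half_le ?divr_ge0.
  have x1 : h `^ beta <= 1 by rewrite powR_le1// h_ge0.
  have y2 : (h / 2) `^ kappa <= h `^ kappa.
    by rewrite powR_mono ?half_le ?divr_ge0 ?(ltW (lt_trans ltr01 kappa1)).
  have zx : (h / 2) `^ kappa <= h `^ beta by rewrite (le_trans y2).
  have xg : h `^ beta * (h `^ beta) `^ gamma = h `^ kappa.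
    by rewrite -powRrM kappaE powRDge0// mulr_gt0.
  have close_pow (s : R) : 0 <= s -> s <= K * (h / 2) `^ kappa ->
      (h / 2) `^ beta * s `^ gamma <= (K + 1) * h `^ kappa.
    move=> s0 sK; rewrite -xg mulrCA ler_pM ?powR_ge0//.
    have : s `^ gamma <= (K * h `^ beta) `^ gamma.
      by rewrite powR_mono ?(ltW gamma0)// (le_trans sK)// ler_wpM2l.
    move=> /le_trans; apply; rewrite powRM ?powR_ge0// ler_wpM2r ?powR_ge0//.
    apply: (@le_trans _ _ ((K + 1) `^ gamma)).
      by rewrite powR_mono ?(ltW gamma0)// lerDl.
    by rewrite ler1_powR ?lerDr//; case/andP: gamma01.
  have Pa := close_pow _ (normr_ge0 _) Ka; have Pb := close_pow _ (normr_ge0 _) Kb.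
  have := Ke (h `^ beta) (h `^ kappa); rewrite !powR_ge0 xe (le_trans yx xe) => /(_ isT isT).
  rewrite powR_half// in IHl, IHr.
  have x0 : 0 <= h `^ beta by exact: powR_ge0. have y0 : 0 <= h `^ kappa by exact: powR_ge0.
  set x := h `^ beta in x0 x1 x2 xe yx L1 *.
  set y := h `^ kappa in y0 yx Pa Pb IHl IHr D *.
  set x' := (h / 2) `^ beta in x2 Pa Pb F L1 *.
  have x'0 : 0 <= x' by exact: powR_ge0.
  set A := dyadic E n p m a in IHl IHr F Ka Pa *.
  set A' := dyadic E n p m b in IHl IHr F Kb Pb *.
  set c := E p m a in IHl D L1 F Ka Pa *; set c' := E p m b in IHl D L1 F Kb Pb *.
  set N := `|a - b| in IHl D L1 *; have N0 : 0 <= N by exact: normr_ge0.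
  set T := K' / 2 `^ kappa => HK'.
  have T0 : 0 <= T by rewrite divr_ge0// powR_ge0.
  have TK : T <= K'.
    by rewrite ler_pdivrMr ?powR_gt0// ler_peMr// ltW// powR_gt1// (lt_trans ltr01).
  clearbody A A' c c' N x y x'.
  set u := `|A - A' - (c - c')| in IHl F *.
  have u0 : 0 <= u by exact: normr_ge0.
  have u1 : u <= T * (N * y) by rewrite (le_trans IHl)// /T le_of_eq//; ring.
  have c1 : `|c - c'| <= (1 + C * x) * N.
    by rewrite (le_trans L1)// ler_wpM2r// lerD2l ler_wpM2l.
  have c2 : `|c - c'| <= (1 + C) * N.
    by rewrite (le_trans c1)// ler_wpM2r// lerD2l ler_piMr.
  have NAA : `|A - A'| <= (1 + C2 * x + K' * y) * N.
    rewrite -[A - A'](subrK (c - c')) (le_trans (ler_normD _ _))//.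
    apply: (@le_trans _ _ (K' * (N * y) + (1 + C2 * x) * N)); last by rewrite le_of_eq//; ring.
    apply: lerD; first by rewrite (le_trans u1)// ler_wpM2r// mulr_ge0.
    by rewrite (le_trans c1)// ler_wpM2r// lerD2l ler_wpM2r.
  have T1 : `|dyadic E n m q A - dyadic E n m q A' - (E m q A - E m q A')| <=
      T * y * ((1 + C2 * x + K' * y) * N).
    rewrite (le_trans IHr)//.
    rewrite (_ : K' * _ * _ = T * y * `|A - A'|); last by rewrite /T; ring.
    by rewrite ler_wpM2l// mulr_ge0.
  have T2 : `|E m q A - E m q A' - (E m q c - E m q c')| <=
      (1 + C2 * x) * (T * (N * y)) + (2 * (C * (1 + C) * (K + 1))) * (N * y).
    rewrite -[_ - (E m q c - _)](subrK (A - A' - (c - c'))) (le_trans (ler_normD _ _))//.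
    rewrite -/u (le_trans (lerD F (lexx u)))//.
    set g1 := `|A - c| `^ gamma in Pa *; set g2 := `|A' - c'| `^ gamma in Pb *.
    apply: (@le_trans _ _ ((1 + C * x') * u + C * (`|c - c'| * (x' * g1 + x' * g2)))).
      by clearbody u g1 g2; rewrite le_of_eq//; ring.
    have Cx : 1 + C * x' <= 1 + C2 * x by rewrite lerD2l ler_pM.
    have Cx0 : 0 <= 1 + C * x' by rewrite addr_ge0 ?mulr_ge0.
    apply: lerD; first exact: ler_pM.
    apply: (@le_trans _ _ (C * ((1 + C) * N * ((K + 1) * y + (K + 1) * y)))).
      apply: (ler_wpM2l C0); apply: (ler_pM (normr_ge0 _) _ c2 (lerD Pa Pb)).
      by rewrite addr_ge0// mulr_ge0// powR_ge0.
    by rewrite le_of_eq//; ring.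
  have -> : dyadic E n m q A - dyadic E n m q A' - (E p q a - E p q b) =
     (dyadic E n m q A - dyadic E n m q A' - (E m q A - E m q A')) +
     (E m q A - E m q A' - (E m q c - E m q c')) +
     (E m q c - E p q a - (E m q c' - E p q b)).
    by apply: colP2 => i; rewrite !mxE; ring.
  apply: (@le_trans _ _ (T * y * ((1 + C2 * x + K' * y) * N) +
      ((1 + C2 * x) * (T * (N * y)) + (2 * (C * (1 + C) * (K + 1))) * (N * y)) + C * y * N)).
    by rewrite (le_trans (ler_normD _ _))// lerD// (le_trans (ler_normD _ _))// lerD.
  rewrite (_ : _ + C * y * N = (T * (2 + 2 * C2 * x + K' * y) + C2) * (N * y)); last first.
    by rewrite /C2; ring.
  by rewrite -[K' * N * y]mulrA ler_wpM2r// mulr_ge0.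
exists (C + K'), h0; split; rewrite ?addr_ge0 ?h00//.
move=> n p q a b Xp Xq hq.
have yx : `|q - p| `^ kappa <= `|q - p| `^ beta.
  by rewrite powR_anti// normr_ge0 (le_trans hq).
rewrite -[_ - dyadic E n p q b](subrK (E p q a - E p q b)) (le_trans (ler_normD _ _))//.
rewrite (le_trans (lerD (main _ _ _ _ _ Xp Xq hq) (af_lip1 _ _ AF Xp Xq)))//.
rewrite mulrAC -mulrDl ler_wpM2r// addrC -addrA lerD2l mulrDl lerD2l.
by rewrite ler_wpM2l.
Qed.

Hypothesis Xbd : exists D : R, forall p q, X p -> X q -> `|q - p| <= D.

(** Refining once more changes each of the [2 ^ n] pieces by [O ((h / 2 ^ n) ^ kappa)],
    and the Lipschitz bound transports these changes to the end point: the
    successive differences decrease geometrically. *)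
Lemma dyadic_step_cvg : exists h0 : R, 0 < h0 /\
  forall p q a, X p -> X q -> `|q - p| <= h0 -> cvgn (fun n => dyadic E n p q a).
Proof.
have [L [h1 [L0 /andP[h10 h11] HL]]] := dyadic_lipschitz.
have k2 : 2 < 2 `^ kappa :> R by have := @powR2_lt R _ _ kappa1; rewrite powRr1.
have [e e0 He] : exists2 e : R, 0 < e & L * e < 2 `^ kappa - 2.
  exists ((2 `^ kappa - 2) / (L + 1)); first by rewrite divr_gt0 ?subr_gt0 ?ltr_wpDl.
  rewrite mulrCA gtr_pMr ?subr_gt0// ltr_pdivrMr ?ltr_wpDl// mul1r.
  by rewrite ltrDl.
have [h2 h20 Hh2] := powR_small beta0 e0.
pose h0 := Num.min h1 h2.
have h00 : 0 < h0 by rewrite lt_min h10.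
pose rho := (2 + L * e) / 2 `^ kappa.
have p0 : 0 < 2 `^ kappa :> R by rewrite powR_gt0.
have rho0 : 0 <= rho by rewrite divr_ge0 ?addr_ge0 ?mulr_ge0 ?(ltW e0) ?(ltW p0).
have rho1 : rho < 1 by rewrite ltr_pdivrMr// mul1r -ltrBrDl.
have step n p q a : X p -> X q -> `|q - p| <= h0 ->
   `|dyadic E n.+1 p q a - dyadic E n p q a| <= C * `|q - p| `^ kappa * rho ^+ n.
  elim: n p q a => [|n IH] p q a Xp Xq hq.
    rewrite expr0 mulr1; have := af_defect AF a Xp Xq; rewrite mul0r addr0 mulr1.
    by apply; rewrite (le_trans hq)// ge_min h11.
  have Xpq := Xm Xp Xq; set h := `|q - p| in hq *; have h_ge0 : 0 <= h := normr_ge0 _.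
  have hm : h / 2 <= h0 by rewrite (le_trans (half_le h_ge0)).
  rewrite [dyadic E n.+2 p q a]/dyadic -/(dyadic E n.+1 _ _ _) -/(dyadic E n.+1 _ _ _).
  rewrite [dyadic E n.+1 p q a]/dyadic -/(dyadic E n _ _ _) -/(dyadic E n _ _ _).
  set m := midpoint p q in Xpq *.
  set A := dyadic E n.+1 p m a; set B := dyadic E n p m a.
  have I1 := IH p m a Xp Xpq; rewrite norm_midl -/h -/A -/B in I1.
  have I2 := IH m q A Xpq Xq; rewrite norm_midr -/h in I2.
  have hL := HL n m q A B Xpq Xq; rewrite norm_midr -/h in hL.
  have {}hL := hL (le_trans hm _); rewrite ge_min lexx in hL; have {}hL := hL isT.
  rewrite (le_trans (ler_distD (dyadic E n m q A) _ _))//.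
  rewrite (le_trans (lerD (I2 hm) hL))//.
  have xe : (h / 2) `^ beta <= e.
    by rewrite Hh2// divr_ge0//= (le_trans hm)// ge_min lexx orbT.
  apply: (@le_trans _ _ (C * (h / 2) `^ kappa * rho ^+ n +
      (1 + L * e) * (C * (h / 2) `^ kappa * rho ^+ n))).
    rewrite lerD2l ler_pM ?I1 ?addr_ge0 ?mulr_ge0 ?powR_ge0// lerD2l ler_wpM2l//.
  by rewrite powR_half// exprS /rho le_of_eq//; ring.
exists h0; split=> // p q a Xp Xq hq.
apply: (@cauchy_geometric _ _ _ (C * `|q - p| `^ kappa) rho).
- by rewrite mulr_ge0 ?powR_ge0.
- by rewrite rho0.
- by move=> n; exact: step.
Qed.

Lemma dyadic_global : exists L : R, [/\ 0 <= L,
  forall n p q a b, X p -> X q -> `|dyadic E n p q a - dyadic E n p q b| <= L * `|a - b| &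
  forall p q a, X p -> X q -> cvgn (fun n => dyadic E n p q a)].
Proof.
have [D HD] := Xbd.
have [L1 [h1 [L10 /andP[h10 h11] HL]]] := dyadic_lipschitz.
have [h2 [h20 H2]] := dyadic_step_cvg.
pose Q h := exists L : R, [/\ 0 <= L,
  forall n p q a b, X p -> X q -> `|q - p| <= h ->
     `|dyadic E n p q a - dyadic E n p q b| <= L * `|a - b| &
  forall p q a, X p -> X q -> `|q - p| <= h -> cvgn (fun n => dyadic E n p q a)].
suff [L [L0 HLL Hc]] : Q D.
  by exists L; split=> // *; [apply: HLL|apply: Hc] => //; exact: HD.
apply: (@doubling R Q (Num.min h1 h2)); first by rewrite lt_min h10.
- exists (1 + L1); split; first by rewrite addr_ge0.
    move=> n p q a b Xp Xq; rewrite le_min => /andP[hq _].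
    rewrite (le_trans (HL _ _ _ _ _ Xp Xq hq))// ler_wpM2r// lerD2l ler_piMr//.
    by rewrite powR_le1// normr_ge0 (le_trans hq).
  by move=> p q a Xp Xq; rewrite le_min => /andP[_ hq]; exact: H2.
- move=> h h0 [L [L0 HLL Hc]]; exists (L * L + (1 + C * (2 * h) `^ beta)); split.
  + by rewrite !addr_ge0 ?mulr_ge0 ?powR_ge0.
  + move=> [|n] p q a b Xp Xq hq /=.
      rewrite (le_trans (af_lip1 _ _ AF Xp Xq))// ler_wpM2r//.
      apply: (@le_trans _ _ (1 + C * (2 * h) `^ beta)); last by rewrite lerDr mulr_ge0.
      by rewrite lerD2l ler_wpM2l// powR_mono// ltW.
    have Xpq := Xm Xp Xq.
    have hm : `|q - p| / 2 <= h by lra.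
    rewrite (le_trans (HLL _ _ _ _ _ Xpq Xq _)) ?norm_midr//.
    rewrite (le_trans (ler_wpM2l L0 (HLL _ _ _ _ _ Xp Xpq _))) ?norm_midl//.
    by rewrite mulrA ler_wpM2r// lerDl addr_ge0 ?mulr_ge0 ?powR_ge0.
  + move=> p q a Xp Xq hq; have Xpq := Xm Xp Xq.
    have hm : `|q - p| / 2 <= h by lra.
    have cl := Hc p (midpoint p q) a Xp Xpq; rewrite norm_midl in cl; have {}cl := cl hm.
    set A := lim ((fun n => dyadic E n p (midpoint p q) a) @ \oo) in cl.
    have cr := Hc (midpoint p q) q A Xpq Xq; rewrite norm_midr in cr; have {}cr := cr hm.
    apply/cvg_ex; exists (lim ((fun n => dyadic E n (midpoint p q) q A) @ \oo)).
    rewrite -(cvg_shiftS (fun n => dyadic E n p q a)) /=.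
    apply/cvgrPdist_le => e e0.
    have e20 : 0 < e / 2 / (L + 1) by rewrite !divr_gt0// ltr_wpDl.
    move/cvgrPdist_le : cl => /(_ _ e20) [N1 _ HN1].
    move/cvgrPdist_le : cr => /(_ (e / 2)) [|N2 _ HN2]; first by rewrite divr_gt0.
    exists (maxn N1 N2) => // n /=; rewrite geq_max => /andP[n1 n2].
    have /= := HN1 n n1; have /= := HN2 n n2.
    set B := dyadic E n p (midpoint p q) a => nB nA.
    rewrite (le_trans (ler_distD (dyadic E n (midpoint p q) q A) _ _))//.
    rewrite [e]splitr lerD//.
    rewrite (le_trans (HLL _ _ _ _ _ Xpq Xq _)) ?norm_midr//.
    rewrite (le_trans (ler_wpM2l L0 nA))// mulrCA ger_pMr ?divr_gt0//.
    by rewrite ler_pdivrMr ?ltr_wpDl// mul1r lerDl.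
- move=> h h' hh' [L [L0 HLL Hc]]; exists L; split=> // *.
    by apply: HLL => //; exact: le_trans hh'.
  by apply: Hc => //; exact: le_trans hh'.
Qed.

Lemma cvg_norm_le (x : nat -> W) (l b : W) (M : R) :
  x @ \oo --> l -> (forall n, `|x n - b| <= M) -> `|l - b| <= M.
Proof.
move=> xl xM; apply/ler_addgt0Pr => e e0.
move/cvgrPdist_le : xl => /(_ _ e0) [N _ HN].
have := HN N (leqnn N); rewrite /= => H.
by rewrite (le_trans (ler_distD (x N) _ _))// addrC lerD.
Qed.

(** The recursive definition of the compositions makes the limit consistent at the
    midpoint of each segment; other intermediate points are out of reach of this
    construction. The last clause transfers to the limit any bound that holds at
    all depths. *)
Lemma dyadic_flow : exists (phi : V -> V -> W -> W) (K L h0 : R),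
  [/\ 0 <= K, 0 <= L, 0 < h0 <= 1,
      forall p q a, X p -> X q ->
        phi p q a = phi (midpoint p q) q (phi p (midpoint p q) a) &
      [/\ forall p q a, X p -> X q -> `|q - p| <= h0 ->
            `|phi p q a - E p q a| <= K * `|q - p| `^ kappa,
          forall p q a b, X p -> X q -> `|q - p| <= h0 ->
            `|phi p q a - phi p q b| <= (1 + L * `|q - p| `^ beta) * `|a - b| &
          forall p q a b M, X p -> X q -> (forall n, `|dyadic E n p q a - b| <= M) ->
            `|phi p q a - b| <= M]].
Proof.
have [L1 [h1 [L10 /andP[h10 h11] HL]]] := dyadic_lipschitz.
have [K [h2 [K0 /andP[h20 h21] HK]]] := @dyadic_close R V d _ _ _ C1 beta0 beta_kappa kappa1.
have [L [L0 HLL Hc]] := dyadic_global.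
pose phi p q a := lim ((fun n => dyadic E n p q a) @ \oo).
have phic p q a : X p -> X q -> (fun n => dyadic E n p q a) @ \oo --> phi p q a.
  by move=> Xp Xq; exact: Hc.
have philip p q a b (M : R) : X p -> X q ->
    (forall n, `|dyadic E n p q a - dyadic E n p q b| <= M) ->
    `|phi p q a - phi p q b| <= M.
  move=> Xp Xq H; rewrite -[phi p q a - _]subr0.
  apply: (@cvg_norm_le (fun n => dyadic E n p q a - dyadic E n p q b)).
    by apply: cvgB; exact: phic.
  by move=> n; rewrite subr0.
exists phi, K, L1, (Num.min h1 h2); split=> //.
- by rewrite lt_min h10 h20 ge_min h11.
- move=> p q a Xp Xq; have Xpq := Xm Xp Xq; set m := midpoint p q in Xpq *.
  apply: (@norm_cvg_unique _ _ ((fun n => dyadic E n.+1 p q a) @ \oo)) => //.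
    by have := phic p q a Xp Xq; rewrite -(cvg_shiftS (fun n => dyadic E n p q a)).
  apply/cvgrPdist_le => e e0.
  have e20 : 0 < e / 2 / (L + 1) by rewrite !divr_gt0// ltr_wpDl.
  have /cvgrPdist_le /(_ _ e20) [N1 _ HN1] := phic p m a Xp Xpq.
  have /cvgrPdist_le /(_ (e / 2)) [|N2 _ HN2] := phic m q (phi p m a) Xpq Xq.
    by rewrite divr_gt0.
  exists (maxn N1 N2) => // n /=; rewrite geq_max => /andP[n1 n2].
  rewrite -/m (le_trans (ler_distD (dyadic E n m q (phi p m a)) _ _))//.
  rewrite [e]splitr lerD//; first exact: HN2.
  rewrite (le_trans (HLL _ _ _ _ _ Xpq Xq))//.
  rewrite (le_trans (ler_wpM2l L0 (HN1 n n1)))// mulrCA ger_pMr ?divr_gt0//.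
  by rewrite ler_pdivrMr ?ltr_wpDl// mul1r lerDl.
- split.
  + move=> p q a Xp Xq; rewrite le_min => /andP[_ hq].
    apply: (@cvg_norm_le (fun n => dyadic E n p q a)); first exact: phic.
    move=> n; have lam01 : 0 <= (0 : R) <= 1 by rewrite lexx ler01.
    by have := HK _ _ _ Xm lam01 AF n p q a Xp Xq hq; rewrite mul0r addr0 mulr1.
  + move=> p q a b Xp Xq; rewrite le_min => /andP[hq _].
    by apply: philip => // n; exact: HL.
  + move=> p q a b M Xp Xq; apply: cvg_norm_le; exact: phic.
Qed.

End RegularFlow.

(** * Uniqueness of trajectories and the flow property on triangles *)

Section FlowProperty.
Context {R : realType}.

Lemma powR_little (c r s e : R) : 0 <= c -> 0 < r -> r < s -> 0 < e ->
  exists2 d : R, 0 < d & forall h, 0 <= h <= d -> c * h `^ s <= e * h `^ r.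
Proof.
move=> c0 r0 rs e0; have c10 : 0 < c + 1 by rewrite ltr_wpDl.
have sr : 0 < s - r by rewrite subr_gt0.
have [d d0 Hd] := powR_small sr (divr_gt0 e0 c10).
exists d => // h hd; rewrite -[s](subrK r) powRDge0 ?subr_gt0// mulrA.
rewrite ler_wpM2r ?powR_ge0// (le_trans (ler_wpM2l c0 (Hd _ hd)))//.
by rewrite mulrCA ger_pMr// ler_pdivrMr// mul1r lerDl.
Qed.

Lemma powR_slack (L beta t : R) : 0 <= L -> 0 < beta -> 0 < t ->
  exists2 d : R, 0 < d & forall h, 0 <= h <= d -> L * h `^ beta <= t.
Proof.
move=> L0 b0 t0; have L10 : 0 < L + 1 by rewrite ltr_wpDl.
have [d d0 Hd] := powR_small b0 (divr_gt0 t0 L10).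
exists d => // h hd; rewrite (le_trans (ler_wpM2l L0 (Hd _ hd)))//.
by rewrite mulrCA ger_pMr// ler_pdivrMr// mul1r lerDl.
Qed.

Context {V : normedModType R} {d : nat}.
Local Notation W := 'cV[R]_d.
Implicit Types (p q : V) (a b : W).
Variables (X : set V) (phi psi : V -> V -> W -> W).
Variables (beta kappa zeta C L K h0 : R).
Hypotheses (beta0 : 0 < beta) (kappa1 : 1 < kappa) (kz : kappa <= zeta) (zeta2 : 2 < zeta).
Hypotheses (C0 : 0 <= C) (L0 : 0 <= L) (K0 : 0 <= K) (h00 : 0 < h0).
Hypothesis Xm : midpoint_closed X.
Hypothesis Xbd : exists D : R, forall p q, X p -> X q -> `|q - p| <= D.
Hypothesis phi_mid : forall p q a, X p -> X q ->
  phi p q a = phi (midpoint p q) q (phi p (midpoint p q) a).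
Hypothesis phi_lip : forall p q a b, X p -> X q -> `|q - p| <= h0 ->
  `|phi p q a - phi p q b| <= (1 + L * `|q - p| `^ beta) * `|a - b|.

Let half_le (h : R) : 0 <= h -> h / 2 <= h. Proof. by move=> ?; lra. Qed.

Let lip_scale h t p q a b : 0 <= h <= h0 -> L * h `^ beta <= t ->
  X p -> X q -> `|q - p| <= h -> `|phi p q a - phi p q b| <= (1 + t) * `|a - b|.
Proof.
move=> /andP[hp hh] ht Xp Xq pq.
rewrite (le_trans (phi_lip _ _ Xp Xq (le_trans pq hh)))// ler_wpM2r// lerD2l.
by rewrite (le_trans _ ht)// ler_wpM2l// powR_mono// ltW.
Qed.

(** The deviation of [theta] from the flow is [O (h ^ kappa)] on a piece of length [h],
    and the flow transports it with a Lipschitz constant close to [1]; over the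
    [2 ^ n] dyadic pieces of a segment the deviations add up to
    [O (2 ^ (n (1 - kappa)))]. *)
Lemma flow_trajectory (theta : V -> W) :
  (forall p q, X p -> X q -> `|q - p| <= h0 ->
     `|phi p q (theta p) - theta q| <= C * `|q - p| `^ kappa) ->
  forall p q, X p -> X q -> theta q = phi p q (theta p).
Proof.
move=> near p q Xp Xq; have [D HD] := Xbd.
pose s := (1 + kappa) / 2; have [s1 sk] : 1 < s /\ s < kappa by have := midf_lt kappa1; rewrite -/s => -[].
have t0 : 0 < 2 `^ s - 2 :> R.
  by rewrite subr_gt0; have := @powR2_lt R _ _ s1; rewrite powRr1.
have [h1 h10 Hh1] := powR_slack L0 beta0 t0.
pose h2 := Num.min h0 h1; have h20 : 0 < h2 by rewrite lt_min h00.
pose Bd (h M : R) := 0 <= M /\ forall p q, X p -> X q -> `|q - p| <= h ->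
  `|phi p q (theta p) - theta q| <= M.
have local h : 0 <= h <= h2 -> forall p q, X p -> X q -> `|q - p| <= h ->
    theta q = phi p q (theta p).
  move=> hh p' q' Xp' Xq' pq; apply/esym/eqP; rewrite -subr_eq0 -normr_le0.
  apply/ler_addgt0Pr => e e0.
  have [_ +] : Bd h (0 * h `^ kappa + e); last by rewrite mul0r; apply.
  have A0 : 0 <= 2 + (2 `^ s - 2) :> R by rewrite addr_ge0// ltW.
  have As : 2 + (2 `^ s - 2) <= 2 `^ s :> R by rewrite addrC subrK.
  have fix0 : (2 + (2 `^ s - 2)) * (0 / 2 `^ kappa) + 0 <= 0 :> R.
    by rewrite mul0r mulr0 addr0.
  apply: (@bisection_bound R Bd h2 _ _ _ _ _ A0 (lexx 0) fix0 _ s As) => //.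
  - by move=> h' M M' MM' [M0 HM]; split=> [|*]; rewrite (le_trans _ MM') ?HM.
  - move=> h' M /andP[h'0 h'h] M0 [_ HM]; rewrite mul0r addr0.
    split; first by rewrite mulr_ge0// addr_ge0// ltW.
    move=> x y Xx Xy xy; rewrite (phi_mid _ Xx Xy); have Xxy := Xm Xx Xy.
    set m := midpoint x y in Xxy *.
    have xy2 : `|y - x| / 2 <= h' / 2 by rewrite ler_pM2r.
    have h2h : h' / 2 <= h' by exact: half_le.
    have hlo : 0 <= h' / 2 <= h0.
      by rewrite divr_ge0//= (le_trans h2h)// (le_trans h'h)// ge_min lexx.
    have Lh : L * (h' / 2) `^ beta <= 2 `^ s - 2.
      by rewrite Hh1// divr_ge0//= (le_trans h2h)// (le_trans h'h)// ge_min lexx orbT.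
    have H1 := lip_scale (phi x m (theta x)) (theta m) hlo Lh Xxy Xy.
    rewrite norm_midr in H1; have {}H1 := H1 xy2.
    have H2 := HM _ _ Xx Xxy; rewrite norm_midl in H2; have {}H2 := H2 xy2.
    have H3 := HM _ _ Xxy Xy; rewrite norm_midr in H3; have {}H3 := H3 xy2.
    rewrite (le_trans (ler_distD (phi m y (theta m)) _ _))// (le_trans (lerD H1 H3))//.
    have : (1 + (2 `^ s - 2)) * `|phi x m (theta x) - theta m| <= (1 + (2 `^ s - 2)) * M.
      by rewrite ler_wpM2l// addr_ge0// ltW.
    by rewrite (_ : (2 + (2 `^ s - 2)) * M = (1 + (2 `^ s - 2)) * M + M); [rewrite lerD2r|ring].
  - move=> e1 e10; have [d1 d10 Hd] := powR_little C0 (lt_trans ltr01 s1) sk e10.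
    exists (Num.min d1 h0); first by rewrite lt_min d10.
    move=> h' /andP[h'0]; rewrite le_min => /andP[h'd h'h].
    split; first by rewrite mulr_ge0 ?powR_ge0// ltW.
    move=> x y Xx Xy xy; rewrite (le_trans (near _ _ Xx Xy (le_trans xy h'h)))//.
    apply: le_trans (Hd h' _); last by rewrite h'0.
    by rewrite ler_wpM2l// powR_mono// ltW// (lt_trans ltr01).
pose Q h := forall p q, X p -> X q -> `|q - p| <= h -> theta q = phi p q (theta p).
suff QD : Q D by apply: QD => //; exact: HD.
apply: (@doubling R Q h2) => //.
- by apply: local; rewrite lexx ltW.
- move=> h h_ge0 Qh x y Xx Xy xy; rewrite (phi_mid _ Xx Xy); have Xxy := Xm Xx Xy.
  by rewrite -!Qh// ?norm_midr ?norm_midl; lra.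
- by move=> h h' hh Qh' x y Xx Xy xy; apply: Qh' => //; exact: le_trans hh.
Qed.

Hypothesis psi_close : forall p q a, X p -> X q -> `|q - p| <= h0 ->
  `|phi p q a - psi p q a| <= K * `|q - p| `^ kappa.
Hypothesis psi_defect : forall h p q r a, 0 <= h <= h0 -> X p -> X q -> X r ->
  `|q - p| <= h -> `|r - q| <= h -> `|r - p| <= h ->
  `|psi q r (psi p q a) - psi p r a| <= C * h `^ zeta.

(** A crude bound of order [kappa > 1] improves to the order [zeta] of the defect of
    [psi], by comparing the two maps on both halves of a segment. *)
Lemma flow_second_order : exists K2 h1 : R, [/\ 0 <= K2, 0 < h1 &
  forall p q a, X p -> X q -> `|q - p| <= h1 ->
    `|phi p q a - psi p q a| <= K2 * `|q - p| `^ zeta].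
Proof.
pose s := (1 + kappa) / 2; have [s1 sk] : 1 < s /\ s < kappa by have := midf_lt kappa1; rewrite -/s => -[].
have sz : s < zeta by exact: lt_le_trans kz.
have t0 : 0 < 2 `^ s - 2 :> R.
  by rewrite subr_gt0; have := @powR2_lt R _ _ s1; rewrite powRr1.
have [h1 h10 Hh1] := powR_slack L0 beta0 t0.
pose h2 := Num.min h0 h1; have h20 : 0 < h2 by rewrite lt_min h00.
have A0 : 0 <= 2 + (2 `^ s - 2) :> R by rewrite addr_ge0// ltW.
have As : 2 + (2 `^ s - 2) <= 2 `^ s :> R by rewrite addrC subrK.
have [K2 K20 fixK] := bisection_bound_exists A0 C0 As sz.
exists K2, h2; split=> // p q a Xp Xq pq.
pose Bd (h M : R) := 0 <= M /\ forall p q a, X p -> X q -> `|q - p| <= h ->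
  `|phi p q a - psi p q a| <= M.
apply/ler_addgt0Pr => e e0.
have [_ +] : Bd `|q - p| (K2 * `|q - p| `^ zeta + e); last by apply.
apply: (@bisection_bound R Bd h2 _ _ _ _ _ A0 K20 fixK _ s As) => //.
- by move=> h' M M' MM' [M0 HM]; split=> [|*]; rewrite (le_trans _ MM') ?HM.
- move=> h' M /andP[h'0 h'h] M0 [_ HM].
  split; first by rewrite addr_ge0 ?mulr_ge0 ?powR_ge0.
  move=> x y b Xx Xy xy; rewrite (phi_mid _ Xx Xy); have Xxy := Xm Xx Xy.
  have xy2 : `|y - x| / 2 <= h' / 2 by rewrite ler_pM2r.
  have h2h : h' / 2 <= h' by exact: half_le.
  have h'h0 : h' <= h0 by rewrite (le_trans h'h)// ge_min lexx.
  have hlo : 0 <= h' / 2 <= h0 by rewrite divr_ge0//= (le_trans h2h).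
  have Lh : L * (h' / 2) `^ beta <= 2 `^ s - 2.
    by rewrite Hh1// divr_ge0//= (le_trans h2h)// (le_trans h'h)// ge_min lexx orbT.
  have D : `|psi (midpoint x y) y (psi x (midpoint x y) b) - psi x y b| <= C * h' `^ zeta.
    apply: psi_defect => //; rewrite ?h'0// ?norm_midl ?norm_midr (le_trans xy2)//.
  set m := midpoint x y in Xxy D *.
  have H1 := lip_scale (phi x m b) (psi x m b) hlo Lh Xxy Xy.
  rewrite norm_midr in H1; have {}H1 := H1 xy2.
  have H2 := HM _ _ b Xx Xxy; rewrite norm_midl in H2; have {}H2 := H2 xy2.
  have H3 := HM _ _ (psi x m b) Xxy Xy; rewrite norm_midr in H3; have {}H3 := H3 xy2.
  rewrite (le_trans (ler_distD (psi m y (psi x m b)) _ _))// lerD//.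
  rewrite (le_trans (ler_distD (phi m y (psi x m b)) _ _))//.
  rewrite (le_trans (lerD H1 H3))//.
  have : (1 + (2 `^ s - 2)) * `|phi x m b - psi x m b| <= (1 + (2 `^ s - 2)) * M.
    by rewrite ler_wpM2l// addr_ge0// ltW.
  by rewrite (_ : (2 + (2 `^ s - 2)) * M = (1 + (2 `^ s - 2)) * M + M); [rewrite lerD2r|ring].
- move=> e1 e10; have [d1 d10 Hd] := powR_little K0 (lt_trans ltr01 s1) sk e10.
  exists (Num.min d1 h0); first by rewrite lt_min d10.
  move=> h' /andP[h'0]; rewrite le_min => /andP[h'd h'h].
  split; first by rewrite mulr_ge0 ?powR_ge0// ltW.
  move=> x y b Xx Xy xy; rewrite (le_trans (psi_close _ Xx Xy (le_trans xy h'h)))//.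
  apply: le_trans (Hd h' _); last by rewrite h'0.
  by rewrite ler_wpM2l// powR_mono// ltW// (lt_trans ltr01).
- by rewrite normr_ge0.
Qed.

Let triangle p q r := forall a, phi q r (phi p q a) = phi p r a.

(** Cutting a triangle at the midpoints of its sides gives four triangles of half
    the size, and the defect of the large triangle is at most the transported
    sum of the four defects; a defect that is [O (h ^ zeta)] with [zeta > 2]
    must then vanish. *)
Lemma flow_property p q r a : X p -> X q -> X r -> phi q r (phi p q a) = phi p r a.
Proof.
have [D HD] := Xbd; have [K2 [h1 [K20 h10 HK2]]] := flow_second_order.
pose s := (2 + zeta) / 2; have [s2 sz] : 2 < s /\ s < zeta by have := midf_lt zeta2; rewrite -/s => -[].
have s0 : 0 < s by rewrite (lt_trans _ s2).
have t0 : 0 < 2 `^ s / 4 - 1 :> R.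
  rewrite subr_gt0 ltr_pdivlMr// mul1r (_ : 4 = 2 `^ 2); first exact: powR2_lt.
  by rewrite powR_mulrn// -natrX.
set t := 2 `^ s / 4 - 1 in t0.
have [h2 h20 Hh2] := powR_slack L0 beta0 t0.
pose h3 := Num.min h0 (Num.min h1 h2).
have h30 : 0 < h3 by rewrite !lt_min h00 h10.
have h3h0 : h3 <= h0 by rewrite ge_min lexx.
have h3h1 : h3 <= h1 by rewrite !ge_min lexx !orbT.
have h3h2 : h3 <= h2 by rewrite !ge_min lexx !orbT.
have lip h x y b c : 0 <= h <= h3 -> X x -> X y -> `|y - x| <= h ->
    `|phi x y b - phi x y c| <= (1 + t) * `|b - c|.
  move=> /andP[h_ge0 hh] Xx Xy xy; apply: (@lip_scale h) => //.
    by rewrite h_ge0 (le_trans hh).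
  by rewrite Hh2// h_ge0 (le_trans hh).
pose small (h : R) (x y z : V) := [/\ `|y - x| <= h, `|z - y| <= h & `|z - x| <= h].
pose Bd (h M : R) := 0 <= M /\ forall x y z b, X x -> X y -> X z -> small h x y z ->
  `|phi y z (phi x y b) - phi x z b| <= M.
have t10 : 0 <= 1 + t by rewrite addr_ge0// ltW.
have t11 : 1 <= 1 + t by rewrite lerDl ltW.
(* Swap the direct path along the side [xz] for the path through [y], one small
   triangle at a time; [b1], [b2] are the states at the midpoints reached. *)
have cut (h M : R) x y z b : 0 <= h <= h3 -> 0 <= M -> Bd (h / 2) M ->
    X x -> X y -> X z -> small h x y z ->
    `|phi y z (phi x y b) - phi x z b| <= 4 * (1 + t) * M.
  move=> /andP[h_ge0 hh] M0 [_ HM] Xx Xy Xz [xy yz xz].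
  have half3 u : u <= h -> u / 2 <= h / 2 by move=> ?; rewrite ler_pM2r.
  have hh2 : 0 <= h / 2 <= h3 by rewrite divr_ge0//= (le_trans (half_le h_ge0)).
  have Xxy := Xm Xx Xy; have Xyz := Xm Xy Xz; have Xxz := Xm Xx Xz.
  rewrite (phi_mid b Xx Xz) (phi_mid b Xx Xy) (phi_mid _ Xy Xz).
  have d1 : `|midpoint x z - midpoint x y| = `|z - y| / 2.
    by rewrite midpoint_dist norm_half.
  have d2 : `|midpoint y z - midpoint x y| = `|z - x| / 2.
    by rewrite (midpointC x y) midpoint_dist norm_half.
  have d3 : `|midpoint y z - midpoint x z| = `|y - x| / 2.
    by rewrite (midpointC x z) (midpointC y z) midpoint_dist norm_half.
  set u := midpoint x y in Xxy d1 d2 *; set v := midpoint y z in Xyz d2 d3 *.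
  set w := midpoint x z in Xxz d1 d3 *.
  have nux : `|u - x| <= h / 2 by rewrite norm_midl half3.
  have nyu : `|y - u| <= h / 2 by rewrite norm_midr half3.
  have nvy : `|v - y| <= h / 2 by rewrite norm_midl half3.
  have nzv : `|z - v| <= h / 2 by rewrite norm_midr half3.
  have nwx : `|w - x| <= h / 2 by rewrite norm_midl half3.
  have nzw : `|z - w| <= h / 2 by rewrite norm_midr half3.
  have nwu : `|w - u| <= h / 2 by rewrite d1 half3.
  have nvu : `|v - u| <= h / 2 by rewrite d2 half3.
  have nvw : `|v - w| <= h / 2 by rewrite d3 half3.
  set b1 := phi x u b.
  have E1 : `|phi w z (phi u w b1) - phi w z (phi x w b)| <= (1 + t) * M.
    rewrite (le_trans (lip _ _ _ _ _ hh2 Xxz Xz nzw))// ler_wpM2l//.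
    by apply: HM => //; split.
  set b2 := phi u w b1 in E1 *.
  have E2 : `|phi v z (phi w v b2) - phi w z b2| <= (1 + t) * M.
    apply: le_trans (ler_peMl M0 t11); apply: HM => //; by split.
  have E3 : `|phi v z (phi w v b2) - phi v z (phi u v b1)| <= (1 + t) * M.
    rewrite (le_trans (lip _ _ _ _ _ hh2 Xyz Xz nzv))// ler_wpM2l//.
    by apply: HM => //; split.
  have E4 : `|phi v z (phi y v (phi u y b1)) - phi v z (phi u v b1)| <= (1 + t) * M.
    rewrite (le_trans (lip _ _ _ _ _ hh2 Xyz Xz nzv))// ler_wpM2l//.
    by apply: HM => //; split.
  set g1 := phi v z (phi y v _) in E4 *; set g2 := phi v z (phi u v b1) in E3 E4.
  set g3 := phi v z (phi w v b2) in E2 E3; set g4 := phi w z b2 in E1 E2.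
  set g5 := phi w z (phi x w b) in E1 *.
  have F1 := ler_distD g2 g1 g5; have F2 := ler_distD g3 g2 g5; have F3 := ler_distD g4 g3 g5.
  rewrite [`|g2 - g3|]distrC in F2.
  have -> : 4 * (1 + t) * M = (1 + t) * M + ((1 + t) * M + ((1 + t) * M + (1 + t) * M)) by ring.
  rewrite (le_trans F1)// lerD// (le_trans F2)// lerD// (le_trans F3)// lerD//.
have local (h : R) x y z : 0 <= h <= h3 -> X x -> X y -> X z -> small h x y z -> triangle x y z.
  move=> hh Xx Xy Xz xyz b; apply/eqP; rewrite -subr_eq0 -normr_le0.
  apply/ler_addgt0Pr => e e0.
  have [_ +] : Bd h (0 * h `^ zeta + e); last by rewrite mul0r; apply.
  have A0 : 0 <= 4 * (1 + t) by rewrite mulr_ge0.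
  have As : 4 * (1 + t) <= 2 `^ s by rewrite /t addrC subrK mulrC divfK.
  have fix0 : 4 * (1 + t) * (0 / 2 `^ zeta) + 0 <= 0.
    by rewrite mul0r mulr0 addr0.
  apply: (@bisection_bound R Bd h3 _ _ _ _ _ A0 (lexx 0) fix0 _ s As) => //.
  - by move=> h' M M' MM' [M0 HM]; split=> [|*]; rewrite (le_trans _ MM') ?HM.
  - move=> h' M h'h M0 HM; rewrite mul0r addr0; split; first by rewrite !mulr_ge0.
    by move=> *; apply: (cut h').
  - move=> e1 e10; pose C' := (1 + t) * K2 + K2 + C + K2.
    have C'0 : 0 <= C' by rewrite !addr_ge0// mulr_ge0.
    have [d1 d10 Hd] := powR_little C'0 s0 sz e10.
    exists (Num.min d1 h3); first by rewrite lt_min d10.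
    move=> h' /andP[h'0]; rewrite le_min => /andP[h'd h'h].
    split; first by rewrite mulr_ge0 ?powR_ge0// ltW.
    move=> x' y' z' c Xx' Xy' Xz' [xy yz xz].
    have h'p : 0 <= h' <= h3 by rewrite h'0.
    have h'd1 : 0 <= h' <= d1 by rewrite h'0.
    apply: le_trans (Hd h' h'd1).
    have so x1 y1 c1 : X x1 -> X y1 -> `|y1 - x1| <= h' ->
        `|phi x1 y1 c1 - psi x1 y1 c1| <= K2 * h' `^ zeta.
      move=> X1 Y1 n1; rewrite (le_trans (HK2 _ _ _ X1 Y1 _))//.
        by rewrite (le_trans n1)// (le_trans h'h).
      by rewrite ler_wpM2l// powR_mono// ltW// (lt_trans _ zeta2).
    have G1 : `|phi y' z' (phi x' y' c) - phi y' z' (psi x' y' c)| <= (1 + t) * (K2 * h' `^ zeta).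
      by rewrite (le_trans (lip _ _ _ _ _ h'p Xy' Xz' yz))// ler_wpM2l// so.
    have G2 := so _ _ (psi x' y' c) Xy' Xz' yz.
    have h'h0 : 0 <= h' <= h0 by rewrite h'0 (le_trans h'h).
    have G3 := psi_defect c h'h0 Xx' Xy' Xz' xy yz xz.
    have G4 := so _ _ c Xx' Xz' xz; rewrite distrC in G4.
    rewrite (_ : C' * _ = (1 + t) * (K2 * h' `^ zeta) + K2 * h' `^ zeta +
      C * h' `^ zeta + K2 * h' `^ zeta); last by rewrite /C'; ring.
    rewrite (le_trans (ler_distD (psi x' z' c) _ _))// lerD//.
    rewrite (le_trans (ler_distD (psi y' z' (psi x' y' c)) _ _))// lerD//.
    by rewrite (le_trans (ler_distD (phi y' z' (psi x' y' c)) _ _))// lerD.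
pose Q (h : R) := forall x y z, X x -> X y -> X z -> small h x y z -> triangle x y z.
move=> Xp Xq Xr; suff QD : Q D by apply: QD => //; split; exact: HD.
apply: (@doubling R Q h3) => //.
- by move=> x y z; apply: local; rewrite lexx ltW.
- move=> h h_ge0 Qh x y z Xx Xy Xz [xy yz xz] b.
  have half3 u : u <= 2 * h -> u / 2 <= h by move=> ?; lra.
  have Xxy := Xm Xx Xy; have Xyz := Xm Xy Xz; have Xxz := Xm Xx Xz.
  rewrite (phi_mid b Xx Xz) (phi_mid b Xx Xy) (phi_mid _ Xy Xz).
  have d1 : `|midpoint x z - midpoint x y| = `|z - y| / 2.
    by rewrite midpoint_dist norm_half.
  have d2 : `|midpoint y z - midpoint x y| = `|z - x| / 2.
    by rewrite (midpointC x y) midpoint_dist norm_half.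
  have d3 : `|midpoint y z - midpoint x z| = `|y - x| / 2.
    by rewrite (midpointC x z) (midpointC y z) midpoint_dist norm_half.
  rewrite (Qh (midpoint x y) y (midpoint y z))//; last first.
    by split; rewrite ?norm_midl ?norm_midr ?d2 half3.
  rewrite -(Qh (midpoint x y) (midpoint x z) (midpoint y z))//; last first.
    by split; rewrite ?d1 ?d2 ?d3 half3.
  rewrite (Qh (midpoint x z) (midpoint y z) z)//; last first.
    by split; rewrite ?norm_midr ?d3 half3.
  rewrite (Qh x (midpoint x y) (midpoint x z))//.
  by split; rewrite ?norm_midl ?d1 half3.
- move=> h h' hh Qh' x y z Xx Xy Xz [xy yz xz]; apply: Qh' => //.
  by split; exact: le_trans hh.
Qed.

End FlowProperty.

(** * Vector fields that are differentiable with respect to a Hoelder map *)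

Section Field.
Context {R : realType}.

(** Bisection applied to the excess [|u t - u s| - M |t - s|], which is subadditive and
    bounded above by a term [o (t - s)]. *)
Lemma mean_value_bound (W : normedModType R) (u : R -> W) (M C r : R) : 1 < r -> 0 <= C ->
  (forall s t, 0 <= s <= 1 -> 0 <= t <= 1 ->
     `|u t - u s| <= M * `|t - s| + C * `|t - s| `^ r) ->
  `|u 1 - u 0| <= M.
Proof.
move=> r1 C0 H; pose X := [set t : R | 0 <= t <= 1].
pose N s t := `|u t - u s| - M * `|t - s|.
have Xm : midpoint_closed X.
  move=> p q /= /andP[p0 p1] /andP[q0 q1].
  have : midpoint p q = (p + q) / 2 by rewrite /midpoint mulrC.
  by move=> ->; apply/andP; split; lra.
have := @bisection_subadditive R R X N 0 r Xm r1 (lexx 0) _ _ 0 1.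
rewrite subr0 normr1 mul0r mul0r /N subr0 normr1 mulr1 subr_le0; apply; rewrite /X /= ?lexx ?ler01//.
- move=> p q _ _; rewrite mul0r addr0 norm_midl norm_midr.
  have := ler_distD (u (midpoint p q)) (u q) (u p).
  rewrite addrC => H1; rewrite addrACA -opprD -mulrDr -splitr lerD2r.
  by rewrite [leRHS]addrC; move: H1; rewrite addrC.
- move=> e e0; have [d d0 Hd] := powR_little C0 ltr01 r1 e0; exists d => // p q Xp Xq pq.
  rewrite lerBlDl (le_trans (H _ _ Xp Xq))// lerD2l.
  by have := Hd `|q - p|; rewrite powRr1//; apply; rewrite normr_ge0.
Qed.

Context {V : normedModType R} {k d : nat}.
Local Notation W := 'cV[R]_d.
Implicit Types (p q : V) (a b z : W) (y : 'cV[R]_k).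
Variables (X : set V) (beta gamma : R) (g : V -> 'cV[R]_k).
Hypotheses (beta01 : 0 < beta <= 1) (gamma01 : 0 < gamma <= 1).

(** [A p a] plays the role of the derivative of [F] at [(p, a)] with respect to
    [(g, id)], as a linear map of the two increments. *)
Record taylor_field (F : V -> W -> 'M[R]_(d, k))
    (A : V -> W -> 'cV[R]_k -> W -> 'M[R]_(d, k)) (B : R) : Prop := TaylorField {
  tf_linear : forall p a c y y' z z',
    A p a (c *: y + y') (c *: z + z') = c *: A p a y z + A p a y' z';
  tf_bound : forall p a y z, X p -> `|A p a y z| <= B * (`|y| + `|z|);
  tf_holder : forall p q a b y z, X p -> X q ->
    `|A q b y z - A p a y z| <=
    B * (`|q - p| `^ gamma + `|b - a| `^ gamma) * (`|y| + `|z|);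
  tf_taylor : forall p q a b, X p -> X q ->
    `|F q b - F p a - A p a (g q - g p) (b - a)| <=
    B * (`|q - p| `^ (beta + gamma) + `|b - a| `^ (1 + gamma) +
         `|b - a| `^ gamma * `|q - p| `^ beta) }.

Let beta0 : 0 < beta. Proof. by case/andP: beta01. Qed.
Let gamma0 : 0 < gamma. Proof. by case/andP: gamma01. Qed.

Section Bounds.
Variables (F : V -> W -> 'M[R]_(d, k)) (A : V -> W -> 'cV[R]_k -> W -> 'M[R]_(d, k)) (B : R).
Hypotheses (B0 : 0 <= B) (TF : taylor_field F A B).

Lemma tf_zero p a : A p a 0 0 = 0.
Proof. by have := tf_linear TF p a (- 1) 0 0 0 0; rewrite !scaler0 !addr0 scaleN1r addNr. Qed.

Lemma tf_scale p a c y z : A p a (c *: y) (c *: z) = c *: A p a y z.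
Proof. by have := tf_linear TF p a c y 0 z 0; rewrite tf_zero !addr0. Qed.

Lemma tf_add p a y y' z z' : A p a (y + y') (z + z') = A p a y z + A p a y' z'.
Proof. by have := tf_linear TF p a 1 y y' z z'; rewrite !scale1r. Qed.

Lemma tf_sub p a y y' z z' : A p a (y - y') (z - z') = A p a y z - A p a y' z'.
Proof. by rewrite -[- y']scaleN1r -[- z']scaleN1r tf_add tf_scale scaleN1r. Qed.

Lemma tf_state p a b : X p ->
  `|F p b - F p a - A p a 0 (b - a)| <= B * `|b - a| `^ (1 + gamma).
Proof.
move=> Xp; have := tf_taylor TF a b Xp Xp; rewrite !subrr normr0.
by rewrite !powR0 ?gt_eqF ?addr_gt0// add0r mulr0 addr0.
Qed.

Let seg a b (s : R) : W := a + s *: (b - a).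

Let seg_sub a b s t : seg a b t - seg a b s = (t - s) *: (b - a).
Proof. by rewrite /seg opprD addrACA subrr add0r -scalerBl. Qed.

Lemma tf_lipschitz p a b : X p -> `|F p b - F p a| <= B * `|b - a|.
Proof.
move=> Xp; have := @mean_value_bound _ (fun s => F p (seg a b s)) (B * `|b - a|)
  (B * `|b - a| `^ (1 + gamma)) (1 + gamma).
rewrite /seg scale1r scale0r addr0 subrKC; apply.
- by rewrite ltrDl.
- by rewrite mulr_ge0// powR_ge0.
move=> s t _ _; rewrite -/(seg a b t) -/(seg a b s).
have := tf_state (seg a b s) (seg a b t) Xp; rewrite seg_sub normrZ powRM// => H.
rewrite -[F p (seg a b t) - _](subrK (A p (seg a b s) 0 ((t - s) *: (b - a)))).
rewrite (le_trans (ler_normD _ _))// addrC lerD//.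
  by rewrite (le_trans (tf_bound TF _ _ _ Xp))// normr0 add0r normrZ le_of_eq//; ring.
by rewrite (le_trans H)// le_of_eq//; ring.
Qed.

(** The mean value inequality for the difference of [F q] and [F p] along two
    parallel motions in the state: the derivatives differ by the change of
    direction and by the oscillation of [A] between the two base points. *)
Lemma tf_four_point p q a b a' b' : X p -> X q ->
  `|F q a' - F q b' - (F p a - F p b)| <= B * `|a' - b' - (a - b)| +
    B * `|a - b| * (`|q - p| `^ gamma + (`|a' - a| `^ gamma + `|b' - b| `^ gamma)).
Proof.
move=> Xp Xq; set G := _ + (_ + _).
have G0 : 0 <= G by rewrite !addr_ge0 ?powR_ge0.
set M := _ + _ * G.
pose u s := F q (seg b' a' s) - F p (seg b a s).
have -> : F q a' - F q b' - (F p a - F p b) = u 1 - u 0.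
  rewrite /u /seg !scale1r !scale0r !addr0 !subrKC.
  by apply/matrixP => i j; rewrite !mxE; ring.
apply: (@mean_value_bound _ u M (B * (`|a' - b'| `^ (1 + gamma) + `|a - b| `^ (1 + gamma)))
  (1 + gamma)); first by rewrite ltrDl.
  by rewrite mulr_ge0// addr_ge0// powR_ge0.
move=> s t /andP[s0 s1] _; rewrite /u.
have H1 := tf_state (seg b a s) (seg b a t) Xp.
have H2 := tf_state (seg b' a' s) (seg b' a' t) Xq.
rewrite seg_sub normrZ powRM// in H1; rewrite seg_sub normrZ powRM// in H2.
have yy : `|seg b' a' s - seg b a s| `^ gamma <= `|a' - a| `^ gamma + `|b' - b| `^ gamma.
  have maxpow (r1 r2 : R) : Num.max r1 r2 `^ gamma <= r1 `^ gamma + r2 `^ gamma.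
    by rewrite maxEle; case: ifP => _; rewrite ?lerDl ?lerDr powR_ge0.
  apply: le_trans (maxpow _ _); apply: (powR_mono (ltW gamma0)) => //.
  have -> : seg b' a' s - seg b a s = (1 - s) *: (b' - b) + s *: (a' - a).
    by apply: colP2 => i; rewrite /seg !mxE; ring.
  rewrite (le_trans (ler_normD _ _))// !normrZ (ger0_norm s0) ger0_norm ?subr_ge0//.
  set n1 := `|b' - b|; set n2 := `|a' - a|; set n := Num.max _ _.
  have h1 : (1 - s) * n1 <= (1 - s) * n by rewrite ler_wpM2l ?subr_ge0// /n le_max lexx orbT.
  have h2 : s * n2 <= s * n by rewrite ler_wpM2l// /n le_max lexx.
  by rewrite (le_trans (lerD h1 h2))// -mulrDl subrK mul1r.
have AG : `|A q (seg b' a' s) 0 (a - b) - A p (seg b a s) 0 (a - b)| <= B * `|a - b| * G.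
  apply: (le_trans (tf_holder TF _ _ _ _ Xp Xq)); rewrite normr0 add0r mulrAC.
  by apply: ler_wpM2l; [exact: mulr_ge0|rewrite lerD2l].
have AM : `|A q (seg b' a' s) 0 (a' - b' - (a - b))| <= B * `|a' - b' - (a - b)|.
  by apply: (le_trans (tf_bound TF _ _ _ Xq)); rewrite normr0 add0r.
move: (seg b' a' t) (seg b a t) (seg b' a' s) (seg b a s) H1 H2 AG AM {yy}.
move=> x' x y' y H1 H2 AG AM; clearbody G; clear u.
have HP : `|A q y' 0 ((t - s) *: (a' - b')) - A p y 0 ((t - s) *: (a - b))| <= M * `|t - s|.
  have sc v c (t' : R) z : A v c 0 (t' *: z) = t' *: A v c 0 z.
    by rewrite -tf_scale scaler0.
  have sp : A q y' 0 (a' - b') = A q y' 0 (a' - b' - (a - b)) + A q y' 0 (a - b).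
    by rewrite -tf_add addr0 subrK.
  rewrite !sc -scalerBr sp -addrA normrZ mulrC ler_wpM2r//.
  by rewrite (le_trans (ler_normD _ _))// lerD.
move: (A p y 0 _) (A q y' 0 _) H1 H2 HP => P P' H1 H2 HP; clear AG AM.
have -> : F q x' - F p x - (F q y' - F p y) =
   (P' - P) + ((F q x' - F q y' - P') - (F p x - F p y - P)).
  by apply/matrixP => i j; rewrite !mxE; ring.
rewrite (le_trans (ler_normD _ _))// lerD// (le_trans (ler_normB _ _))//.
by apply: (le_trans (lerD H2 H1)); rewrite -mulrDr -mulrDr [_ `^ _ * (_ + _)]mulrC mulrA.
Qed.

End Bounds.
End Field.

(** * Truncation of the state variable *)

Section Truncation.
Context {R : realType}.
Implicit Types x y s t : R.

Let ramp x := Num.max x 0.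
Let square_ramp x := ramp x ^+ 2 / 2.

Let square_rampP x y :
  `|square_ramp y - square_ramp x - ramp x * (y - x)| <= (y - x) ^+ 2 / 2.
Proof.
have := sqr_ge0 (y - x); have := sqr_ge0 x; have := sqr_ge0 y.
rewrite /square_ramp /ramp !maxEle ler_norml !expr2 => ? ? ?.
by do 2 (case: ifPn; rewrite -?ltNge => ?); apply/andP; split; nra.
Qed.

(** A primitive of [clamp], the projection onto the unit interval. *)
Let soft_ramp x := square_ramp x - square_ramp (x - 1).
Let clamp x := ramp x - ramp (x - 1).

Let soft_ramp_taylor x y :
  `|soft_ramp y - soft_ramp x - clamp x * (y - x)| <= (y - x) ^+ 2.
Proof.
have := square_rampP x y; have := square_rampP (x - 1) (y - 1).
rewrite (_ : y - 1 - (x - 1) = y - x); last by ring.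
rewrite /soft_ramp /clamp => H1 H2.
rewrite (_ : _ - _ - _ = (square_ramp y - square_ramp x - ramp x * (y - x)) -
  (square_ramp (y - 1) - square_ramp (x - 1) - ramp (x - 1) * (y - x))); last by ring.
by rewrite (le_trans (ler_normB _ _))//; move: H1 H2; lra.
Qed.

Let clamp01 x : 0 <= clamp x <= 1.
Proof.
rewrite /clamp /ramp !maxEle.
by do 2 (case: ifPn; rewrite -?ltNge => ?); apply/andP; split; lra.
Qed.

Let clamp_lip x y : `|clamp y - clamp x| <= `|y - x|.
Proof.
wlog xy : x y / x <= y.
  move=> H; have [/H//|/ltW/H] := leP x y.
  by rewrite distrC [leRHS]distrC.
rewrite [leRHS]ger0_norm ?subr_ge0// ler_norml /clamp /ramp !maxEle.
by do 4 (case: ifPn; rewrite -?ltNge => ?); apply/andP; split; lra.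
Qed.

Let soft_ramp_incr x y : x <= y -> 0 <= soft_ramp y - soft_ramp x <= y - x.
Proof.
move=> xy; rewrite /soft_ramp /square_ramp /ramp !maxEle.
by do 4 (case: ifPn; rewrite -?ltNge => ?); apply/andP; split; nra.
Qed.

Let soft_ramp_neg x : x <= 0 -> soft_ramp x = 0.
Proof.
move=> x0; rewrite /soft_ramp /square_ramp /ramp !maxEle x0 ifT; last by lra.
by rewrite subrr.
Qed.

Let soft_ramp_large x : 1 <= x -> soft_ramp x = x - 2^-1.
Proof.
move=> x1; rewrite /soft_ramp /square_ramp /ramp !maxEle.
case: ifPn => [x0|_]; first by move: x1 x0; lra.
case: ifPn => [x0|_]; last by field.
have -> : x = 1 by move: x1 x0; lra.
by field.
Qed.

Variable rho : R.
Hypothesis rho0 : 0 <= rho.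

(** The identity on [[- rho, rho]], flattened smoothly on either side: the slope
    decreases linearly from [1] to [0] over an interval of length [1]. *)
Definition truncate t : R := t - soft_ramp (t - rho) + soft_ramp (- t - rho).
Definition truncate_deriv t : R := 1 - clamp (t - rho) - clamp (- t - rho).

Lemma truncate_id t : `|t| <= rho -> truncate t = t.
Proof.
rewrite ler_norml => /andP[t1 t2].
by rewrite /truncate !soft_ramp_neg ?subr0 ?addr0//; lra.
Qed.

Lemma truncate_lip s t : `|truncate t - truncate s| <= `|t - s|.
Proof.
wlog st : s t / s <= t.
  move=> H; have [/H//|/ltW/H] := leP s t.
  by rewrite distrC [leRHS]distrC.
rewrite [leRHS]ger0_norm ?subr_ge0// ler_norml /truncate.
have h1 : s - rho <= t - rho by lra.
have h2 : - t - rho <= - s - rho by lra.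
have /andP[? ?] := soft_ramp_incr h1; have /andP[? ?] := soft_ramp_incr h2.
by apply/andP; split; lra.
Qed.

Lemma truncate0 : truncate 0 = 0.
Proof. by rewrite truncate_id ?normr0. Qed.

Lemma truncate_norm t : `|truncate t| <= `|t|.
Proof. by have := truncate_lip 0 t; rewrite truncate0 !subr0. Qed.

Lemma truncateN t : truncate (- t) = - truncate t.
Proof. by rewrite /truncate opprK; ring. Qed.

Lemma truncate_bound t : `|truncate t| <= rho + 1.
Proof.
wlog t0 : t / 0 <= t.
  move=> H; have [/H//|/ltW t0] := leP 0 t.
  by have := H (- t); rewrite truncateN normrN oppr_ge0; apply.
have [t1|/ltW t1] := leP t (rho + 1).
  by rewrite (le_trans (truncate_norm t))// ger0_norm.
have r0 := rho0.
rewrite /truncate [soft_ramp (- t - rho)]soft_ramp_neg ?soft_ramp_large; try lra.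
by rewrite ler_norml; apply/andP; split; lra.
Qed.

Lemma truncate_deriv_bound t : `|truncate_deriv t| <= 1.
Proof.
rewrite ler_norml /truncate_deriv.
have /andP[? ?] := clamp01 (t - rho); have /andP[? ?] := clamp01 (- t - rho).
by apply/andP; split; lra.
Qed.

Variable gamma : R.
Hypothesis gamma01 : 0 < gamma <= 1.

Let pow_large x : 1 <= x -> 1 <= x `^ gamma.
Proof.
move=> x1; have /andP[g0 _] := gamma01.
by have := @powR_mono R 1 x _ (ltW g0) ler01 x1; rewrite powR1.
Qed.

Lemma truncate_taylor s t :
  `|truncate t - truncate s - truncate_deriv s * (t - s)| <= 2 * `|t - s| `^ (1 + gamma).
Proof.
have /andP[g0 g1] := gamma01.
rewrite powRDge0// powRr1//.
have [ts|/ltW ts] := leP `|t - s| 1.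
  have h1 := soft_ramp_taylor (s - rho) (t - rho).
  have h2 := soft_ramp_taylor (- s - rho) (- t - rho).
  rewrite (_ : t - rho - (s - rho) = t - s) in h1; last by ring.
  rewrite (_ : - t - rho - (- s - rho) = - (t - s)) in h2; last by ring.
  rewrite sqrrN in h2.
  have h3 : (t - s) ^+ 2 <= `|t - s| * `|t - s| `^ gamma.
    rewrite -real_normK ?num_real// expr2 ler_wpM2l//.
    by rewrite -{1}[`|t - s|]powRr1// powR_anti// normr_ge0.
  rewrite (_ : _ - _ - _ = - (soft_ramp (t - rho) - soft_ramp (s - rho) -
      clamp (s - rho) * (t - s)) + (soft_ramp (- t - rho) - soft_ramp (- s - rho) -
      clamp (- s - rho) * (- (t - s)))); last by rewrite /truncate /truncate_deriv; ring.
  by rewrite (le_trans (ler_normD _ _))// normrN; move: h1 h2 h3; lra.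
have h1 := truncate_lip s t.
have h2 : `|truncate_deriv s * (t - s)| <= `|t - s|.
  by rewrite normrM ler_piMl// truncate_deriv_bound.
have h3 : `|t - s| <= `|t - s| * `|t - s| `^ gamma by rewrite ler_peMr// pow_large.
by rewrite (le_trans (ler_normB _ _))//; move: h1 h2 h3; lra.
Qed.

Lemma truncate_deriv_holder s t :
  `|truncate_deriv t - truncate_deriv s| <= 2 * `|t - s| `^ gamma.
Proof.
have /andP[g0 g1] := gamma01.
have [ts|/ltW ts] := leP `|t - s| 1.
  have h1 := clamp_lip (s - rho) (t - rho); have h2 := clamp_lip (- s - rho) (- t - rho).
  rewrite (_ : t - rho - (s - rho) = t - s) in h1; last by ring.
  rewrite (_ : - t - rho - (- s - rho) = - (t - s)) in h2; last by ring.
  rewrite normrN in h2.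
  have h3 : `|t - s| <= `|t - s| `^ gamma.
    by rewrite -{1}[`|t - s|]powRr1// powR_anti// normr_ge0.
  rewrite (_ : _ - _ = - (clamp (t - rho) - clamp (s - rho)) -
    (clamp (- t - rho) - clamp (- s - rho))); last by rewrite /truncate_deriv; ring.
  by rewrite (le_trans (ler_normB _ _))// normrN; move: h1 h2 h3; lra.
have := pow_large ts; have := truncate_deriv_bound s; have := truncate_deriv_bound t => h1 h2 h3.
by rewrite (le_trans (ler_normB _ _))//; move: h1 h2 h3; lra.
Qed.

End Truncation.

Section TruncatedField.
Context {R : realType} {V : normedModType R} {k d : nat}.
Local Notation W := 'cV[R]_d.
Implicit Types (p q : V) (a b z : W) (y : 'cV[R]_k).

Definition truncate_state (rho : R) a : W := \col_i truncate rho (a i 0).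
Definition truncate_state_deriv (rho : R) a z : W :=
  \col_i (truncate_deriv rho (a i 0) * z i 0).

Variables (X : set V) (beta gamma rho : R) (g : V -> 'cV[R]_k).
Hypotheses (gamma01 : 0 < gamma <= 1) (rho0 : 0 <= rho).

Let chi := truncate_state rho.
Let dchi := truncate_state_deriv rho.

Lemma truncate_state_id a : `|a| <= rho -> chi a = a.
Proof.
move=> ar; apply: colP2 => i; rewrite mxE truncate_id//.
by rewrite (le_trans (mx_entry_le _ _ _)).
Qed.

Lemma truncate_state_lip a b : `|chi b - chi a| <= `|b - a|.
Proof.
apply: mx_norm_le => // i j; rewrite (ord1 j) !mxE (le_trans (truncate_lip _ _ _))//.
by have := mx_entry_le (b - a) i 0; rewrite !mxE.
Qed.

Lemma truncate_state_norm a : `|chi a| <= `|a|.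
Proof.
apply: mx_norm_le => // i j; rewrite (ord1 j) !mxE (le_trans (truncate_norm _ _))//.
exact: mx_entry_le.
Qed.

Lemma truncate_state_bound a : `|chi a| <= rho + 1.
Proof.
apply: mx_norm_le => [|i j]; first by rewrite addr_ge0.
by rewrite (ord1 j) !mxE truncate_bound.
Qed.

Lemma truncate_state_deriv_bound a z : `|dchi a z| <= `|z|.
Proof.
apply: mx_norm_le => // i j; rewrite (ord1 j) !mxE normrM.
apply: (le_trans (ler_wpM2r (normr_ge0 _) (truncate_deriv_bound _ _))).
by rewrite mul1r mx_entry_le.
Qed.

Lemma truncate_state_deriv_holder a b z :
  `|dchi b z - dchi a z| <= 2 * `|b - a| `^ gamma * `|z|.
Proof.
have g0 : 0 <= gamma by case/andP: gamma01 => /ltW.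
apply: mx_norm_le => [|i j]; first by rewrite !mulr_ge0 ?powR_ge0.
rewrite (ord1 j) !mxE -mulrBl normrM ler_pM ?mx_entry_le//.
rewrite (le_trans (truncate_deriv_holder _ gamma01 _ _))// ler_wpM2l// powR_mono//.
by have := mx_entry_le (b - a) i 0; rewrite !mxE.
Qed.

Lemma truncate_state_taylor a b :
  `|chi b - chi a - dchi a (b - a)| <= 2 * `|b - a| `^ (1 + gamma).
Proof.
have g0 : 0 <= gamma by case/andP: gamma01 => /ltW.
apply: mx_norm_le => [|i j]; first by rewrite !mulr_ge0 ?powR_ge0.
rewrite (ord1 j) !mxE (le_trans (truncate_taylor _ gamma01 _ _))//.
rewrite ler_wpM2l// powR_mono// ?addr_ge0//.
by have := mx_entry_le (b - a) i 0; rewrite !mxE.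
Qed.

(** The chain rule, with the derivative of the truncation inserted in [A]. *)
Lemma taylor_field_truncate F A B : 0 <= B -> taylor_field X beta gamma g F A B ->
  taylor_field X beta gamma g (fun p a => F p (chi a))
    (fun p a y z => A p (chi a) y (dchi a z)) (3 * B).
Proof.
move=> B0 TF; have g0 : 0 < gamma by case/andP: gamma01.
have B3 : B <= 3 * B by rewrite ler_peMl// ler1n.
have zA p a z : X p -> `|A p a 0 z| <= B * `|z|.
  by move=> Xp; rewrite (le_trans (tf_bound TF _ _ _ Xp))// normr0 add0r.
split.
- move=> p a c y y' z z'; rewrite -(tf_linear TF); congr (A _ _ _ _).
  by apply: colP2 => i; rewrite !mxE; ring.
- move=> p a y z Xp; rewrite (le_trans (tf_bound TF _ _ _ Xp))// ler_pM ?addr_ge0//.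
  by rewrite lerD2l truncate_state_deriv_bound.
- move=> p q a b y z Xp Xq.
  have -> : A q (chi b) y (dchi b z) - A p (chi a) y (dchi a z) =
      (A q (chi b) y (dchi b z) - A p (chi a) y (dchi b z)) +
      A p (chi a) 0 (dchi b z - dchi a z).
    by rewrite -(subrr y) (tf_sub TF) addrA subrK.
  have pw : `|chi b - chi a| `^ gamma <= `|b - a| `^ gamma.
    by rewrite powR_mono ?(ltW g0)// truncate_state_lip.
  set u := `|q - p| `^ gamma; set v := `|b - a| `^ gamma.
  have u0 : 0 <= u by exact: powR_ge0. have v0 : 0 <= v by exact: powR_ge0.
  rewrite (_ : 3 * B * (u + v) * _ = B * (u + v) * (`|y| + `|z|) +
    B * (2 * (u + v) * (`|y| + `|z|))); last by ring.
  rewrite (le_trans (ler_normD _ _))// lerD//.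
    apply: (le_trans (tf_holder TF _ _ _ _ Xp Xq)); apply: ler_pM.
    - by apply: mulr_ge0 => //; apply: addr_ge0 => //; exact: powR_ge0.
    - exact: addr_ge0.
    - by apply: (ler_wpM2l B0); rewrite lerD2l.
    - by rewrite lerD2l truncate_state_deriv_bound.
  rewrite (le_trans (zA _ _ _ Xp))// ler_wpM2l//.
  rewrite (le_trans (truncate_state_deriv_holder _ _ _))// ler_pM ?mulr_ge0//.
    by rewrite ler_wpM2l// lerDr.
  by rewrite lerDr.
- move=> p q a b Xp Xq.
  have -> : F q (chi b) - F p (chi a) - A p (chi a) (g q - g p) (dchi a (b - a)) =
     (F q (chi b) - F p (chi a) - A p (chi a) (g q - g p) (chi b - chi a)) +
     A p (chi a) 0 (chi b - chi a - dchi a (b - a)).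
    move: (g q - g p) => y.
    by rewrite -[in RHS](subrr y) (tf_sub TF) addrA subrK.
  have p1 : `|chi b - chi a| `^ (1 + gamma) <= `|b - a| `^ (1 + gamma).
    by rewrite powR_mono ?addr_ge0 ?(ltW g0)// truncate_state_lip.
  have p2 : `|chi b - chi a| `^ gamma * `|q - p| `^ beta <=
      `|b - a| `^ gamma * `|q - p| `^ beta.
    apply: ler_wpM2r; first exact: powR_ge0.
    by apply: powR_mono => //; [exact: ltW|exact: truncate_state_lip].
  have T1 := tf_taylor TF (chi a) (chi b) Xp Xq.
  have T2 : `|A p (chi a) 0 (chi b - chi a - dchi a (b - a))| <=
      B * (2 * `|b - a| `^ (1 + gamma)).
    by apply: (le_trans (zA _ _ _ Xp)); apply: (ler_wpM2l B0); exact: truncate_state_taylor.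
  apply: (le_trans (ler_normD _ _)); apply: (le_trans (lerD T1 T2)); clear T1 T2.
  have w0 : 0 <= `|b - a| `^ gamma * `|q - p| `^ beta by rewrite mulr_ge0 ?powR_ge0.
  have sum3 (u v w v' w' : R) : 0 <= u -> 0 <= v -> 0 <= w -> v' <= v -> w' <= w ->
      B * (u + v' + w') + B * (2 * v) <= 3 * B * (u + v + w).
    move=> u0 v0 w0' vv ww.
    rewrite (_ : 3 * B * (u + v + w) = B * (u + v + w) + B * (2 * (u + v + w))); last by ring.
    apply: lerD; apply: (ler_wpM2l B0); first by rewrite !lerD.
    by rewrite ler_wpM2l// addrAC lerDr addr_ge0.
  exact: (sum3 _ _ _ _ _ (powR_ge0 _ _) (powR_ge0 _ _) w0 p1 p2).
Qed.

End TruncatedField.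

(** * From a vector field to its flow *)

Section LipschitzField.
Context {R : realType} {V : normedModType R} {k d : nat}.
Local Notation W := 'cV[R]_d.
Implicit Types (p q : V) (a b z : W) (y : 'cV[R]_k) (F : V -> W -> 'M[R]_(d, k)).
Variables (X : set V) (beta gamma kappa Cg : R) (g : V -> 'cV[R]_k).
Hypotheses (beta01 : 0 < beta <= 1) (gamma01 : 0 < gamma <= 1).
Hypotheses (kappaE : kappa = beta + beta * gamma).
Hypotheses (Xm : midpoint_closed X) (Cg0 : 0 <= Cg).
Hypothesis hg : forall p q, X p -> X q -> `|g q - g p| <= Cg * `|q - p| `^ beta.

Record lipschitz_field (lam G : R) F : Prop := LipschitzField {
  lf_time : forall p q a, X p -> X q -> `|F q a - F p a| <= G * `|q - p| `^ beta;
  lf_state : forall p a b, X p -> `|F p b - F p a| <= G * `|b - a|;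
  lf_growth : forall p a, X p -> `|F p a| <= G * (1 + lam * `|a|) }.

Definition euler F p q a : W := a + F p a *m (g q - g p).

Let beta0 : 0 < beta. Proof. by case/andP: beta01. Qed.
Let gamma0 : 0 < gamma. Proof. by case/andP: gamma01. Qed.
Let bg0 : 0 < beta * gamma. Proof. by rewrite mulr_gt0. Qed.

Let mul_norm (M : 'M[R]_(d, k)) y : `|M *m y| <= k%:R * `|M| * `|y|.
Proof. by rewrite -mulrA mulmx_norm. Qed.

Let kappa_le2 : kappa <= beta + beta.
Proof. by rewrite kappaE lerD2l ger_pMr//; case/andP: gamma01. Qed.

Lemma euler_sub F p q a : euler F p q a - a = F p a *m (g q - g p).
Proof. by rewrite /euler addrC addKr. Qed.

Lemma euler_norm F G lam p q a : 0 <= G -> 0 <= lam -> lipschitz_field lam G F ->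
  X p -> X q ->
  `|euler F p q a - a| <= k%:R * G * Cg * (1 + lam * `|a|) * `|q - p| `^ beta.
Proof.
move=> G0 l0 LF Xp Xq; rewrite euler_sub (le_trans (mul_norm _ _))//.
rewrite (_ : k%:R * G * Cg * _ * _ =
  (k%:R * (G * (1 + lam * `|a|))) * (Cg * `|q - p| `^ beta)); last by ring.
by rewrite ler_pM ?mulr_ge0 ?hg// ler_wpM2l// (lf_growth LF).
Qed.

Lemma euler_defect F p m q a : euler F m q (euler F p m a) - euler F p q a =
  (F m (euler F p m a) - F p a) *m (g q - g m).
Proof.
have -> : euler F p q a = euler F p m a + F p a *m (g q - g m).
  rewrite /euler -addrA -mulmxDr; congr (_ + _ *m _).
  by apply: colP2 => i; rewrite !mxE; ring.
have E b : euler F m q b = b + F m b *m (g q - g m) by [].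
by rewrite E mulmxBl opprD addrACA subrr add0r.
Qed.

(** The defect is [(F m b - F p a) (g q - g m)], a product of two Hoelder increments.
    The constant depends on the field only through its linear growth and its
    Lipschitz bounds, which truncation does not increase. *)
Lemma euler_almost_flow (G : R) : 0 <= G -> exists C : R, 1 <= C /\
  forall lam F, 0 <= lam <= 1 -> lipschitz_field lam G F ->
    almost_flow X lam C beta kappa (euler F).
Proof.
move=> G0; pose c1 := k%:R * G * Cg.
have c10 : 0 <= c1 by rewrite !mulr_ge0.
pose c2 := k%:R * (G + G * c1) * Cg.
have c20 : 0 <= c2 by rewrite !mulr_ge0 ?addr_ge0 ?mulr_ge0.
exists (1 + c1 + c2); split; first by rewrite -addrA lerDl addr_ge0.
have C1 : c1 <= 1 + c1 + c2 by rewrite -addrA addrCA lerDl addr_ge0.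
have C2 : c2 <= 1 + c1 + c2 by rewrite lerDr addr_ge0.
move=> lam F /andP[l0 l1] LF; split.
- move=> p q a Xp Xq; rewrite (le_trans (euler_norm _ G0 l0 LF Xp Xq))//.
  by rewrite ler_wpM2r ?powR_ge0// ler_wpM2r ?addr_ge0 ?mulr_ge0.
- move=> p q a b Xp Xq.
  have -> : euler F p q a - euler F p q b - (a - b) = (F p a - F p b) *m (g q - g p).
    by rewrite mulmxBl -!euler_sub; apply: colP2 => i; rewrite !mxE; ring.
  rewrite (le_trans (mul_norm _ _))//.
  apply: (@le_trans _ _ (c1 * `|q - p| `^ beta * `|a - b|)); last first.
    by rewrite ler_wpM2r// ler_wpM2r// powR_ge0.
  rewrite (_ : c1 * _ * _ = (k%:R * (G * `|a - b|)) * (Cg * `|q - p| `^ beta)); last first.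
    by rewrite /c1; ring.
  by rewrite ler_pM ?mulr_ge0 ?hg// ler_wpM2l// (lf_state LF).
- move=> p q a Xp Xq pq1; have Xpq := Xm Xp Xq; set m := midpoint p q in Xpq *.
  rewrite euler_defect (le_trans (mul_norm _ _))//.
  set h := `|q - p| in pq1 *; have h0 : 0 <= h by exact: normr_ge0.
  set w := 1 + lam * `|a|; have w1 : 1 <= w by rewrite lerDl mulr_ge0.
  have w0 : 0 <= w by exact: le_trans w1.
  have half : (h / 2) `^ beta <= h `^ beta by rewrite powR_mono ?(ltW beta0)//; lra.
  have F1 : `|F m (euler F p m a) - F p a| <= (G + G * c1) * w * h `^ beta.
    rewrite (le_trans (ler_distD (F p (euler F p m a)) _ _))//.
    rewrite [leRHS](_ : _ = G * w * h `^ beta + G * (c1 * w * h `^ beta)); last by ring.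
    apply: lerD.
      rewrite (le_trans (lf_time LF _ Xp Xpq))// norm_midl -/h.
      by apply: ler_pM => //; [exact: powR_ge0|rewrite ler_peMr].
    rewrite (le_trans (lf_state LF _ _ Xp))// ler_wpM2l//.
    rewrite (le_trans (euler_norm _ G0 l0 LF Xp Xpq))// norm_midl -/h.
    by rewrite ler_wpM2l// mulr_ge0.
  have g1 : `|g q - g m| <= Cg * h `^ beta.
    by rewrite (le_trans (hg Xpq Xq))// norm_midr ler_wpM2l.
  have hk : h `^ (beta + beta) <= h `^ kappa.
    by rewrite powR_anti ?h0// kappaE addr_gt0.
  apply: (@le_trans _ _ (c2 * w * h `^ (beta + beta))); last first.
    by apply: (ler_pM _ (powR_ge0 _ _) _ hk); [exact: mulr_ge0|exact: ler_wpM2r].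
  rewrite powRDge0// (_ : c2 * w * _ =
    (k%:R * ((G + G * c1) * w * h `^ beta)) * (Cg * h `^ beta)); last by rewrite /c2; ring.
  by rewrite ler_pM ?mulr_ge0// ler_wpM2l.
Qed.

Lemma euler_regular (G B : R) F A : 0 <= G -> 0 <= B ->
  lipschitz_field 0 G F -> taylor_field X beta gamma g F A B ->
  exists C : R, 1 <= C /\ regular_flow X C beta gamma kappa (euler F).
Proof.
move=> G0 B0 LF TF; have [C [C1 HC]] := euler_almost_flow G0.
have C0 : 0 <= C by exact: le_trans C1.
have l01 : 0 <= (0 : R) <= 1 by rewrite lexx ler01.
have AF := HC _ _ l01 LF.
pose c1 := k%:R * B * Cg; have c10 : 0 <= c1 by rewrite !mulr_ge0.
pose c2 := c1 * (C + (1 + (C + C))).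
have c20 : 0 <= c2 by rewrite mulr_ge0 ?addr_ge0.
pose C' := C + c1 + c2.
have CC' : C <= C' by rewrite /C' -addrA lerDl addr_ge0.
have c1C' : c1 <= C' by rewrite /C' -addrA addrCA lerDl addr_ge0.
have c2C' : c2 <= C' by rewrite /C' lerDr addr_ge0.
have pw (x s : R) : 0 <= x -> 0 < s -> 0 <= x `^ s by move=> *; exact: powR_ge0.
exists C'; split; first exact: le_trans CC'.
split.
- split.
  + move=> p q a Xp Xq; rewrite (le_trans (af_incr AF _ Xp Xq))//.
    by rewrite ler_wpM2r ?powR_ge0// ler_wpM2r// addr_ge0 ?mulr_ge0.
  + move=> p q a b Xp Xq; rewrite (le_trans (af_lip AF _ _ Xp Xq))//.
    by rewrite ler_wpM2r// ler_wpM2r ?powR_ge0.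
  + move=> p q a Xp Xq pq; rewrite (le_trans (af_defect AF _ Xp Xq pq))//.
    by rewrite ler_wpM2r ?powR_ge0// ler_wpM2r// addr_ge0 ?mulr_ge0.
- move=> p q a b a' b' Xp Xq.
  have -> : euler F p q a - euler F p q b - (euler F p q a' - euler F p q b') -
      (a - b - (a' - b')) = (F p a - F p b - (F p a' - F p b')) *m (g q - g p).
    by rewrite !mulmxBl -!euler_sub; apply: colP2 => i; rewrite !mxE; ring.
  rewrite (le_trans (mul_norm _ _))//.
  have fp := tf_four_point beta01 gamma01 B0 TF a' b' a b Xp Xp.
  rewrite subrr normr0 powR0 ?gt_eqF// add0r in fp.
  set u := `|a - b - (a' - b')| in fp *; set v := `|a' - b'| in fp *.
  set w := _ `^ gamma + _ `^ gamma in fp *.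
  have w0 : 0 <= w by rewrite addr_ge0 ?powR_ge0.
  apply: (@le_trans _ _ (c1 * `|q - p| `^ beta * (u + v * w))); last first.
    apply: ler_wpM2r; last by apply: ler_wpM2r => //; exact: powR_ge0.
    by apply: addr_ge0; rewrite ?mulr_ge0 /u /v.
  rewrite (_ : c1 * _ * _ = (k%:R * (B * u + B * v * w)) * (Cg * `|q - p| `^ beta)); last first.
    by rewrite /c1; ring.
  by rewrite ler_pM ?mulr_ge0 ?hg// ler_wpM2l.
- move=> p q a b Xp Xq pq1; have Xpq := Xm Xp Xq; set m := midpoint p q in Xpq *.
  have -> : euler F m q (euler F p m a) - euler F p q a -
    (euler F m q (euler F p m b) - euler F p q b) =
    (F m (euler F p m a) - F m (euler F p m b) - (F p a - F p b)) *m (g q - g m).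
    by rewrite !euler_defect -mulmxBl; congr (_ *m _); apply/matrixP => i j; rewrite !mxE; ring.
  rewrite (le_trans (mul_norm _ _))//.
  have := tf_four_point beta01 gamma01 B0 TF a b (euler F p m a) (euler F p m b) Xp Xpq.
  rewrite norm_midl; set h := `|q - p| in pq1 *; have h0 : 0 <= h by exact: normr_ge0.
  have hb : (h / 2) `^ beta <= h `^ beta by rewrite powR_mono ?(ltW beta0)//; lra.
  have h01 : 0 <= h <= 1 by rewrite h0.
  have bgb : beta * gamma <= beta by rewrite ger_pMr//; case/andP: gamma01.
  have bgg : beta * gamma <= gamma by rewrite ger_pMl//; case/andP: beta01.
  have s1 : h `^ beta <= h `^ (beta * gamma) by exact: powR_anti.
  have s2 : (h / 2) `^ gamma <= h `^ (beta * gamma).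
    rewrite (@le_trans _ _ (h `^ gamma))//; last exact: powR_anti.
    by rewrite powR_mono ?(ltW gamma0)//; lra.
  have incr c : `|euler F p m c - c| `^ gamma <= C * h `^ (beta * gamma).
    have := af_incr AF c Xp Xpq; rewrite mul0r addr0 mulr1 norm_midl -/h => H.
    apply: (@le_trans _ _ ((C * h `^ beta) `^ gamma)).
      by rewrite powR_mono ?(ltW gamma0)// (le_trans H)// ler_wpM2l.
    rewrite powRM ?powR_ge0// -powRrM ler_wpM2r ?powR_ge0//.
    by rewrite ler1_powR//; case/andP: gamma01.
  have Ia := incr a; have Ib := incr b.
  have L := af_lip AF a b Xp Xpq; rewrite norm_midl -/h in L.
  set x := h `^ (beta * gamma) in s1 s2 Ia Ib *; have x0 : 0 <= x by exact: powR_ge0.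
  set M := F m _ - F m _ - _ => H4.
  have HM : `|M| <= B * (C + (1 + (C + C))) * x * `|a - b|.
    rewrite (le_trans H4)//.
    rewrite (_ : B * (C + _) * x * _ = B * (C * x * `|a - b|) +
      B * `|a - b| * (x + (C * x + C * x))); last by ring.
    apply: lerD.
      rewrite ler_wpM2l// (le_trans L)// ler_wpM2r// ler_wpM2l//.
      exact: le_trans s1.
    by apply: ler_wpM2l; [exact: mulr_ge0|apply: lerD => //; exact: lerD].
  have g1 : `|g q - g m| <= Cg * h `^ beta.
    by rewrite (le_trans (hg Xpq Xq))// norm_midr ler_wpM2l.
  apply: (@le_trans _ _ (c2 * h `^ kappa * `|a - b|)); last first.
    by rewrite ler_wpM2r// ler_wpM2r ?powR_ge0.
  rewrite kappaE powRDge0// -/x (_ : c2 * _ * _ =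
    (k%:R * (B * (C + (1 + (C + C))) * x * `|a - b|)) * (Cg * h `^ beta)); last first.
    by rewrite /c2 /c1; ring.
  by rewrite ler_pM ?mulr_ge0// ler_wpM2l.
Qed.

End LipschitzField.

Section Contraction.
Context {R : realType} {k d : nat}.
Implicit Types (T : 'cV[R]_k -> 'M[R]_(d, k)) (Z : 'M[R]_k) (y w : 'cV[R]_k).

(** The linear extension of [y *m w^T |-> T y *m w] to all square matrices. *)
Definition contract T Z : 'cV[R]_d := \sum_j T (col j Z) *m delta_mx j (0 : 'I_1).

Lemma contract_norm T Z c : 0 <= c -> (forall y, `|T y| <= c * `|y|) ->
  `|contract T Z| <= k%:R * (k%:R * c) * `|Z|.
Proof.
move=> c0 HT; rewrite (le_trans (ler_norm_sum _ _ _))//.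
rewrite -mulrA mulr_natl -[X in _ *+ X](card_ord k) -sumr_const; apply: ler_sum => j _.
rewrite (le_trans (mulmx_norm _ _))// -mulrA ler_wpM2l//.
have colZ : `|col j Z| <= `|Z|.
  by apply: mx_norm_le => // i l; rewrite mxE mx_entry_le.
have d1 : `|delta_mx j (0 : 'I_1) : 'cV[R]_k| <= 1.
  by apply: mx_norm_le => // i l; rewrite mxE; case: (_ && _); rewrite ?normr1 ?normr0.
rewrite -[leRHS]mulr1; apply: ler_pM => //.
by rewrite (le_trans (HT _))// ler_wpM2l.
Qed.

Lemma contract_sub T T' Z :
  contract T Z - contract T' Z = contract (fun y => T y - T' y) Z.
Proof. by rewrite /contract -sumrB; apply: eq_bigr => j _; rewrite mulmxBl. Qed.

Lemma contract_add T Z Z' : (forall y w, T (y + w) = T y + T w) ->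
  contract T (Z + Z') = contract T Z + contract T Z'.
Proof.
move=> HT; rewrite /contract -big_split; apply: eq_bigr => j _ /=.
by rewrite linearD /= HT mulmxDl.
Qed.

Lemma contract_outer T y w : (forall c y, T (c *: y) = c *: T y) ->
  contract T (y *m w^T) = T y *m w.
Proof.
move=> HT; rewrite /contract.
have cw j : col j (y *m w^T) = w j 0 *: y.
  by apply: colP2 => i; rewrite !mxE big_ord1 !mxE mulrC.
under eq_bigr => j _ do rewrite cw HT -scalemxAl scalemxAr.
rewrite -mulmx_sumr; congr (_ *m _); apply: colP2 => i.
rewrite summxE (bigD1 i)//= big1 ?addr0; last first.
  by move=> j ji; rewrite !mxE eq_sym (negbTE ji) mulr0.
by rewrite !mxE !eqxx mulr1.
Qed.

End Contraction.

Section FieldFlow.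
Context {R : realType} {V : normedModType R} {k d : nat}.
Local Notation W := 'cV[R]_d.
Implicit Types (p q r : V) (a b z : W) (y : 'cV[R]_k).
Variables (X : set V) (beta gamma kappa zeta Cg : R) (g : V -> 'cV[R]_k) (H : V -> 'M[R]_k).
Hypotheses (beta01 : 0 < beta <= 1) (gamma01 : 0 < gamma <= 1).
Hypotheses (kappaE : kappa = beta + beta * gamma) (zetaE : zeta = kappa + beta).
Hypotheses (zeta2 : 2 < zeta).
Hypotheses (Xm : midpoint_closed X) (Cg0 : 0 <= Cg).
Hypothesis Xbd : exists D : R, forall p q, X p -> X q -> `|q - p| <= D.
Hypothesis hg : forall p q, X p -> X q -> `|g q - g p| <= Cg * `|q - p| `^ beta.

(** The second-level increments of [g]: when [H] is a potential of the matrix of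
    one-forms [g_i dg_j], these are the iterated integrals of [g] over [[p, q]]. *)
Definition area p q : 'M[R]_k := H q - H p - g p *m (g q - g p)^T.

Hypothesis area_norm : forall p q, X p -> X q ->
  `|area p q| <= Cg * `|q - p| `^ (beta + beta).

Lemma area_chen p q r : area p r = area p q + area q r + (g q - g p) *m (g r - g q)^T.
Proof. by apply/matrixP => i j; rewrite !mxE !big_ord1 !mxE; ring. Qed.

Variables (F : V -> W -> 'M[R]_(d, k)) (A : V -> W -> 'cV[R]_k -> W -> 'M[R]_(d, k)).
Variables (G B : R).
Hypotheses (G0 : 0 <= G) (B0 : 0 <= B).
Hypothesis LF : lipschitz_field X beta 0 G F.
Hypothesis TF : taylor_field X beta gamma g F A B.

Let T p a y : 'M[R]_(d, k) := A p a y (F p a *m y).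

(** One step of the second-order scheme: the second term replaces [F] by its
    first-order variation along the solution, integrated against [g]. *)
Definition davie p q a : W := euler g F p q a + contract (T p a) (area p q).

Let beta0 : 0 < beta. Proof. by case/andP: beta01. Qed.
Let gamma0 : 0 < gamma. Proof. by case/andP: gamma01. Qed.
Let bg0 : 0 < beta * gamma. Proof. by rewrite mulr_gt0. Qed.
Let bgb : beta * gamma <= beta. Proof. by rewrite ger_pMr//; case/andP: gamma01. Qed.
Let bgg : beta * gamma <= gamma. Proof. by rewrite ger_pMl//; case/andP: beta01. Qed.
Let kappa1 : 1 < kappa.
Proof. by case/andP: beta01 => _ b1; rewrite -(ltrD2r beta) -zetaE (le_lt_trans _ zeta2)// lerD2l. Qed.

Let mul_norm (M : 'M[R]_(d, k)) y : `|M *m y| <= k%:R * `|M| * `|y|.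
Proof. by rewrite -mulrA mulmx_norm. Qed.

Let F_norm p a : X p -> `|F p a| <= G.
Proof. by move=> Xp; have := lf_growth LF a Xp; rewrite mul0r addr0 mulr1. Qed.

Let Fy_norm p a y : X p -> `|F p a *m y| <= k%:R * G * `|y|.
Proof.
move=> Xp; rewrite (le_trans (mul_norm _ _))// ler_wpM2r// ler_wpM2l//.
exact: F_norm.
Qed.

Let cT := B * (1 + k%:R * G).
Let cT0 : 0 <= cT. Proof. by rewrite mulr_ge0// addr_ge0 ?mulr_ge0. Qed.

Let T_norm p a y : X p -> `|T p a y| <= cT * `|y|.
Proof.
move=> Xp; rewrite (le_trans (tf_bound TF _ _ _ Xp))// -mulrA ler_wpM2l//.
by rewrite mulrDl mul1r lerD2l Fy_norm.
Qed.

Let T_add p a y y' : T p a (y + y') = T p a y + T p a y'.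
Proof. by rewrite /T mulmxDr (tf_add TF). Qed.

Let T_scale p a c y : T p a (c *: y) = c *: T p a y.
Proof. by rewrite /T -scalemxAr (tf_scale TF). Qed.

Let cS := k%:R * (k%:R * cT) * Cg.
Let kkT0 : 0 <= k%:R * (k%:R * cT).
Proof. by apply: mulr_ge0 => //; exact: mulr_ge0. Qed.
Let cS0 : 0 <= cS. Proof. exact: mulr_ge0. Qed.

Let area_term_norm p q a : X p -> X q ->
  `|contract (T p a) (area p q)| <= cS * `|q - p| `^ (beta + beta).
Proof.
move=> Xp Xq; rewrite (le_trans (contract_norm _ cT0 (fun y => T_norm a y Xp)))//.
by rewrite /cS -[leRHS]mulrA; apply: ler_wpM2l => //; exact: area_norm.
Qed.

Let cE := k%:R * G * Cg + cS.
Let cE0 : 0 <= cE.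
Proof. by apply: addr_ge0 => //; apply: mulr_ge0 => //; exact: mulr_ge0. Qed.

Let davie_incr h p q a : 0 <= h <= 1 -> X p -> X q -> `|q - p| <= h ->
  `|davie p q a - a| <= cE * h `^ beta.
Proof.
move=> /andP[h0 h1] Xp Xq pq.
have -> : davie p q a - a = (euler g F p q a - a) + contract (T p a) (area p q).
  by rewrite /davie addrAC.
rewrite (le_trans (ler_normD _ _))// [leRHS]mulrDl; apply: lerD.
  rewrite euler_sub (le_trans (Fy_norm _ _ Xp))// -[leRHS]mulrA.
  apply: ler_wpM2l; first exact: mulr_ge0.
  by rewrite (le_trans (hg Xp Xq))// ler_wpM2l// powR_mono// ltW.
rewrite (le_trans (area_term_norm _ Xp Xq))// ler_wpM2l//.
apply: (@le_trans _ _ (h `^ (beta + beta))).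
  by rewrite powR_mono// addr_ge0// ltW.
by rewrite powR_anti ?h0// lerDl ltW.
Qed.

Let cD : R := B * (1 + cE `^ (1 + gamma) + cE `^ gamma) * k%:R * Cg + B * cS * k%:R * Cg +
  k%:R * (k%:R * (B * (1 + cE `^ gamma) * (1 + k%:R * G) + B * (k%:R * (G * (1 + cE))))) * Cg.

Let cD0 : 0 <= cD.
Proof.
have e1 : 0 <= 1 + cE by exact: addr_ge0.
have e2 : 0 <= 1 + cE `^ gamma by rewrite addr_ge0// powR_ge0.
have e3 : 0 <= 1 + k%:R * G by rewrite addr_ge0// mulr_ge0.
have e4 : 0 <= 1 + cE `^ (1 + gamma) + cE `^ gamma by rewrite !addr_ge0 ?powR_ge0.
have n0 : 0 <= k%:R :> R by [].
have m0 (s t : R) : 0 <= s -> 0 <= t -> 0 <= s * t by exact: mulr_ge0.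
apply: addr_ge0; first apply: addr_ge0.
- exact: m0 _ _ (m0 _ _ (m0 _ _ B0 e4) n0) Cg0.
- exact: m0 _ _ (m0 _ _ (m0 _ _ B0 cS0) n0) Cg0.
apply: (m0 _ _ _ Cg0); apply: (m0 _ _ n0); apply: (m0 _ _ n0); apply: addr_ge0.
  exact: m0 _ _ (m0 _ _ B0 e2) e3.
exact: m0 _ _ B0 (m0 _ _ n0 (m0 _ _ G0 e1)).
Qed.

Let davie_defectE p q r a : let b := davie p q a in
  davie q r b - davie p r a =
  (F q b - F p a - A p a (g q - g p) (b - a)) *m (g r - g q) +
  (A p a 0 (contract (T p a) (area p q)) *m (g r - g q) +
   contract (fun y => T q b y - T p a y) (area q r)).
Proof.
move=> b; rewrite -contract_sub.
have Eb : b = a + F p a *m (g q - g p) + contract (T p a) (area p q) by [].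
have Er : davie p r a = a + F p a *m (g q - g p) + F p a *m (g r - g q) +
    (contract (T p a) (area p q) + contract (T p a) (area q r) +
     T p a (g q - g p) *m (g r - g q)).
  rewrite /davie /euler (area_chen p q r) !contract_add// contract_outer//.
  congr (_ + _); rewrite -addrA -mulmxDr; congr (_ + _ *m _).
  by apply: colP2 => i; rewrite !mxE; ring.
have EA : A p a (g q - g p) (b - a) = T p a (g q - g p) +
    A p a 0 (contract (T p a) (area p q)).
  by rewrite /T -(tf_add TF) addr0; congr (A _ _ _ _); rewrite Eb -[a + _ + _]addrA [LHS]addrC addKr.
have Eq z : davie q r z = z + F q z *m (g r - g q) + contract (T q z) (area q r).
  by rewrite /davie; congr (_ + _).
rewrite Er Eq EA !mulmxBl mulmxDl {1}Eb; clear.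
move: (F p a *m (g q - g p)) (F q b *m _) (F p a *m _) (T p a _ *m _) (A p a 0 _ *m _).
move: (contract _ _) (contract _ _) (contract _ _) => *.
by apply: colP2 => i; rewrite !mxE; ring.
Qed.

(** The second-order terms cancel by Chen's relation; what remains are products of
    two Hoelder increments and of a third one to the power [gamma]. *)
Let davie_defect h p q r a : 0 <= h <= 1 -> X p -> X q -> X r ->
  `|q - p| <= h -> `|r - q| <= h -> `|davie q r (davie p q a) - davie p r a| <= cD * h `^ zeta.
Proof.
move=> h01 Xp Xq Xr pq qr; have /andP[h0 h1] := h01.
have pm s x : 0 < s -> 0 <= x -> x <= h -> x `^ s <= h `^ s.
  by move=> s0 x0 xh; rewrite powR_mono// ltW.
rewrite davie_defectE; set b := davie p q a.
have Db : `|b - a| <= cE * h `^ beta by exact: davie_incr.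
have Y1 : `|g r - g q| <= Cg * h `^ beta.
  by rewrite (le_trans (hg Xq Xr))// ler_wpM2l// pm.
have hk : h `^ kappa = h `^ beta * h `^ (beta * gamma) by rewrite kappaE powRDge0.
have hz : h `^ zeta = h `^ kappa * h `^ beta.
  by rewrite zetaE powRDge0// (lt_trans _ kappa1).
have Dg : `|b - a| `^ gamma <= cE `^ gamma * h `^ (beta * gamma).
  apply: (le_trans (powR_mono (ltW gamma0) (normr_ge0 _) Db)).
  by rewrite powRM ?powR_ge0// -powRrM.
have x1 := powR_anti bg0 bgb h01; have x2 := powR_anti bg0 bgg h01.
have p1 : `|F q b - F p a - A p a (g q - g p) (b - a)| <=
    B * (1 + cE `^ (1 + gamma) + cE `^ gamma) * h `^ kappa.
  apply: (le_trans (tf_taylor TF _ _ Xp Xq)); rewrite -mulrA; apply: (ler_wpM2l B0).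
  rewrite mulrDl [X in _ <= X + _]mulrDl mul1r; apply: lerD; [apply: lerD|].
  - apply: (@le_trans _ _ (h `^ (beta + gamma))).
      by apply: pm => //; rewrite addr_gt0.
    by apply: powR_anti => //; [rewrite kappaE addr_gt0|rewrite kappaE lerD2l].
  - have g1 : 0 <= 1 + gamma by rewrite addr_ge0// ltW.
    apply: (le_trans (powR_mono g1 (normr_ge0 _) Db)).
    rewrite powRM ?powR_ge0// ler_wpM2l ?powR_ge0//.
    by rewrite -powRrM mulrDr mulr1 -kappaE.
  - rewrite [h `^ kappa]hk [_ * (_ * _)]mulrCA [leRHS]mulrC.
    by apply: (ler_pM (powR_ge0 _ _) (powR_ge0 _ _) Dg); exact: pm.
have S1 : `|contract (T p a) (area p q)| <= cS * h `^ kappa.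
  apply: (le_trans (area_term_norm _ Xp Xq)); apply: ler_wpM2l => //.
  apply: (@le_trans _ _ (h `^ (beta + beta))); first by apply: pm => //; rewrite addr_gt0.
  by apply: powR_anti => //; [rewrite kappaE addr_gt0|rewrite kappaE lerD2l].
have p2 : `|A p a 0 (contract (T p a) (area p q))| <= B * cS * h `^ kappa.
  apply: (le_trans (tf_bound TF _ _ _ Xp)); rewrite normr0 add0r -mulrA.
  exact: (ler_wpM2l B0).
have FF : `|F q b - F p a| <= G * (1 + cE) * h `^ (beta * gamma).
  apply: (le_trans (ler_distD (F p b) _ _)).
  rewrite mulrDr mulrDl mulr1; apply: lerD.
    apply: (le_trans (lf_time LF _ Xp Xq)); apply: (ler_wpM2l G0).
    by apply: le_trans x1; exact: pm.
  apply: (le_trans (lf_state LF _ _ Xp)); rewrite -mulrA; apply: (ler_wpM2l G0).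
  by apply: (le_trans Db); apply: ler_wpM2l.
set c3 := B * (1 + cE `^ gamma) * (1 + k%:R * G) + B * (k%:R * (G * (1 + cE))).
have c30 : 0 <= c3.
  have e1 : 0 <= 1 + cE by exact: addr_ge0.
  have e2 : 0 <= 1 + cE `^ gamma by rewrite addr_ge0// powR_ge0.
  have e3 : 0 <= 1 + k%:R * G by rewrite addr_ge0// mulr_ge0.
  by apply: addr_ge0; [exact: mulr_ge0 (mulr_ge0 B0 e2) e3
    |apply: mulr_ge0 => //; apply: mulr_ge0 => //; exact: mulr_ge0].
have TT y : `|T q b y - T p a y| <= c3 * h `^ (beta * gamma) * `|y|.
  have -> : T q b y - T p a y = (A q b y (F q b *m y) - A p a y (F q b *m y)) +
      A p a 0 ((F q b - F p a) *m y).
    rewrite /T mulmxBl; move: (F q b *m y) (F p a *m y) => z z'.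
    by rewrite -[in RHS](subrr y) (tf_sub TF) addrA subrK.
  have yn : `|y| + `|F q b *m y| <= (1 + k%:R * G) * `|y|.
    by rewrite mulrDl mul1r lerD2l Fy_norm.
  apply: (le_trans (ler_normD _ _)); rewrite /c3 mulrDl [leRHS]mulrDl; apply: lerD.
    apply: (le_trans (tf_holder TF _ _ _ _ Xp Xq)).
    rewrite [leRHS](_ : _ = B * ((1 + cE `^ gamma) * h `^ (beta * gamma)) *
      ((1 + k%:R * G) * `|y|)); last by ring.
    apply: ler_pM => //; rewrite ?mulr_ge0 ?addr_ge0 ?powR_ge0//.
    apply: (ler_wpM2l B0); rewrite mulrDl mul1r; apply: lerD => //.
    by apply: le_trans x2; exact: pm.
  apply: (le_trans (tf_bound TF _ _ _ Xp)); rewrite normr0 add0r -!mulrA.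
  apply: (ler_wpM2l B0); apply: (le_trans (mul_norm _ _)); rewrite -mulrA.
  apply: ler_wpM2l => //; rewrite !mulrA; apply: ler_wpM2r => //.
have p3 : `|contract (fun y => T q b y - T p a y) (area q r)| <=
    k%:R * (k%:R * c3) * Cg * h `^ zeta.
  have c3h : 0 <= c3 * h `^ (beta * gamma) by rewrite mulr_ge0 ?powR_ge0.
  apply: (le_trans (contract_norm _ c3h TT)).
  have -> : k%:R * (k%:R * c3) * Cg * h `^ zeta =
      k%:R * (k%:R * (c3 * h `^ (beta * gamma))) * (Cg * h `^ (beta + beta)).
    by rewrite hz hk powRDge0//; ring.
  apply: ler_wpM2l; first by rewrite !mulr_ge0// powR_ge0.
  apply: (le_trans (area_norm Xq Xr)); apply: ler_wpM2l => //.
  by apply: pm => //; rewrite addr_gt0.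
have -> : cD * h `^ zeta = B * (1 + cE `^ (1 + gamma) + cE `^ gamma) * k%:R * Cg * h `^ zeta +
    (B * cS * k%:R * Cg * h `^ zeta + k%:R * (k%:R * c3) * Cg * h `^ zeta).
  by rewrite /cD -/c3; ring.
apply: (le_trans (ler_normD _ _)); apply: lerD.
  apply: (le_trans (mul_norm _ _)).
  rewrite [leRHS](_ : _ = k%:R * (B * (1 + cE `^ (1 + gamma) + cE `^ gamma) * h `^ kappa) *
    (Cg * h `^ beta)); last by rewrite hz; ring.
  by apply: (ler_pM _ (normr_ge0 _) _ Y1); [exact: mulr_ge0|exact: ler_wpM2l].
apply: (le_trans (ler_normD _ _)); apply: lerD => //.
apply: (le_trans (mul_norm _ _)).
rewrite [leRHS](_ : _ = k%:R * (B * cS * h `^ kappa) * (Cg * h `^ beta)); last by rewrite hz; ring.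
by apply: (ler_pM _ (normr_ge0 _) _ Y1); [exact: mulr_ge0|exact: ler_wpM2l].
Qed.

(** The flow of the equation. Its existence uses the first-order scheme only; the
    second-order scheme, whose defect beats the square of the mesh, makes it
    consistent on triangles and hence independent of paths. *)
Lemma field_flow : exists (phi : V -> V -> W -> W) (K h0 : R),
  [/\ 0 <= K, 0 < h0 <= 1,
      forall p q a, X p -> X q -> `|q - p| <= h0 ->
        `|phi p q a - euler g F p q a| <= K * `|q - p| `^ kappa,
      forall p q r a, X p -> X q -> X r -> phi q r (phi p q a) = phi p r a &
      (forall p q a b M, X p -> X q -> (forall n, `|dyadic (euler g F) n p q a - b| <= M) ->
         `|phi p q a - b| <= M) /\
      (forall (theta : V -> W) (C : R), 0 <= C ->
         (forall p q, X p -> X q -> `|q - p| <= 1 ->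
           `|theta q - euler g F p q (theta p)| <= C * `|q - p| `^ kappa) ->
         forall p q, X p -> X q -> theta q = phi p q (theta p))].
Proof.
have [C [C1 RF]] := euler_regular beta01 gamma01 kappaE Xm Cg0 hg G0 B0 LF TF.
have [phi [K [L [h0 [K0 L0 h01 mid [near lip bd]]]]]] :=
  dyadic_flow C1 beta0 gamma01 kappaE kappa1 Xm RF Xbd.
have /andP[h00 h0le] := h01.
have kz : kappa <= zeta by rewrite zetaE lerDl ltW.
exists phi, K, h0; split=> //.
- have KS0 : 0 <= K + cS by rewrite addr_ge0.
  have dnear p q a : X p -> X q -> `|q - p| <= h0 ->
      `|phi p q a - davie p q a| <= (K + cS) * `|q - p| `^ kappa.
    move=> Xp Xq pq; rewrite /davie opprD addrA (le_trans (ler_normB _ _))//.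
    rewrite [leRHS]mulrDl; apply: lerD; first exact: near.
    apply: (le_trans (area_term_norm _ Xp Xq)); apply: ler_wpM2l => //.
    apply: powR_anti; [by rewrite kappaE addr_gt0|by rewrite kappaE lerD2l|].
    by rewrite normr_ge0 (le_trans pq).
  have ddefect h p q r a : 0 <= h <= h0 -> X p -> X q -> X r ->
      `|q - p| <= h -> `|r - q| <= h -> `|r - p| <= h ->
      `|davie q r (davie p q a) - davie p r a| <= cD * h `^ zeta.
    move=> /andP[hp hh] Xp Xq Xr pq qr _; apply: davie_defect => //.
    by rewrite hp (le_trans hh).
  move=> p q r a Xp Xq Xr.
  exact: (flow_property beta0 kappa1 kz zeta2 cD0 L0 KS0 h00 Xm Xbd mid lip dnear ddefect).
- split=> // theta C' C'0 Hth p q Xp Xq.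
  have KC0 : 0 <= K + C' by rewrite addr_ge0.
  apply: (flow_trajectory beta0 kappa1 KC0 L0 h00 Xm Xbd mid lip _ Xp Xq) => x y Xx Xy xy.
  rewrite (le_trans (ler_distD (euler g F x y (theta x)) _ _))// mulrDl; apply: lerD.
    exact: near.
  by rewrite distrC; apply: Hth => //; exact: le_trans h0le.
Qed.

End FieldFlow.

(** * Second-level increments and Taylor bounds from the hypotheses *)

Section Setting.
Context {R : realType}.

Lemma holder_bound (V W : normedModType R) (alpha : R) (X : set V) (u : V -> W) :
  holder_on alpha X u ->
  exists C : R, 0 <= C /\ forall x y, X x -> X y -> `|u y - u x| <= C * `|y - x| `^ alpha.
Proof.
move=> [_ [C HC]]; exists `|C|; split=> // x y Xx Xy.
have [->|xy] := eqVneq x y; first by rewrite subrr normr0 mulr_ge0 ?powR_ge0.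
have d0 : 0 < `|y - x| `^ alpha by apply: powR_gt0; rewrite normr_gt0 subr_eq0 eq_sym.
by rewrite -ler_pdivrMr// (le_trans (HC _ _ Xx Xy xy))// ler_norm.
Qed.

Lemma cube_midpoint_closed (m : nat) (I : set R) : is_interval I ->
  midpoint_closed (cube I : set 'cV[R]_m).
Proof.
move=> hI p q Ip Iq i; rewrite /midpoint !mxE.
have [pq|/ltW qp] := leP (p i 0) (q i 0).
  by apply: (hI _ _ (Ip i) (Iq i)); apply/andP; split; lra.
by apply: (hI _ _ (Iq i) (Ip i)); apply/andP; split; lra.
Qed.

Lemma cube_bounded (m : nat) (I : set R) : bounded_set I ->
  exists D : R, forall p q : 'cV[R]_m, cube I p -> cube I q -> `|q - p| <= D.
Proof.
move=> [M [_ HM]]; pose N := `|M| + 1; exists (N + N) => p q Ip Iq.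
have IN x : I x -> `|x| <= N.
  by move=> Ix; apply: (HM N) => //; rewrite (le_lt_trans (ler_norm M))// ltrDl.
have N0 : 0 <= N by rewrite addr_ge0.
apply: mx_norm_le => [|i j]; first exact: addr_ge0.
by rewrite (ord1 j) !mxE (le_trans (ler_normB _ _))// lerD// IN.
Qed.

(** The diagonal one-forms [g_i dg_i] are exact, with potential [g_i ^ 2 / 2]. *)
Lemma area_potential (m k : nat) (I : set R) (beta : R) (g : 'cV[R]_m -> 'cV[R]_k)
  (p0 : 'cV[R]_m) : is_interval I -> cube I p0 -> 0 < beta -> 1 < beta + beta ->
  holder_on beta (cube I) g ->
  (forall i j : 'I_k, i != j ->
     forall p v1 v2 : 'cV[R]_m, axis_rectangle_in (cube I) p v1 v2 ->
       parallelogram_boundary_integral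
         (fun x => g x i 0) (fun x => g x j 0) p v1 v2 = 0) ->
  exists (H : 'cV[R]_m -> 'M[R]_k) (C : R), 0 <= C /\ forall p q, cube I p -> cube I q ->
    `|area g H p q| <= C * `|q - p| `^ (beta + beta).
Proof.
move=> hI Ip0 beta0 beta2 /holder_bound [Cg [Cg0 hg]] hclosed.
have hgi i p q : cube I p -> cube I q ->
    `|g q i 0 - g p i 0| <= Cg * `|q - p| `^ beta.
  move=> Ip Iq; have := mx_entry_le (g q - g p) i 0; rewrite !mxE.
  by move/le_trans; apply; exact: hg.
have pot (ij : 'I_k * 'I_k) : exists HC : ('cV[R]_m -> R) * R, 0 <= HC.2 /\
    forall p q, cube I p -> cube I q ->
    `|HC.1 q - HC.1 p - g p ij.1 0 * (g q ij.2 0 - g p ij.2 0)| <=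
    HC.2 * `|q - p| `^ (beta + beta).
  case: ij => i j /=; have [->|ij] := eqVneq i j.
    exists (fun x => g x j 0 ^+ 2 / 2, Cg * Cg) => /=; split=> [|p q Ip Iq].
      exact: mulr_ge0.
    rewrite (_ : _ - _ - _ = (g q j 0 - g p j 0) * (g q j 0 - g p j 0) / 2); last by field.
    rewrite !normrM (ger0_norm (_ : 0 <= 2^-1))// powRDge0// mulrACA.
    apply: (@le_trans _ _ (`|g q j 0 - g p j 0| * `|g q j 0 - g p j 0|)).
      by rewrite ler_piMr ?mulr_ge0// invf_le1// ler1n.
    by apply: ler_pM => //; exact: hgi.
  have [h [C [C0 HC]]] :=
    closed_form_potential hI beta0 beta2 Cg0 Cg0 (hgi i) (hgi j) (hclosed i j ij) Ip0.
  by exists (h, C).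
have [f Hf] := choice pot.
exists (fun x => \matrix_(i, j) (f (i, j)).1 x), (\sum_ij (f ij).2).
have fC0 ij : 0 <= (f ij).2 by have [] := Hf ij.
split=> [|p q Ip Iq]; first exact: sumr_ge0.
apply: mx_norm_le => [|i j]; first by rewrite mulr_ge0 ?powR_ge0// sumr_ge0.
rewrite /area !mxE big_ord1 !mxE; have [_ H] := Hf (i, j).
rewrite (le_trans (H _ _ Ip Iq))// ler_wpM2r ?powR_ge0//.
by rewrite (bigD1 (i, j))//= lerDl sumr_ge0.
Qed.

Context {m k d : nat}.
Local Notation V := 'cV[R]_m.
Local Notation W := 'cV[R]_d.
Variables (X : set V) (beta gamma : R) (g : V -> 'cV[R]_k).
Hypotheses (beta01 : 0 < beta <= 1) (gamma01 : 0 < gamma <= 1).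
Hypothesis bg1 : 1 < beta + gamma.
Hypothesis Xm : midpoint_closed X.

Let beta0 : 0 < beta. Proof. by case/andP: beta01. Qed.
Let gamma0 : 0 < gamma. Proof. by case/andP: gamma01. Qed.

Lemma vec_mx_norm (v : 'cV[R]_(d * k)) : `|vec_mx v^T| <= `|v|.
Proof. by apply: mx_norm_le => // i j; rewrite mxE mxE mx_entry_le. Qed.

Lemma col_mx_norm (y : 'cV[R]_k) (z : W) : `|col_mx y z| <= `|y| + `|z|.
Proof.
apply: mx_norm_le => [|i j]; first exact: addr_ge0.
rewrite mxE; case: (fintype.split i) => l; rewrite (le_trans (mx_entry_le _ _ _))//.
  by rewrite lerDl.
by rewrite lerDr.
Qed.

(** Along either variable the remainder of the first-order expansion is [o (h)]
    and subadditive up to the oscillation of the derivative; bisection turns it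
    into a power of the increment. *)
Lemma gderivative_taylor (f : V * W -> 'M[R]_(d, k)) (Df : V * W -> 'M[R]_(d * k, k + d)) :
  holder_on beta X g ->
  is_gderivative (X `*` setT) (extend_map g) (fun x => flatten_mx (f x)) Df ->
  holder_on gamma (X `*` setT) Df ->
  exists (A : V -> W -> 'cV[R]_k -> W -> 'M[R]_(d, k)) (B : R), 0 <= B /\
    taylor_field X beta gamma g (fun p a => f (p, a)) A B.
Proof.
move=> /holder_bound [Cg [Cg0 hg]] [_ [rem0 remo]] HDf.
have [[B1 HB1] _] := HDf; have [C [C0 HC]] := holder_bound HDf.
pose A p a y z : 'M[R]_(d, k) := vec_mx (Df (p, a) *m col_mx y z)^T.
pose F p a := f (p, a).
have Alin p a c y y' z z' : A p a (c *: y + y') (c *: z + z') = c *: A p a y z + A p a y' z'.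
  by rewrite /A -add_col_mx -scale_col_mx mulmxDr -scalemxAr !linearD !linearZ.
have A0 p a : A p a 0 0 = 0.
  by have := Alin p a (- 1) 0 0 0 0; rewrite !scaler0 !addr0 scaleN1r addNr.
have Aadd p a y y' z z' : A p a (y + y') (z + z') = A p a y z + A p a y' z'.
  by have := Alin p a 1 y y' z z'; rewrite !scale1r.
pose n : R := (k + d)%:R; have n0 : 0 <= n by [].
have B10 : 0 <= `|B1| by [].
have Abound p a y z : X p -> `|A p a y z| <= n * `|B1| * (`|y| + `|z|).
  move=> Xp; apply: (le_trans (vec_mx_norm _)); apply: (le_trans (mulmx_norm _ _)).
  rewrite -mulrA ler_wpM2l//; apply: ler_pM => //; last exact: col_mx_norm.
  by rewrite (le_trans (HB1 (p, a) _))// ler_norm.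
have pair_pow p q (a b : W) :
    `|(q, b) - (p, a)| `^ gamma <= `|q - p| `^ gamma + `|b - a| `^ gamma.
  have -> : `|(q, b) - (p, a)| = Num.max `|q - p| `|b - a| by rewrite prod_normE.
  by rewrite maxEle; case: ifP => _; rewrite ?lerDl ?lerDr powR_ge0.
have Ahold p q a b y z : X p -> X q -> `|A q b y z - A p a y z| <=
    n * C * (`|q - p| `^ gamma + `|b - a| `^ gamma) * (`|y| + `|z|).
  move=> Xp Xq; rewrite /A -linearB -linearB /= -mulmxBl.
  apply: (le_trans (vec_mx_norm _)); apply: (le_trans (mulmx_norm _ _)).
  rewrite -!mulrA ler_wpM2l// mulrA; apply: ler_pM => //; last exact: col_mx_norm.
  apply: (le_trans (HC (p, a) (q, b) _ _)); [by split|by split|].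
  by apply: (ler_wpM2l C0); exact: pair_pow.
have remE p q a b : `|F q b - F p a - A p a (g q - g p) (b - a)| <=
    `|flatten_mx (f (q, b)) - flatten_mx (f (p, a)) -
      Df (p, a) *m (extend_map g (q, b) - extend_map g (p, a))|.
  apply: le_trans (vec_mx_norm _); rewrite le_of_eq//; congr `|_|.
  rewrite /extend_map /= opp_col_mx add_col_mx !linearB /=.
  by rewrite /flatten_mx !trmxK !mxvecK.
have small e : 0 < e -> exists2 dl : R, 0 < dl & forall p q a b, X p -> X q ->
    `|(q, b) - (p, a)| <= dl ->
    `|F q b - F p a - A p a (g q - g p) (b - a)| <= e * `|(q, b) - (p, a)|.
  move=> e0; have [dl dl0 Hdl] := remo _ e0; exists dl => // p q a b Xp Xq pq.
  apply: (le_trans (remE _ _ _ _)).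
  have [qp|qp] := eqVneq (q, b) (p, a).
    have := rem0 (p, a); rewrite qp => -> //.
    by rewrite normr0 mulr_ge0// ltW.
  have qp0 : 0 < `|(q, b) - (p, a)| by rewrite normr_gt0 subr_eq0.
  have := Hdl (p, a) (q, b); rewrite qp0 pq ler_pdivrMr//; exact.
have dirp p q a : X p -> X q -> `|F q a - F p a - A p a (g q - g p) 0| <=
    n * C * Cg * sewing_const (beta + gamma) * `|q - p| `^ (beta + gamma).
  move=> Xp Xq.
  apply: (@bisection_subadditive R _ X
    (fun p q => `|F q a - F p a - A p a (g q - g p) 0|)) => //.
  - by rewrite !mulr_ge0.
  - move=> x y Xx Xy; have Xxy := Xm Xx Xy; set c := midpoint x y in Xxy *.
    have -> : F y a - F x a - A x a (g y - g x) 0 = (F c a - F x a - A x a (g c - g x) 0) +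
       (F y a - F c a - A c a (g y - g c) 0) + (A c a (g y - g c) 0 - A x a (g y - g c) 0).
      have -> : A x a (g y - g x) 0 = A x a (g c - g x) 0 + A x a (g y - g c) 0.
        rewrite -Aadd addr0; congr (A _ _ _ _).
        by apply: colP2 => i; rewrite !mxE; ring.
      by apply/matrixP => i j; rewrite !mxE; ring.
    apply: (le_trans (ler_normD _ _)); apply: lerD; first exact: ler_normD.
    apply: (le_trans (Ahold _ _ _ _ _ _ Xx Xxy)).
    rewrite subrr normr0 powR0 ?gt_eqF// !addr0 norm_midl.
    rewrite [leRHS](_ : _ = n * C * `|y - x| `^ gamma * (Cg * `|y - x| `^ beta)); last first.
      by rewrite powRDge0//; ring.
    have half (s : R) : 0 < s -> (`|y - x| / 2) `^ s <= `|y - x| `^ s.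
      move=> s0; rewrite powR_mono ?(ltW s0) ?divr_ge0// ler_pdivrMr// ler_peMr// ler1n.
      by [].
    apply: ler_pM => //.
    + by rewrite !mulr_ge0 ?powR_ge0.
    + by apply: ler_wpM2l; [exact: mulr_ge0|exact: half].
    + by apply: (le_trans (hg _ _ Xxy Xy)); apply: (ler_wpM2l Cg0); rewrite norm_midr half.
  - move=> e e0; have [dl dl0 Hdl] := small _ e0; exists dl => // x y Xx Xy.
    have := Hdl x y a a Xx Xy; rewrite prod_normE /= subrr normr0.
    by rewrite (_ : Num.max `|y - x| 0 = `|y - x|)//; apply/max_idPl.
have dira p a b : X p -> `|F p b - F p a - A p a 0 (b - a)| <=
    n * C * sewing_const (1 + gamma) * `|b - a| `^ (1 + gamma).
  move=> Xp.
  apply: (@bisection_subadditive R _ setT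
    (fun a b => `|F p b - F p a - A p a 0 (b - a)|)) => //.
  - by rewrite ltrDl.
  - by rewrite mulr_ge0.
  - move=> x y _ _; set c := midpoint x y.
    have -> : F p y - F p x - A p x 0 (y - x) = (F p c - F p x - A p x 0 (c - x)) +
       (F p y - F p c - A p c 0 (y - c)) + (A p c 0 (y - c) - A p x 0 (y - c)).
      have -> : A p x 0 (y - x) = A p x 0 (c - x) + A p x 0 (y - c).
        rewrite -Aadd addr0; congr (A _ _ _ _).
        by apply: colP2 => i; rewrite !mxE; ring.
      by apply/matrixP => i j; rewrite !mxE; ring.
    apply: (le_trans (ler_normD _ _)); apply: lerD; first exact: ler_normD.
    apply: (le_trans (Ahold _ _ _ _ _ _ Xp Xp)).
    rewrite subrr [`|0|]normr0 powR0 ?gt_eqF// [`|0|]normr0 !add0r norm_midl norm_midr.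
    rewrite powRDge0// powRr1// -!mulrA; apply: ler_wpM2l => //; apply: ler_wpM2l => //.
    have h2 : `|y - x| / 2 <= `|y - x| by rewrite ler_pdivrMr// ler_peMr// ler1n.
    rewrite [leRHS]mulrC; apply: ler_pM => //; rewrite ?powR_ge0 ?divr_ge0//.
    by rewrite powR_mono ?(ltW gamma0) ?divr_ge0.
  - move=> e e0; have [dl dl0 Hdl] := small _ e0; exists dl => // x y _ _.
    have := Hdl p p x y Xp Xp; rewrite prod_normE /= !subrr normr0.
    by rewrite (_ : Num.max 0 `|y - x| = `|y - x|)//; apply/max_idPr.
have S1 := ltW (sewing_const_gt0 bg1).
have gg1 : 1 < 1 + gamma by rewrite ltrDl.
have S2 := ltW (sewing_const_gt0 gg1).
pose c1 := n * `|B1|; pose c2 := n * C.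
pose c3 := n * C * Cg * sewing_const (beta + gamma); pose c4 := n * C * sewing_const (1 + gamma).
pose c5 := n * C * Cg.
have [c10 c20 c30 c40 c50] : [/\ 0 <= c1, 0 <= c2, 0 <= c3, 0 <= c4 & 0 <= c5].
  by split; rewrite ?mulr_ge0.
have Ble : forall c, c \in [:: c1; c2; c3; c4; c5] -> c <= c1 + c2 + c3 + c4 + c5.
  move=> c; rewrite !inE => /or4P[/eqP->|/eqP->|/eqP->|/orP[]/eqP->]; lra.
exists A, (c1 + c2 + c3 + c4 + c5); split; first by rewrite !addr_ge0.
split.
- by move=> p a c y y' z z'; exact: Alin.
- move=> p a y z Xp; rewrite (le_trans (Abound _ _ _ _ Xp))// ler_wpM2r ?addr_ge0//.
  by apply: Ble; rewrite inE eqxx.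
- move=> p q a b y z Xp Xq; rewrite (le_trans (Ahold _ _ _ _ _ _ Xp Xq))//.
  rewrite ler_wpM2r ?addr_ge0// ler_wpM2r ?addr_ge0 ?powR_ge0//.
  by apply: Ble; rewrite !inE eqxx orbT.
- move=> p q a b Xp Xq.
  have -> : f (q, b) - f (p, a) - A p a (g q - g p) (b - a) =
     (F q b - F p b - A p b (g q - g p) 0) + (F p b - F p a - A p a 0 (b - a)) +
     (A p b (g q - g p) 0 - A p a (g q - g p) 0).
    have -> : A p a (g q - g p) (b - a) = A p a (g q - g p) 0 + A p a 0 (b - a).
      by rewrite -Aadd addr0 add0r.
    by apply/matrixP => i j; rewrite !mxE; ring.
  rewrite [leRHS]mulrDr [X in _ <= X + _]mulrDr.
  apply: (le_trans (ler_normD _ _)); apply: lerD.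
    apply: (le_trans (ler_normD _ _)); apply: lerD.
      apply: (le_trans (dirp _ _ _ Xp Xq)); apply: ler_wpM2r; first exact: powR_ge0.
      by apply: Ble; rewrite !inE eqxx !orbT.
    apply: (le_trans (dira _ _ _ Xp)); apply: ler_wpM2r; first exact: powR_ge0.
    by apply: Ble; rewrite !inE eqxx !orbT.
  apply: (le_trans (Ahold _ _ _ _ _ _ Xp Xp)).
  rewrite subrr [`|0|]normr0 powR0 ?gt_eqF// [`|0|]normr0 add0r addr0.
  apply: (@le_trans _ _ (c5 * (`|b - a| `^ gamma * `|q - p| `^ beta))).
    rewrite [leRHS](_ : _ = n * C * `|b - a| `^ gamma * (Cg * `|q - p| `^ beta)); last first.
      by rewrite /c5; ring.
    apply: ler_wpM2l; last exact: hg.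
    by rewrite !mulr_ge0// powR_ge0.
  apply: ler_wpM2r; first by rewrite mulr_ge0 ?powR_ge0.
  by apply: Ble; rewrite !inE eqxx !orbT.
Qed.

End Setting.

(** * Solutions *)

Section Solutions.
Context {R : realType} {m k d : nat}.
Local Notation V := 'cV[R]_m.
Local Notation W := 'cV[R]_d.
Implicit Types (p q : V) (a b z : W) (F : V -> W -> 'M[R]_(d, k)).
Variables (X : set V) (beta gamma kappa Cg : R) (g : V -> 'cV[R]_k).
Hypotheses (beta01 : 0 < beta <= 1) (gamma01 : 0 < gamma <= 1).
Hypotheses (kappaE : kappa = beta + beta * gamma) (kappa1 : 1 < kappa).
Hypotheses (Xm : midpoint_closed X) (Cg0 : 0 <= Cg).
Hypothesis Xbd : exists D : R, forall p q, X p -> X q -> `|q - p| <= D.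
Hypothesis hg : forall p q, X p -> X q -> `|g q - g p| <= Cg * `|q - p| `^ beta.

Let beta0 : 0 < beta. Proof. by case/andP: beta01. Qed.
Let gamma0 : 0 < gamma. Proof. by case/andP: gamma01. Qed.
Let kappa2 : kappa <= beta + beta.
Proof. by rewrite kappaE lerD2l ger_pMr//; case/andP: gamma01. Qed.

(** The Taylor bound controls the variation in time on a bounded domain; in the
    state, where it is superlinear for large increments, the mean value
    inequality is used instead. *)
Lemma taylor_lipschitz_field F A (B : R) p0 : X p0 -> 0 <= B ->
  taylor_field X beta gamma g F A B ->
  exists G : R, 0 <= G /\ lipschitz_field X beta 1 G F.
Proof.
move=> Xp0 B0 TF; have [D HD] := Xbd.
have D0 : 0 <= D by rewrite (le_trans _ (HD _ _ Xp0 Xp0)).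
pose Gt := B * Cg + B * D `^ gamma.
have Gt0 : 0 <= Gt by rewrite addr_ge0 ?mulr_ge0 ?powR_ge0.
have time p q a : X p -> X q -> `|F q a - F p a| <= Gt * `|q - p| `^ beta.
  move=> Xp Xq; have := tf_taylor TF a a Xp Xq.
  rewrite subrr normr0 !powR0 ?gt_eqF ?addr_gt0// mul0r !addr0 powRDge0// => H.
  rewrite -[F q a - _](subrK (A p a (g q - g p) 0)) addrC [leRHS]mulrDl.
  apply: (le_trans (ler_normD _ _)); apply: lerD.
    apply: (le_trans (tf_bound TF _ _ _ Xp)); rewrite normr0 addr0 -mulrA.
    by apply: (ler_wpM2l B0); exact: hg.
  apply: (le_trans H); rewrite -mulrA; apply: (ler_wpM2l B0); rewrite mulrC.
  by apply: ler_wpM2r; [exact: powR_ge0|exact: powR_mono (ltW gamma0) _ (HD _ _ Xp Xq)].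
pose c := `|F p0 0|.
pose G := B + Gt + Gt * D `^ beta + c.
have Db0 : 0 <= Gt * D `^ beta by rewrite mulr_ge0 ?powR_ge0.
have c0 : 0 <= c by exact: normr_ge0.
have [GB GGt] : B <= G /\ Gt <= G.
  by rewrite /G; move: (Gt * _) Db0 c0 Gt0 B0; clearbody c Gt => s *; split; lra.
exists G; split; first exact: le_trans GB.
split.
- move=> p q a Xp Xq; apply: (le_trans (time _ _ _ Xp Xq)).
  by apply: ler_wpM2r => //; exact: powR_ge0.
- move=> p a b Xp; apply: (le_trans (tf_lipschitz beta01 gamma01 B0 TF a b Xp)).
  exact: ler_wpM2r.
- move=> p a Xp; rewrite mul1r mulrDr mulr1.
  have h1 := tf_lipschitz beta01 gamma01 B0 TF 0 a Xp; rewrite subr0 in h1.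
  have h2 := time p0 p 0 Xp0 Xp.
  have h3 : Gt * `|p - p0| `^ beta <= Gt * D `^ beta.
    by apply: (ler_wpM2l Gt0); exact: powR_mono (ltW beta0) _ (HD _ _ Xp0 Xp).
  have -> : F p a = (F p a - F p 0) + ((F p 0 - F p0 0) + F p0 0) by rewrite !addrA !subrK.
  rewrite addrC; apply: (le_trans (ler_normD _ _)); rewrite addrC [leRHS]addrC; apply: lerD.
    by apply: (le_trans h1); exact: ler_wpM2r.
  apply: (le_trans (ler_normD _ _)).
  apply: (le_trans (lerD (le_trans h2 h3) (lexx _))); rewrite -/c /G -[leRHS]addrA lerDr.
  exact: addr_ge0.
Qed.

Lemma lipschitz_field_truncate F (G rho : R) : 0 <= G -> 0 <= rho ->
  lipschitz_field X beta 1 G F ->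
  lipschitz_field X beta 1 G (fun p a => F p (truncate_state rho a)) /\
  lipschitz_field X beta 0 (G * (rho + 2)) (fun p a => F p (truncate_state rho a)).
Proof.
move=> G0 rho0 LF; have GG : G <= G * (rho + 2) by rewrite ler_peMr//; lra.
split; split=> /=.
- by move=> p q a; exact: (lf_time LF).
- move=> p a b Xp; apply: (le_trans (lf_state LF _ _ Xp)); apply: (ler_wpM2l G0).
  exact: truncate_state_lip.
- move=> p a Xp; apply: (le_trans (lf_growth LF _ Xp)); apply: (ler_wpM2l G0).
  by rewrite !mul1r lerD2l truncate_state_norm.
- move=> p q a Xp Xq; apply: (le_trans (lf_time LF _ Xp Xq)).
  by apply: ler_wpM2r => //; exact: powR_ge0.
- move=> p a b Xp; apply: (le_trans (lf_state LF _ _ Xp)).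
  by apply: ler_pM => //; exact: truncate_state_lip.
- move=> p a Xp; apply: (le_trans (lf_growth LF _ Xp)); rewrite mul0r addr0 mulr1.
  apply: (ler_wpM2l G0); rewrite mul1r.
  by have := truncate_state_bound rho0 a; lra.
Qed.

(** The remainder of a solution is [o (h)], and its additivity defect is a product of
    two [beta]-Hoelder increments; hence it is [O (h ^ kappa)]. *)
Lemma solution_remainder F (G : R) (theta : V -> W) : 0 <= G ->
  lipschitz_field X beta 1 G F -> holder_on beta X theta ->
  little_o_on X (fun p q => (theta q - theta p) - F p (theta p) *m (g q - g p)) ->
  exists C : R, 0 <= C /\ forall p q, X p -> X q -> `|q - p| <= 1 ->
    `|theta q - euler g F p q (theta p)| <= C * `|q - p| `^ kappa.
Proof.
move=> G0 LF /holder_bound [Ct [Ct0 Ht]] [rem0 remo].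
pose N p q := `|(theta q - theta p) - F p (theta p) *m (g q - g p)|.
pose C := k%:R * (G + G * Ct) * Cg.
have C0 : 0 <= C by rewrite !mulr_ge0// addr_ge0// mulr_ge0.
have bb1 : 1 < beta + beta by exact: lt_le_trans kappa2.
have key p q : X p -> X q -> N p q <= C * sewing_const (beta + beta) * `|q - p| `^ (beta + beta).
  apply: (@bisection_subadditive R _ X) => //.
  - move=> x y Xx Xy; have Xxy := Xm Xx Xy; set c := midpoint x y in Xxy *.
    rewrite /N; have -> : theta y - theta x - F x (theta x) *m (g y - g x) =
      (theta c - theta x - F x (theta x) *m (g c - g x)) +
      (theta y - theta c - F c (theta c) *m (g y - g c)) +
      (F c (theta c) - F x (theta x)) *m (g y - g c).
      have -> : g y - g x = (g c - g x) + (g y - g c).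
        by apply: colP2 => i; rewrite !mxE; ring.
      rewrite mulmxBl mulmxDr; move: (F x _ *m _) (F x _ *m _) (F c _ *m _) => *.
      by apply: colP2 => i; rewrite !mxE; ring.
    apply: (le_trans (ler_normD _ _)); apply: lerD; first exact: ler_normD.
    apply: (le_trans (mulmx_norm _ _)); rewrite powRDge0//.
    rewrite [leRHS](_ : _ = k%:R * ((G + G * Ct) * `|y - x| `^ beta * (Cg * `|y - x| `^ beta))).
      have half : (`|y - x| / 2) `^ beta <= `|y - x| `^ beta.
        by rewrite powR_mono ?(ltW beta0) ?divr_ge0// ler_pdivrMr// ler_peMr// ler1n.
      apply: ler_wpM2l => //; apply: ler_pM => //.
        apply: (le_trans (ler_distD (F x (theta c)) _ _)); rewrite mulrDl; apply: lerD.
          apply: (le_trans (lf_time LF _ Xx Xxy)); apply: (ler_wpM2l G0).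
          by rewrite norm_midl.
        apply: (le_trans (lf_state LF _ _ Xx)); rewrite -mulrA; apply: (ler_wpM2l G0).
        apply: (le_trans (Ht _ _ Xx Xxy)); apply: (ler_wpM2l Ct0).
        by rewrite norm_midl.
      apply: (le_trans (hg Xxy Xy)); apply: (ler_wpM2l Cg0).
      by rewrite norm_midr.
    by rewrite /C; ring.
  - move=> e e0; have [dl dl0 Hdl] := remo _ e0; exists dl => // x y Xx Xy xy.
    have [->|yx] := eqVneq y x; first by rewrite /N rem0// normr0 mulr_ge0// ltW.
    have yx0 : 0 < `|y - x| by rewrite normr_gt0 subr_eq0.
    by have := Hdl x y Xx Xy; rewrite yx0 xy ler_pdivrMr//; exact.
have K0 : 0 <= C * sewing_const (beta + beta) by rewrite mulr_ge0// ltW// sewing_const_gt0.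
exists (C * sewing_const (beta + beta)); split=> // p q Xp Xq pq.
have -> : theta q - euler g F p q (theta p) =
    (theta q - theta p) - F p (theta p) *m (g q - g p) by rewrite /euler opprD addrA.
apply: (le_trans (key _ _ Xp Xq)); apply: ler_wpM2l => //.
by apply: powR_anti => //; [rewrite kappaE addr_gt0// mulr_gt0|rewrite normr_ge0].
Qed.

End Solutions.

Theorem theorem4p3 (R : realType) (I : set R)
  (hI : is_interval I) (hIb : bounded_set I)
  (m k d : nat) (hm : (1 <= m)%N) (hk : (1 <= k)%N) (hd : (1 <= d)%N)
  (beta gamma : R) (hbeta : 0 < beta <= 1) (hgamma : 0 < gamma <= 1)
  (hbg : 2 < beta * (2 + gamma))
  (g : 'cV[R]_m -> 'cV[R]_k) (hg : holder_on beta (cube I) g)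
  (hclosed : forall i j : 'I_k, i != j ->
     forall p v1 v2 : 'cV[R]_m, axis_rectangle_in (cube I) p v1 v2 ->
       parallelogram_boundary_integral
         (fun x => g x i 0) (fun x => g x j 0) p v1 v2 = 0)
  (f : 'cV[R]_m * 'cV[R]_d -> 'M[R]_(d, k))
  (Df : 'cV[R]_m * 'cV[R]_d -> 'M[R]_(d * k, k + d))
  (hDf : is_gderivative (cube I `*` setT) (extend_map g)
           (fun x => flatten_mx (f x)) Df)
  (hDfgamma : holder_on gamma (cube I `*` setT) Df)
  (p0 : 'cV[R]_m) (hp0 : cube I p0) (vartheta : 'cV[R]_d) :
  exists theta : 'cV[R]_m -> 'cV[R]_d,
    is_solution I beta g f p0 vartheta theta /\
    (forall theta' : 'cV[R]_m -> 'cV[R]_d,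
       is_solution I beta g f p0 vartheta theta' ->
       forall p, cube I p -> theta' p = theta p).
Proof.
have /andP[beta0 beta1] := hbeta; have /andP[gamma0 gamma1] := hgamma.
pose kappa := beta + beta * gamma; pose zeta := kappa + beta.
have kappaE : kappa = beta + beta * gamma by [].
have zetaE : zeta = kappa + beta by [].
have zeta2 : 2 < zeta by move: hbg; rewrite (_ : beta * _ = zeta)// /zeta /kappa; ring.
have kappa1 : 1 < kappa by move: zeta2; rewrite zetaE; lra.
have bg1 : 1 < beta + gamma.
  by rewrite (lt_le_trans kappa1)// kappaE lerD2l ger_pMl.
have bb1 : 1 < beta + beta by rewrite (lt_le_trans kappa1)// kappaE lerD2l ger_pMr.
have kb : beta <= kappa by rewrite kappaE lerDl mulr_ge0// ltW.
have Xm := @cube_midpoint_closed R m I hI; have Xbd := @cube_bounded R m I hIb.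
have [D HD] := Xbd; have [Cg1 [Cg10 Hg1]] := holder_bound hg.
have [H [CH [CH0 HH]]] := area_potential hI hp0 beta0 bb1 hg hclosed.
pose Cg := Cg1 + CH; have Cg0 : 0 <= Cg by exact: addr_ge0.
have hg' p q : cube I p -> cube I q -> `|g q - g p| <= Cg * `|q - p| `^ beta.
  by move=> Ip Iq; rewrite (le_trans (Hg1 _ _ Ip Iq))// ler_wpM2r ?powR_ge0// lerDl.
have hH p q : cube I p -> cube I q -> `|area g H p q| <= Cg * `|q - p| `^ (beta + beta).
  by move=> Ip Iq; rewrite (le_trans (HH _ _ Ip Iq))// ler_wpM2r ?powR_ge0// lerDr.
have [A [B [B0 TF]]] := gderivative_taylor hbeta hgamma bg1 Xm hg hDf hDfgamma.
pose F p a := f (p, a); rewrite -/F in TF.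
have [G [G0 LF]] := taylor_lipschitz_field hbeta hgamma Cg0 Xbd hg' hp0 B0 TF.
have [C [C1 HC]] := euler_almost_flow (d := d) hbeta hgamma kappaE Xm Cg0 hg' G0.
have [M [M1 HM]] := @dyadic_growth R 'cV[R]_m d C beta kappa D C1 beta0 kb kappa1.
pose chi rho p a := F p (truncate_state rho a).
have B30 : 0 <= 3 * B by rewrite mulr_ge0.
have flow rho : 0 <= rho ->
    exists (phi : 'cV[R]_m -> 'cV[R]_m -> 'cV[R]_d -> 'cV[R]_d) (K h0 : R),
    [/\ 0 <= K, 0 < h0 <= 1,
      forall p q a, cube I p -> cube I q -> `|q - p| <= h0 ->
        `|phi p q a - euler g (chi rho) p q a| <= K * `|q - p| `^ kappa,
      forall p q r a, cube I p -> cube I q -> cube I r -> phi q r (phi p q a) = phi p r a &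
      (forall p q a b M, cube I p -> cube I q ->
         (forall n, `|dyadic (euler g (chi rho)) n p q a - b| <= M) ->
         `|phi p q a - b| <= M) /\
      (forall (theta : 'cV[R]_m -> 'cV[R]_d) (C : R), 0 <= C ->
         (forall p q, cube I p -> cube I q -> `|q - p| <= 1 ->
           `|theta q - euler g (chi rho) p q (theta p)| <= C * `|q - p| `^ kappa) ->
         forall p q, cube I p -> cube I q -> theta q = phi p q (theta p))].
  move=> rho0; have [_ LF0] := lipschitz_field_truncate G0 rho0 LF.
  have G20 : 0 <= G * (rho + 2) by rewrite mulr_ge0// addr_ge0.
  exact: (field_flow hbeta hgamma kappaE zetaE zeta2 Xm Cg0 Xbd hg' hH G20 B30 LF0
    (taylor_field_truncate rho hgamma B0 TF)).
(* Two solutions are bounded, so they are trajectories of one truncated field. *)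
have unique th1 th2 : is_solution I beta g f p0 vartheta th1 ->
    is_solution I beta g f p0 vartheta th2 -> forall p, cube I p -> th1 p = th2 p.
  move=> [ho1 i1 o1] [ho2 i2 o2] p Ip.
  have [[[b1 Hb1] _] [[b2 Hb2] _]] := (ho1, ho2).
  have rho0 : 0 <= `|b1| + `|b2| by exact: addr_ge0.
  have [phi [K [h0 [_ _ _ _ [_ traj]]]]] := flow _ rho0.
  have sol th b : holder_on beta (cube I) th -> th p0 = vartheta ->
      little_o_on (cube I) (fun p q => (th q - th p) - f (p, th p) *m (g q - g p)) ->
      (forall p, cube I p -> `|th p| <= b) -> b <= `|b1| + `|b2| -> th p = phi p0 p vartheta.
    move=> ho i o Hb bb; rewrite -i.
    have [C' [C'0 HC']] := solution_remainder hbeta hgamma kappaE kappa1 Xm Cg0 hg' G0 LF ho o.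
    apply: (traj th C' C'0) => // x y Ix Iy xy.
    rewrite /euler /chi truncate_state_id; first exact: HC'.
    by rewrite (le_trans (Hb _ Ix)).
  rewrite (sol th1 b1)// ?(sol th2 b2)//.
    by rewrite (le_trans (ler_norm b2))// lerDr.
  by rewrite (le_trans (ler_norm b1))// lerDl.
(* By the uniform growth bound the flow of the field truncated at this radius,
   started at the initial value, never feels the truncation. *)
pose rho := M * (1 + `|vartheta|).
have rho0 : 0 <= rho by rewrite mulr_ge0 ?addr_ge0// (le_trans ler01).
have rhoE : M * (1 + `|vartheta|) <= rho by [].
clearbody rho; have [phi [K [h0 [K0 /andP[h00 h01] near grp [bd _]]]]] := flow _ rho0.
have [LF1 _] := lipschitz_field_truncate G0 rho0 LF.
have l11 : 0 <= (1 : R) <= 1 by rewrite ler01 lexx.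
have AF := HC _ _ l11 LF1.
pose theta p := phi p0 p vartheta.
have thb p : cube I p -> `|theta p| <= rho.
  move=> Ip; have := bd p0 p vartheta 0 rho hp0 Ip; rewrite subr0; apply=> n; rewrite subr0.
  have := HM _ _ Xm AF n p0 p vartheta hp0 Ip (HD _ _ hp0 Ip).
  by move=> H1; apply: le_trans rhoE; apply: le_trans H1; rewrite lerDr.
have rem p q : cube I p -> cube I q -> `|q - p| <= h0 ->
    `|(theta q - theta p) - f (p, theta p) *m (g q - g p)| <= K * `|q - p| `^ kappa.
  move=> Ip Iq pq; have := near p q (theta p) Ip Iq pq.
  rewrite grp// -/(theta q) /euler /chi truncate_state_id ?thb//.
  by rewrite opprD addrA.
have sol : is_solution I beta g f p0 vartheta theta.
  split.
  - split; first by exists rho.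
    pose C2 := k%:R * (G * (1 + rho)) * Cg.
    have C20 : 0 <= C2.
      by apply: mulr_ge0 => //; apply: mulr_ge0 => //; apply: mulr_ge0 => //; exact: addr_ge0.
    have h0b : 0 < h0 `^ beta by exact: powR_gt0.
    have far0 : 0 <= (rho + rho) / h0 `^ beta by apply: divr_ge0; [exact: addr_ge0|exact: ltW].
    exists (K + C2 + (rho + rho) / h0 `^ beta) => p q Ip Iq pq.
    have d0 : 0 < `|q - p| by rewrite normr_gt0 subr_eq0 eq_sym.
    have db : 0 < `|q - p| `^ beta by exact: powR_gt0.
    have [pqh|/ltW pqh] := leP `|q - p| h0.
      rewrite ler_pdivrMr// -[theta q - _](subrK (f (p, theta p) *m (g q - g p))).
      apply: (le_trans (ler_normD _ _)).
      apply: (@le_trans _ _ (K * `|q - p| `^ beta + C2 * `|q - p| `^ beta)); last first.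
        by rewrite -mulrDl ler_wpM2r ?powR_ge0// lerDl.
      apply: lerD.
        rewrite (le_trans (rem _ _ Ip Iq pqh))// ler_wpM2l// powR_anti//.
        by rewrite normr_ge0 (le_trans pqh).
      apply: (le_trans (mulmx_norm _ _)).
      rewrite [leRHS](_ : _ = k%:R * (G * (1 + rho) * (Cg * `|q - p| `^ beta))); last first.
        by rewrite /C2; ring.
      apply: ler_wpM2l => //; apply: ler_pM => //; last exact: hg'.
      rewrite (le_trans (lf_growth LF (theta p) Ip))// ler_wpM2l// lerD2l mul1r.
      exact: thb.
    apply: (@le_trans _ _ ((rho + rho) / h0 `^ beta)); last first.
      by rewrite lerDr addr_ge0.
    apply: (ler_pM (normr_ge0 _)); first by rewrite invr_ge0 ltW.
      by rewrite (le_trans (ler_normB _ _))// lerD// thb.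
    by rewrite lef_pV2 ?posrE// powR_mono// ltW.
  - apply/eqP; rewrite -subr_eq0 -normr_le0.
    have := near p0 p0 vartheta hp0 hp0; rewrite /euler !subrr normr0 mulmx0 addr0.
    by rewrite powR0 ?mulr0 ?gt_eqF ?(lt_trans ltr01)//; apply; exact: ltW.
  - split=> [p Ip|e e0]; first by rewrite !subrr mulmx0 subrr.
    have [dl dl0 Hdl] := powR_little K0 ltr01 kappa1 e0.
    exists (Num.min dl h0); first by rewrite lt_min dl0.
    move=> p q Ip Iq; rewrite le_min => /and3P[pq0 pqd pqh].
    rewrite ler_pdivrMr// (le_trans (rem _ _ Ip Iq pqh))//.
    by have := Hdl `|q - p|; rewrite powRr1//; apply; rewrite normr_ge0.
exists theta; split=> // theta' sol' p Ip.
exact: unique.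
Qed.
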